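(* Let $\Sigma_h^\alpha\subset\Sigma^\alpha$, $V_h^\alpha\subset V^\alpha$, $W_h^\beta=W_{1h}^\beta\times W_{2h}^\beta$ with $W_{1h}^\beta\subset H^1_0(\beta;\mathbb R^2)$, $W_{2h}^\beta\subset H^2_0(\beta)$ be conforming finite element spaces. Assume that, with constants $C>0$ independent of the mesh sizes, $$(\mathcal C_0^{-1}\tau_h,\tau_h)_\alpha\ge C\|\tau_h\|_{\operatorname{div},\alpha}^2\quad\text{for all }\tau_h\in B_h^c:=\{\tau_h\in\Sigma_h^\alpha:(\operatorname{div}\tau_h,v_h)_\alpha=0\ \forall v_h\in V_h^\alpha\},$$ $$\inf_{v_h\in V_h^\alpha}\sup_{\tau_h\in\Sigma_h^\alpha}\frac{(\operatorname{div}\tau_h,v_h)_\alpha}{\|v_h\|_{0,\alpha}\|\tau_h\|_{\operatorname{div},\alpha}}\ge C.$$ Then the conforming finite element method is well-posed: for all $f^\alpha\in L^2(\alpha;\mathbb R^3)$, $f^\beta\in L^2(\beta;\mathbb R^3)$ there is a unique $(\sigma_h^\alpha,u_h^\alpha,u_h^\beta)\in\Sigma_h^\alpha\times V_h^\alpha\times W_h^\beta$ with $$a(\sigma_h^\alpha,u_h^\beta;\tau_h^\alpha,v_h^\beta)+b(u_h^\alpha;\tau_h^\alpha,v_h^\beta)=(f^\beta,v_h^\beta)_\beta,\qquad b(v_h^\alpha;\sigma_h^\alpha,u_h^\beta)=-(f^\alpha,v_h^\alpha)_\alpha$$ for all $(\tau_h^\alpha,v_h^\alpha,v_h^\beta)\in\Sigma_h^\alpha\times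 V_h^\alpha\times W_h^\beta$, and $$|||(\sigma_h^\alpha,u_h^\beta)|||+\|u_h^\alpha\|_{0,\alpha}\le C(\|f^\alpha\|_{0,\alpha}+\|f^\beta\|_{0,\beta})$$ with $C$ independent of the data and the mesh sizes.
   Context: Geometry: $\alpha\subset\mathbb R^3$ is a bounded polyhedron (elastic body); $\beta$ is a bounded polygon in the $(x_1,x_2)$-plane (plate), viewed as a planar subset of $\mathbb R^3$ orthogonal to the $x_3$ direction. They are rigidly joined along the interface $\Gamma$, a planar part (face) of $\partial\alpha$ contained in $\beta$. $n^\alpha,n^\beta$ are the unit outward normals of $\partial\alpha,\partial\beta$; $\partial_{n^\beta}v=\nabla v\cdot n^\beta$. Indices $i,j,l\in\{1,2,3\}$, $I,J,L\in\{1,2\}$; repeated indices are summed. $\mathbb S$ is the space of symmetric $3\times3$ real matrices. $\|\cdot\|_{m,G},|\cdot|_{m,G}$ are the $H^m(G)$ norm and seminorm, $(\cdot,\cdot)_G$ the $L^2(G)$ inner product, $\langle\cdot,\cdot\rangle_{\partial\alpha}$ the duality between $H^{-1/2}(\partial\alpha;\mathbb R^3)$ and $H^{1/2}(\partial\alpha;\mathbb R^3)$. Material laws: $E_\alpha,E_\beta,t_\beta>0$ and $\nu_\alpha,\nu_\beta\in(0,1/2)$ are constants. For the body, $\mathcal C_0:\mathbb S\to\mathbb S$ is $(\mathcal C_0\varepsilon)_{ij}=\frac{E_\alpha}{1+\nu_\alpha}\varepsilon_{ij}+\frac{E_\alpha\nu_\alpha}{(1+\nu_\alpha)(1-2\nu_\alpha)}\varepsilon_{ll}\delta_{ij}$,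 with inverse $\mathcal C_0^{-1}$. For the plate, with $v=(v_1,v_2,v_3)$: $\varepsilon^\beta_{IJ}(v)=\frac12(\partial_Iv_J+\partial_Jv_I)$, $\sigma^\beta_{IJ}(v)=\frac{E_\beta t_\beta}{1-\nu_\beta^2}\big((1-\nu_\beta)\varepsilon^\beta_{IJ}(v)+\nu_\beta\varepsilon^\beta_{LL}(v)\delta_{IJ}\big)$, $K^\beta_{IJ}(v)=-\partial^2v_3/\partial x_I\partial x_J$, $M^\beta_{IJ}(v)=\frac{E_\beta t_\beta^3}{12(1-\nu_\beta^2)}\big((1-\nu_\beta)K^\beta_{IJ}(v)+\nu_\beta K^\beta_{LL}(v)\delta_{IJ}\big)$. Spaces: $H(\operatorname{div},\alpha;\mathbb S)=\{\tau\in L^2(\alpha;\mathbb S):\operatorname{div}\tau\in L^2(\alpha;\mathbb R^3)\}$ (row-wise divergence) with $\|\tau\|_{\operatorname{div},\alpha}^2=\|\tau\|_{0,\alpha}^2+\|\operatorname{div}\tau\|_{0,\alpha}^2$. $H^{1/2}_{00}(\partial\alpha\setminus\Gamma;\mathbb R^3)$ is the set of $v\in H^{1/2}(\partial\alpha\setminus\Gamma;\mathbb R^3)$ whose extension by zero to $\partial\alpha$ lies in $H^{1/2}(\partial\alpha;\mathbb R^3)$. $\Sigma^\alpha=\{\tau\in H(\operatorname{div},\alpha;\mathbb S):\langle\tau n^\alpha,v\rangle_{\partial\alpha}=0\ \forall v\in H^{1/2}_{00}(\partial\alpha\setminus\Gamma;\mathbb R^3)\}$ ($v$ extended by zero). $V^\alpha=L^2(\alpha;\mathbb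 R^3)$. $W^\beta=H^1_0(\beta;\mathbb R^2)\times H^2_0(\beta)$, where $H^2_0(\beta)=\{v\in H^2(\beta):v=\partial_{n^\beta}v=0\text{ on }\partial\beta\}$. For $v\in H^1(\beta;\mathbb R^3)$, $\hat v\in H^{1/2}(\partial\alpha;\mathbb R^3)$ denotes an extension of $v|_\Gamma$ to $\partial\alpha$ that is bounded: $\|\hat v\|_{1/2,\partial\alpha}\le C\|v\|_{1,\beta}$. Forms and norm: $a(\sigma,u;\tau,v)=(\mathcal C_0^{-1}\sigma,\tau)_\alpha+(\sigma^\beta(u),\varepsilon^\beta(v))_\beta+(M^\beta(u),K^\beta(v))_\beta+\langle\sigma n^\alpha,\hat v\rangle_{\partial\alpha}-\langle\tau n^\alpha,\hat u\rangle_{\partial\alpha}$ for $(\sigma,u),(\tau,v)\in\Sigma^\alpha\times W^\beta$; $b(w;\tau,v)=(\operatorname{div}\tau,w)_\alpha$ for $w\in V^\alpha$; $|||(\tau,v)|||^2=\|\tau\|_{\operatorname{div},\alpha}^2+\sum_{I=1}^2|v_I|_{1,\beta}^2+|v_3|_{2,\beta}^2$. The finite element spaces are finite-dimensional spaces of piecewise polynomials on shape-regular tetrahedral meshes $\mathcal T_h^\alpha$ of $\alpha$ and triangular meshes $\mathcal T_h^\beta$ of $\beta$ (not required to match on $\Gamma$), with maximal diameters $h_\alpha,h_\beta$. Infima and suprema are over nonzero elements. *)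

(* Defs.v *)
From HB Require Import structures.
From mathcomp Require Import all_boot all_order all_algebra.
From mathcomp Require Import all_classical all_reals all_analysis.
From mathcomp Require Import measurable_realfun.
Set Implicit Arguments.
Unset Strict Implicit.
Unset Printing Implicit Defensive.
Import Order.TTheory GRing.Theory Num.Theory.
Import numFieldNormedType.Exports.
Local Open Scope classical_set_scope.
Local Open Scope ring_scope.

Definition rV_display : measure_display.
Proof. exact: default_measure_display. Qed.

Section rV_measurable.
Context (R : realType) (n : nat).

Let coord (i : 'I_n) (x : 'rV[R]_n) : R := x ord0 i.

Let rV_set0 : g_sigma_preimage coord set0.
Proof. exact: sigma_algebra0. Qed.

Let rV_setC A : g_sigma_preimage coord A -> g_sigma_preimage coord (~` A).
Proof. exact: sigma_algebraC. Qed.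

Let rV_bigcup (F : (set 'rV[R]_n)^nat) :
  (forall i, g_sigma_preimage coord (F i)) ->
  g_sigma_preimage coord (\bigcup_i (F i)).
Proof. exact: sigma_algebra_bigcup. Qed.

(* The sigma-algebra generated by the coordinates, that is, the Borel sets. *)
HB.instance Definition _ := @isMeasurable.Build rV_display
  'rV[R]_n (g_sigma_preimage coord) rV_set0 rV_setC rV_bigcup.

Lemma measurable_coord (i : 'I_n) :
  measurable_fun [set: 'rV[R]_n] (fun x : 'rV[R]_n => x ord0 i).
Proof.
move=> _ Y mY; rewrite setTI; apply: sub_sigma_algebra => /=.
rewrite -bigcup_seq/=; exists i => /=; first by rewrite mem_index_enum.
by exists Y => //; rewrite setTI.
Qed.

Lemma measurable_fun_rV d (T : measurableType d) (f : T -> 'rV[R]_n) :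
  (forall i, measurable_fun [set: T] (fun x => f x ord0 i)) ->
  measurable_fun [set: T] f.
Proof.
move=> mf; apply: (@measurability _ _ _ _ _ _
  (\big[setU/set0]_(i < n) preimage_set_system setT (coord i) measurable)) => //.
move=> _ [B + <-]; rewrite -bigcup_seq => -[i _ [Y mY <-]].
by rewrite setTI -comp_preimage; exact: (mf i measurableT Y mY).
Qed.

End rV_measurable.

Section lebesgue_rV.
Context (R : realType).

Definition snoc n (p : 'rV[R]_n * R) : 'rV[R]_n.+1 :=
  \row_j oapp (p.1 ord0) p.2 (unlift ord_max j).

Lemma measurable_snoc n : measurable_fun setT (@snoc n).
Proof.
apply: measurable_fun_rV => i; rewrite /snoc.
case: (unliftP ord_max i) => [k|] ->.
- under eq_fun do rewrite mxE liftK /=.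
  exact: (measurableT_comp (measurable_coord k) measurable_fst).
- under eq_fun do rewrite mxE unlift_none /=.
  exact: measurable_snd.
Qed.

Definition image_measure d d' (T : measurableType d) (U : measurableType d')
    (mu : {measure set T -> \bar R}) (f : T -> U) (mf : measurable_fun setT f) :
    {measure set U -> \bar R} :=
  @Measure.clone _ _ _ (pushforward mu f)
    (measure_function_pushforward__canonical__measure_function_Measure mu mf).

Fixpoint leb n : {measure set 'rV[R]_n -> \bar R} :=
  if n is m.+1
  then image_measure (leb m \x lebesgue_measure)%E (@measurable_snoc m)
  else dirac (0 : 'rV[R]_0).
End lebesgue_rV.


Section geometry.
Context (R : realType).

(* The norm of the library on 'rV[R]_n is the sup norm. *)
Definition eucl n (x : 'rV[R]_n) : R := Num.sqrt (\sum_i x ord0 i ^+ 2).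

Definition hull n (A : seq 'rV[R]_n) : set 'rV[R]_n :=
  [set x | exists t : 'rV[R]_n -> R,
    [/\ forall a, a \in A -> 0 <= t a,
        \sum_(a <- A) t a = 1 & x = \sum_(a <- A) t a *: a]].

Definition edge_mx m n (K : m.+1.-tuple 'rV[R]_n) : 'M[R]_(m, n) :=
  \matrix_(i < m) (tnth K (lift ord0 i) - tnth K ord0).

(* A face-to-face complex of nondegenerate m-simplices that covers A. *)
Definition triangulates m n (Th : seq (m.+1.-tuple 'rV[R]_n)) (A : set 'rV[R]_n) :=
  [/\ uniq Th,
      forall K, K \in Th -> row_free (edge_mx K),
      forall K L, K \in Th -> L \in Th -> {subset K <= L} -> K = L,
      forall K L, K \in Th -> L \in Th ->
        hull K `&` hull L = hull [seq a <- K | a \in L] &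
      A = [set x | exists2 K, K \in Th & hull K x]].

Definition bdry n (D : set 'rV[R]_n) : set 'rV[R]_n := closure D `\` D.

(* A bounded polygon (m = 1) or polyhedron (m = 2), as an open set D that comes
   with a triangulation bd of its boundary. *)
Definition polyhedral_domain m (D : set 'rV[R]_m.+1)
    (bd : seq (m.+1.-tuple 'rV[R]_m.+1)) :=
  [/\ [/\ open D, D !=set0, connected D & bounded_set D],
      D = interior (closure D),
      exists Th : seq (m.+2.-tuple 'rV[R]_m.+1), triangulates Th (closure D) &
      triangulates bd (bdry D)].

Definition ref_simplex m : set 'rV[R]_m :=
  [set y | (forall i, 0 <= y ord0 i) /\ \sum_i y ord0 i <= 1].

Lemma measurable_ref_simplex m : measurable (@ref_simplex m).
Proof.
have -> : @ref_simplex m =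
    (\bigcap_(i in [set: 'I_m]) ((fun y : 'rV[R]_m => y ord0 i) @^-1` `[0, +oo[)) `&`
    ((fun y : 'rV[R]_m => \sum_i y ord0 i) @^-1` `]-oo, 1]).
  apply/seteqP; split => y /=; rewrite in_itv /=.
    move=> [y0 y1]; split => // i _ /=.
    by rewrite in_itv /= andbT.
  move=> [y0 y1]; split => // i.
  by have := y0 i I; rewrite /= in_itv /= andbT.
apply: measurableI.
  apply: fin_bigcap_measurable => [|i _]; first exact: finite_finset.
  by rewrite -[X in measurable X]setTI; exact: measurable_coord.
rewrite -[X in measurable X]setTI.
have : measurable_fun setT (fun y : 'rV[R]_m => \sum_i y ord0 i).
  by apply: measurable_sum => i; exact: measurable_coord.
by apply.
Qed.

Definition facet_map m n (K : m.+1.-tuple 'rV[R]_n) (y : 'rV[R]_m) : 'rV[R]_n :=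
  tnth K ord0 + y *m edge_mx K.

Lemma measurable_facet_map m n (K : m.+1.-tuple 'rV[R]_n) :
  measurable_fun setT (facet_map K).
Proof.
apply: measurable_fun_rV => i; rewrite /facet_map.
under eq_fun do rewrite mxE mxE.
apply: measurable_funD => //; apply: measurable_sum => k.
by apply: measurable_funM => //; exact: measurable_coord.
Qed.

(* The Gram determinant is the square of the Jacobian of facet_map. *)
Definition facet_measure m n (K : m.+1.-tuple 'rV[R]_n) :
    {measure set 'rV[R]_n -> \bar R} :=
  mscale (NngNum (sqrtr_ge0 (\det (edge_mx K *m (edge_mx K)^T))))
    (image_measure (mrestr (leb R m) (@measurable_ref_simplex m))
       (measurable_facet_map K)).

Definition surf m n (bd : seq (m.+1.-tuple 'rV[R]_n)) :
    {measure set 'rV[R]_n -> \bar R} :=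
  foldr (fun K mu => measure_add (facet_measure K) mu : {measure set _ -> \bar R})
    (mzero : {measure set _ -> \bar R}) bd.

(* Near x, D is an open half-ball whose flat side is orthogonal to nu. *)
Definition outward_normal n (D : set 'rV[R]_n) (x nu : 'rV[R]_n) :=
  eucl nu = 1 /\ exists2 r : R, 0 < r & forall y, eucl (y - x) < r ->
    (D y <-> \sum_i (y - x) ord0 i * nu ord0 i < 0).

Definition diam n (A : set 'rV[R]_n) : R :=
  sup [set r | exists x y, [/\ A x, A y & r = eucl (x - y)]].

Definition inradius n (A : set 'rV[R]_n) : R :=
  sup [set r | exists2 c, 0 <= r & forall y, eucl (y - c) <= r -> A y].

Definition shape_regular n (kappa : R) (Th : seq (n.+1.-tuple 'rV[R]_n)) :=
  forall K, K \in Th -> diam (hull K) <= kappa * inradius (hull K).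

End geometry.

Section sobolev.
Context (R : realType) (n : nat).
Implicit Types (D : set 'rV[R]_n) (u v f g phi : 'rV[R]_n -> R).

Section L2.
Context (mu : {measure set 'rV[R]_n -> \bar R}) (D : set 'rV[R]_n).

Definition L2 f :=
  measurable_fun D f /\ mu.-integrable D (fun x => (f x ^+ 2)%:E).

Definition inner f g : R := \int[mu]_(x in D) (f x * g x).

Definition norm0 f : R := Num.sqrt (inner f f).

Section fields.
Context (p q : nat).
Implicit Types F G : 'rV[R]_n -> 'M[R]_(p, q).

Definition L2m F := forall i j, L2 (fun x => F x i j).

Definition innerm F G : R :=
  \sum_i \sum_j inner (fun x => F x i j) (fun x => G x i j).

Definition norm0m F : R := Num.sqrt (innerm F F).

End fields.
End L2.

Let lambda : {measure set 'rV[R]_n -> \bar R} := leb R n.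

Definition partial (i : 'I_n) f : 'rV[R]_n -> R :=
  fun x => 'D_(delta_mx ord0 i) f x.

Definition smooth f := forall s : seq 'I_n,
  continuous (foldr partial f s) /\
  forall i x, derivable (foldr partial f s) x (delta_mx ord0 i).

Definition test_function D phi := smooth phi /\
  exists K, [/\ compact K, K `<=` D & forall x, ~ K x -> phi x = 0].

Definition weak_partial D i u g := L2 lambda D g /\
  forall phi, test_function D phi ->
    inner lambda D u (partial i phi) = - inner lambda D g phi.

(* The weak derivative is determined up to a null set; wD chooses one. *)
Definition wD D i u : 'rV[R]_n -> R := xget (fun=> 0) (weak_partial D i u).

Definition H1 D u := L2 lambda D u /\ forall i, exists g, weak_partial D i u g.

Definition H1_semi D u : R := Num.sqrt (\sum_i norm0 lambda D (wD D i u) ^+ 2).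

Definition H1_norm D u : R :=
  Num.sqrt (norm0 lambda D u ^+ 2 + H1_semi D u ^+ 2).

Definition H10 D u := H1 D u /\
  exists2 phi : nat -> ('rV[R]_n -> R), (forall k, test_function D (phi k)) &
    (fun k => H1_norm D (fun x => u x - phi k x)) @ \oo --> (0 : R).

Definition H2 D u := H1 D u /\ forall i, H1 D (wD D i u).

Definition H2_semi D u : R :=
  Num.sqrt (\sum_i \sum_j norm0 lambda D (wD D j (wD D i u)) ^+ 2).

Definition H1v m D (v : 'rV[R]_n -> 'rV[R]_m) :=
  forall i, H1 D (fun x => v x ord0 i).

Definition H1v_norm m D (v : 'rV[R]_n -> 'rV[R]_m) : R :=
  Num.sqrt (\sum_i H1_norm D (fun x => v x ord0 i) ^+ 2).

(* g = div tau, row by row, in the sense of distributions. *)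
Definition weak_div D (tau : 'rV[R]_n -> 'M[R]_n) (g : 'rV[R]_n -> 'rV[R]_n) :=
  L2m lambda D g /\
  forall i phi, test_function D phi ->
    \sum_j inner lambda D (fun x => tau x i j) (partial j phi) =
    - inner lambda D (fun x => g x ord0 i) phi.

Definition wdiv D (tau : 'rV[R]_n -> 'M[R]_n) : 'rV[R]_n -> 'rV[R]_n :=
  xget (fun=> 0) (weak_div D tau).

Definition Hdiv D (tau : 'rV[R]_n -> 'M[R]_n) :=
  [/\ L2m lambda D tau, forall x, D x -> (tau x)^T = tau x &
      exists g : 'rV[R]_n -> 'rV[R]_n, weak_div D tau g].

Definition Hdiv_norm D (tau : 'rV[R]_n -> 'M[R]_n) : R :=
  Num.sqrt (norm0m lambda D tau ^+ 2 + norm0m lambda D (wdiv D tau) ^+ 2).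

End sobolev.

Section traces.
Context (R : realType) (m : nat) (D : set 'rV[R]_m.+1)
  (bd : seq (m.+1.-tuple 'rV[R]_m.+1)).
Let n := m.+1.
Implicit Types (u g : 'rV[R]_n -> R) (E v : 'rV[R]_n -> 'rV[R]_n).

(* The trace operator is the continuous extension to H^1(D) of the restriction
   of smooth functions to the boundary, with values in L^2 of the boundary. *)
Definition has_trace u g := L2 (surf bd) (bdry D) g /\
  exists uk : nat -> ('rV[R]_n -> R), [/\ forall k, smooth (uk k),
    (fun k => H1_norm D (fun x => uk k x - u x)) @ \oo --> (0 : R) &
    (fun k => norm0 (surf bd) (bdry D) (fun x => uk k x - g x)) @ \oo --> (0 : R)].

Definition normal_derivative_zero u := exists2 g : 'rV[R]_n -> 'rV[R]_n,
  forall i, has_trace (wD D i u) (fun x => g x ord0 i) &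
  {ae surf bd, forall x, bdry D x -> forall nu, outward_normal D x nu ->
    \sum_(i < n) g x ord0 i * nu ord0 i = 0}.

(* The condition u = 0 on the boundary is membership in H^1_0. *)
Definition H20 u := [/\ H2 D u, H10 D u & normal_derivative_zero u].

Definition lifting v E := H1v D E /\
  forall i, has_trace (fun x => E x ord0 i) (fun x => v x ord0 i).

(* H^{1/2} of the boundary is the range of the trace operator, with the
   quotient norm. *)
Definition Hhalf v := exists E, lifting v E.

Definition Hhalf_norm v : R := inf [set H1v_norm D E | E in lifting v].

Definition Hhalf_on (S : set 'rV[R]_n) v := exists2 w, Hhalf w &
  {ae surf bd, forall x, S x -> w x = v x}.

Definition H00half (S : set 'rV[R]_n) v :=
  Hhalf_on (bdry D `\` S) v /\ Hhalf (patch (fun=> 0) (~` S) v).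

Definition green (tau : 'rV[R]_n -> 'M[R]_n) E : R :=
  innerm (leb R n) D (wdiv D tau) E +
  \sum_i \sum_j inner (leb R n) D (fun x => tau x i j)
                    (wD D j (fun x => E x ord0 i)).

(* The normal trace of tau in H(div) is the functional on H^{1/2} given by the
   Green formula at an arbitrary lifting. *)
Definition normal_pairing_is tau v (r : R) :=
  forall E, lifting v E -> green tau E = r.

Definition normal_pairing tau v : R := xget 0 (normal_pairing_is tau v).

End traces.

Section finite_elements.
Context (R : realType) (n : nat) (D : set 'rV[R]_n) (V : lmodType R).
Implicit Types f : 'rV[R]_n -> V.

Definition polynomial_map f :=
  exists N (c : {ffun 'I_n -> 'I_N} -> V), forall x,
    f x = \sum_(a : {ffun 'I_n -> 'I_N}) (\prod_i x ord0 i ^+ a i) *: c a.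

Definition fe_space (Th : seq (n.+1.-tuple 'rV[R]_n)) (S : set ('rV[R]_n -> V)) :=
  [/\ S (fun=> 0),
      forall (a : R) f g, S f -> S g -> S (fun x => a *: f x + g x),
      exists N (b : 'I_N -> 'rV[R]_n -> V), (forall k, S (b k)) /\
        forall f, S f -> exists c : 'I_N -> R,
          {ae leb R n, forall x, D x -> f x = \sum_k c k *: b k x} &
      forall f, S f -> forall K, K \in Th -> exists2 p, polynomial_map p &
        {ae leb R n, forall x, hull K x -> f x = p x}].

End finite_elements.

Section model.
Context (R : realType).
Local Notation body_stress := ('rV[R]_3 -> 'M[R]_3).
Local Notation body_field := ('rV[R]_3 -> 'rV[R]_3).
Local Notation plate_field := ('rV[R]_2 -> 'rV[R]_3).

(* The plate lies in the plane x_3 = 0. *)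
Definition plane (x : 'rV[R]_2) : 'rV[R]_3 := snoc (x, 0).

Definition inplane (v : plate_field) : 'rV[R]_2 -> 'rV[R]_2 :=
  fun x => \row_I v x ord0 (lift ord_max I).

Definition deflection (v : plate_field) : 'rV[R]_2 -> R :=
  fun x => v x ord0 ord_max.

Section material.
Context (E nu t : R).

Definition C0 (e : 'M[R]_3) : 'M[R]_3 :=
  (E / (1 + nu)) *: e + (E * nu / ((1 + nu) * (1 - 2 * nu)) * \tr e)%:M.

Definition C0inv (s : 'M[R]_3) : 'M[R]_3 :=
  xget 0 [set e : 'M[R]_3 | e^T = e /\ C0 e = s].

Definition plate_law (k : R) (e : 'M[R]_2) : 'M[R]_2 :=
  k *: ((1 - nu) *: e + (nu * \tr e)%:M).

Section plate.
Context (beta : set 'rV[R]_2).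

Definition plate_strain (v : plate_field) : 'rV[R]_2 -> 'M[R]_2 := fun x =>
  \matrix_(I, J) (2^-1 * (wD beta I (fun y => inplane v y ord0 J) x +
                          wD beta J (fun y => inplane v y ord0 I) x)).

Definition plate_stress (v : plate_field) : 'rV[R]_2 -> 'M[R]_2 := fun x =>
  plate_law (E * t / (1 - nu ^+ 2)) (plate_strain v x).

Definition curvature (v : plate_field) : 'rV[R]_2 -> 'M[R]_2 := fun x =>
  \matrix_(I, J) - wD beta J (wD beta I (deflection v)) x.

Definition moment (v : plate_field) : 'rV[R]_2 -> 'M[R]_2 := fun x =>
  plate_law (E * t ^+ 3 / (12 * (1 - nu ^+ 2))) (curvature v x).

End plate.
End material.

Section spaces.
Context (alpha : set 'rV[R]_3) (bd_alpha : seq (3.-tuple 'rV[R]_3)).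
Context (beta : set 'rV[R]_2) (bd_beta : seq (2.-tuple 'rV[R]_2)).
Context (Gamma : set 'rV[R]_2).

(* Gamma is represented by its open planar interior. *)
Definition interface :=
  [/\ exists bd_Gamma, polyhedral_domain Gamma bd_Gamma,
      plane @` Gamma `<=` bdry alpha & Gamma `<=` beta].

Definition Sigma_alpha (tau : body_stress) := Hdiv alpha tau /\
  forall v, H00half alpha bd_alpha (plane @` Gamma) v ->
    normal_pairing_is alpha bd_alpha tau
      (patch (fun=> 0) (~` (plane @` Gamma)) v) 0.

Definition V_alpha (w : body_field) := L2m (leb R 3) alpha w.

Definition bounded_extension (hat : plate_field -> body_field) :=
  exists C : R, forall v, H1v beta v ->
    [/\ Hhalf alpha bd_alpha (hat v),
        {ae surf bd_alpha, forall x, forall y, Gamma y -> x = plane y ->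
          hat v x = v y} &
        Hhalf_norm alpha bd_alpha (hat v) <= C * H1v_norm beta v].

End spaces.

Section forms.
Context (Ea nua Eb nub tb : R).
Context (alpha : set 'rV[R]_3) (bd_alpha : seq (3.-tuple 'rV[R]_3)).
Context (beta : set 'rV[R]_2) (hat : plate_field -> body_field).
Implicit Types (s tau : body_stress) (u v : plate_field) (w : body_field).

Definition compliance s tau : R :=
  innerm (leb R 3) alpha (fun x => C0inv Ea nua (s x)) tau.

Definition form_a s u tau v : R :=
  compliance s tau
  + innerm (leb R 2) beta (plate_stress Eb nub tb beta u) (plate_strain beta v)
  + innerm (leb R 2) beta (moment Eb nub tb beta u) (curvature beta v)
  + normal_pairing alpha bd_alpha s (hat v)
  - normal_pairing alpha bd_alpha tau (hat u).

Definition form_b w tau v : R := innerm (leb R 3) alpha (wdiv alpha tau) w.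

Definition triple_norm tau v : R :=
  Num.sqrt (Hdiv_norm alpha tau ^+ 2
            + \sum_(I < 2) H1_semi beta (fun x => inplane v x ord0 I) ^+ 2
            + H2_semi beta (deflection v) ^+ 2).

Definition product_space (W1 : set ('rV[R]_2 -> 'rV[R]_2))
    (W2 : set ('rV[R]_2 -> R)) : set plate_field :=
  [set v | W1 (inplane v) /\ W2 (deflection v)].

Definition discrete_kernel (Sh : set body_stress) (Vh : set body_field) :=
  [set tau | Sh tau /\
    forall w, Vh w -> innerm (leb R 3) alpha (wdiv alpha tau) w = 0].

Definition inf_sup (Sh : set body_stress) (Vh : set body_field) : \bar R :=
  ereal_inf [set
    ereal_sup [set
      (innerm (leb R 3) alpha (wdiv alpha tau) w /
         (norm0m (leb R 3) alpha w * Hdiv_norm alpha tau))%:E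
      | tau in [set tau | Sh tau /\ Hdiv_norm alpha tau != 0]]
    | w in [set w | Vh w /\ norm0m (leb R 3) alpha w != 0]].

Definition discrete_solution (Sh : set body_stress) (Vh : set body_field)
    (Wh : set plate_field) (fa : body_field) (fb : plate_field) s w u :=
  [/\ Sh s, Vh w, Wh u,
      forall tau v, Sh tau -> Wh v ->
        form_a s u tau v + form_b w tau v = innerm (leb R 2) beta fb v &
      forall w', Vh w' -> form_b w' s u = - innerm (leb R 3) alpha fa w'].

End forms.
End model.

(* Main.v *)
From HB Require Import structures.
Require Import Defs.
From mathcomp Require Import all_boot all_order all_algebra.
From mathcomp Require Import all_classical all_reals all_analysis.
From mathcomp Require Import measurable_realfun ring lra.
Import Order.TTheory GRing.Theory Num.Theory.
Import numFieldNormedType.Exports.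

(** The discrete problem is a saddle point problem for the stress-displacement pair
    x = (sigma, u) and the multiplier w, and the two assumptions on the finite element
    spaces are made for the theory of Brezzi: a form that is bounded and coercive on the
    kernel of the constraint, and an inf-sup condition for the constraint, give a unique
    solution with a bound by a constant that depends only on the bounds of the forms, on the
    coercivity constant and on the inf-sup constant ([brezzi]). In finite dimension, existence is the
    statement that an injective square system is solvable ([galerkin_solvable]).

    The constraint involves the stress only, so the inf-sup condition for stresses is the one
    for pairs ([infsup_pair]), and the kernel consists of pairs whose stress is in the discrete
    kernel. On the diagonal the coupling terms of the form a cancel: what is left is the
    energy of the body, which is coercive on the discrete kernel by assumption, and the
    energy of the plate ([form_a_coercive]). The plate energy controls the plate norm by
    Korn's inequality for displacements that vanish on the boundary, which is integration by
    parts ([inner_wDC], [korn]). The triple norm contains seminorms of the plate displacement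
    only, and the Poincare inequality ([poincare], [H1_semi_le_H2_semi]) makes it control the
    norm in H1 that occurs in the bound of the load and of the coupling terms
    ([clamped_H1v_norm]).

    The coupling terms need the most care. The normal trace is a functional on traces, given by the
    Green formula at any lifting. For a stress whose normal trace vanishes off the interface
    it is well defined, because the condition on the normal trace also concerns the liftings
    of the zero function ([normal_pairingE]); it is bounded, because the norm of a trace is an
    infimum over liftings ([normal_pairing_bound]); and it depends on the values on the
    interface only. Therefore the pairing with the extended displacement is linear in the
    displacement even if the extension operator is not ([normal_pairing_linr]).

    Weak derivatives, traces and finite element bases are determined up to null sets. All
    the forms are therefore handled as semi-inner products on subspaces, in which null
    functions have norm zero, and the fundamental lemma of the calculus of variations
    ([du_bois_reymond]) makes weak derivatives unique and linear when they are tested against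
    square integrable functions. It rests on the integration by parts of smooth functions in
    several variables ([integral_partial_eq0]) and on smooth bump functions on boxes ([test_bump]). *)

Set Implicit Arguments.
Unset Strict Implicit.
Unset Printing Implicit Defensive.
Local Open Scope classical_set_scope.
Local Open Scope ring_scope.

(** * Borel sets and Lebesgue measure on row vectors *)

Section borel_rV.
Context (R : realType) (n : nat).
Implicit Types (x y : 'rV[R]_n) (U : set 'rV[R]_n).

Definition box M : set 'rV[R]_n := [set x | forall i, `|x ord0 i| <= M].

Lemma measurable_forall_coord (B : 'I_n -> set R) :
  (forall i, measurable (B i)) ->
  measurable [set x : 'rV[R]_n | forall i, B i (x ord0 i)].
Proof.
move=> mB.
have -> : [set x : 'rV[R]_n | forall i, B i (x ord0 i)] =
    \bigcap_(i in [set: 'I_n]) ((fun x : 'rV[R]_n => x ord0 i) @^-1` B i).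
  by apply/seteqP; split=> x /= h i *; apply: h.
apply: fin_bigcap_measurable => [|i _]; first exact: finite_finset.
by rewrite -[X in measurable X]setTI; exact: measurable_coord.
Qed.

Lemma coord_le_norm (x : 'rV[R]_n) i : `|x ord0 i| <= `|x|.
Proof.
rewrite [`|x|]mx_normrE; apply: (le_bigmax_cond _ (fun ij => `|x ij.1 ij.2|) (j := (ord0, i))) => //.
Qed.

Lemma norm_le_coord (x : 'rV[R]_n) M : 0 <= M ->
  (forall i, `|x ord0 i| <= M) -> `|x| <= M.
Proof.
move=> M0 h; rewrite [`|x|]mx_normrE; apply/bigmax_leP; split => // -[i j] _ /=.
by rewrite ord1.
Qed.

Lemma measurable_box M : measurable (box M).
Proof.
rewrite /box; apply: (@measurable_forall_coord (fun=> [set t | `|t| <= M])) => _.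
have -> : [set t : R | `|t| <= M] = `[- M, M]%classic.
  by apply/seteqP; split=> t /=; rewrite in_itv/= ler_norml.
exact: measurable_itv.
Qed.

Definition obox (a b : 'rV[R]_n) : set 'rV[R]_n :=
  [set x | forall i, a ord0 i < x ord0 i < b ord0 i].

Definition cbox (a b : 'rV[R]_n) : set 'rV[R]_n :=
  [set x | forall i, a ord0 i <= x ord0 i <= b ord0 i].

Lemma measurable_obox a b : measurable (obox a b).
Proof.
have -> : obox a b = [set x | forall i, `]a ord0 i, b ord0 i[%classic (x ord0 i)].
  by apply/seteqP; split=> x h i; have := h i; rewrite /= in_itv.
by apply: (@measurable_forall_coord (fun i => `]a ord0 i, b ord0 i[%classic)) => i; exact: measurable_itv.
Qed.

Definition ratr_mx (q : 'rV[rat]_n) : 'rV[R]_n := map_mx ratr q.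

(** Rational boxes are countably many, which brings statements on open sets down to
    boxes, both for measurability and for properties that hold almost everywhere. *)
Lemma open_bigcup_obox U : open U ->
  U = \bigcup_(q in [set q : 'rV[rat]_n * 'rV[rat]_n | cbox (ratr_mx q.1) (ratr_mx q.2) `<=` U])
        obox (ratr_mx q.1) (ratr_mx q.2).
Proof.
move=> oU; apply/seteqP; split=> [x Ux|x [q /= qU qx]]; last first.
  by apply: qU => i; have /andP[/ltW-> /ltW->] := qx i.
have /nbhs_ballP[e /= e0 eU] : nbhs x U by move: oU; rewrite openE; exact.
have e20 : 0 < e / 2 by rewrite divr_gt0.
have hr (s t : R) : s < t -> exists q : rat, s < ratr q < t.
  by move=> /rat_in_itvoo[q]; rewrite in_itv/=; exists q.
have ha i : exists q : rat, x ord0 i - e / 2 < ratr q < x ord0 i.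
  by apply: hr; rewrite gtrDl oppr_lt0.
have hb i : exists q : rat, x ord0 i < ratr q < x ord0 i + e / 2.
  by apply: hr; rewrite ltrDl.
have [a ax] := choice ha; have [b bx] := choice hb.
exists (\row_i a i, \row_i b i) => /=; last first.
  by move=> i; rewrite !mxE; have /andP[_ ->] := ax i; have /andP[->] := bx i.
move=> y hy; apply: eU; rewrite -ball_normE/= distrC.
apply: (@le_lt_trans _ _ (e / 2)); last by rewrite ltr_pdivrMr// ltr_pMr// ltr1n.
apply: norm_le_coord => [|i]; first exact: ltW.
have := hy i; have := ax i; have := bx i; rewrite !mxE ler_norml => /andP[_ h1] /andP[h2 _] /andP[h3 h4].
have /ltW := h1; have /ltW := h2; move: (e / 2) (ratr _) (ratr _) h3 h4.
by move=> *; lra.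
Qed.

Lemma open_measurable_rV U : open U -> measurable U.
Proof.
move=> /open_bigcup_obox ->; rewrite bigcup_mkcond.
apply: countable_bigcupT_measurable => [|q]; first exact: countableP.
by case: ifP => // _; exact: measurable_obox.
Qed.

Lemma continuous_measurable_rV (f : 'rV[R]_n -> R) :
  continuous f -> measurable_fun setT f.
Proof.
move=> cf; apply: (@measurability _ _ _ _ _ _ (@RGenOpens.G R)) => /=.
  exact: RGenOpens.measurableE.
move=> _ [_ [a [b ->]] <-]; rewrite setTI; apply: open_measurable_rV.
by apply: open_comp; [move=> x _; exact: cf|exact: itv_open].
Qed.

End borel_rV.

Section lebesgue_box.
Context (R : realType).

Lemma snocK n (x : 'rV[R]_n) (y : R) i : snoc (x, y) ord0 (lift ord_max i) = x ord0 i.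
Proof. by rewrite mxE liftK. Qed.

Lemma snoc_max n (x : 'rV[R]_n) (y : R) : snoc (x, y) ord0 ord_max = y.
Proof. by rewrite mxE unlift_none. Qed.

Lemma preimage_snoc_box n M :
  @snoc R n @^-1` box M = box M `*` `[- M, M]%classic.
Proof.
apply/seteqP; split => -[x y] /=; rewrite /box/= in_itv/= -ler_norml.
  move=> h; split => [i|]; first by rewrite -(snocK x y).
  by rewrite -(snoc_max x y).
move=> [hx hy] i; case: (unliftP ord_max i) => [k|] ->.
  by rewrite snocK.
by rewrite snoc_max.
Qed.

Lemma leb_box n M : (leb R n (box M) < +oo)%E.
Proof.
elim: n => [|n IH]; first by rewrite /= diracE; case: (_ \in _); rewrite ltry.
rewrite /= /pushforward preimage_snoc_box product_measure1E; last 2 first.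
  exact: measurable_box.
  exact: measurable_itv.
apply: lte_mul_pinfty => //; first by rewrite ge0_fin_numE// IH.
apply: (le_lt_trans (y := @lebesgue_measure R `[- M, M]%classic)) => //.
rewrite lebesgue_measure_itv/= lte_fin; case: ifP => _; last exact: ltry.
by rewrite -EFinB ltry.
Qed.

Lemma leb_sigma_finite n : sigma_finite [set: 'rV[R]_n] (leb R n).
Proof.
exists (fun k => box k%:R) => [|k]; last by split; [exact: measurable_box|exact: leb_box].
apply/seteqP; split=> // x _; exists (Num.bound `|x|) => // i.
apply: (le_trans (coord_le_norm x i)).
by rewrite ltW// archi_boundP.
Qed.

(** The product measure and the Fubini theorem take a measure bundled with the proof
    that it is sigma-finite. *)
Definition sigma_finite_leb n : {sigma_finite_measure set 'rV[R]_n -> \bar R} :=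
  HB.pack_for {sigma_finite_measure set 'rV[R]_n -> \bar R}
    (Measure.sort (leb R n))
    (isSFinite.Build _ _ _ _ (sfinite_measure_sigma_finite (@leb_sigma_finite n)))
    (isSigmaFinite.Build _ _ _ _ (@leb_sigma_finite n)).

Local Open Scope ereal_scope.

Lemma integrable_snoc n (f : 'rV[R]_n.+1 -> \bar R) :
  (leb R n.+1).-integrable setT f ->
  (sigma_finite_leb n \x lebesgue_measure).-integrable setT (f \o @snoc R n).
Proof.
move=> /integrableP[mf fi]; apply/integrableP; split.
  exact: (measurableT_comp mf (@measurable_snoc R n)).
move: fi; rewrite /= ge0_integral_pushforward//.
- exact: measurable_snoc.
- exact: measurableT_comp.
Qed.

Lemma integral_snoc n (f : 'rV[R]_n.+1 -> \bar R) :
  (leb R n.+1).-integrable setT f ->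
  \int[leb R n.+1]_x f x =
  \int[sigma_finite_leb n \x lebesgue_measure]_p f (snoc p).
Proof.
move=> fi; rewrite [LHS]integral_pushforward//.
- exact: measurable_snoc.
- by case/integrableP : fi.
- exact: (integrable_snoc fi).
Qed.

(** The two orders of integration are both of use: a derivative along the last
    coordinate is integrated in that coordinate first, any other derivative in that
    coordinate last. *)
Lemma integral_snoc12 n (f : 'rV[R]_n.+1 -> \bar R) :
  (leb R n.+1).-integrable setT f ->
  \int[leb R n.+1]_x f x =
  \int[leb R n]_x \int[lebesgue_measure]_y f (snoc (x, y)).
Proof.
move=> fi; rewrite integral_snoc// -integral12_prod_meas1//.
exact: integrable_snoc.
Qed.

Lemma integral_snoc21 n (f : 'rV[R]_n.+1 -> \bar R) :
  (leb R n.+1).-integrable setT f ->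
  \int[leb R n.+1]_x f x =
  \int[lebesgue_measure]_y \int[leb R n]_x f (snoc (x, y)).
Proof.
move=> fi; rewrite integral_snoc// -integral21_prod_meas1//.
exact: integrable_snoc.
Qed.

End lebesgue_box.

(** * Integrals of partial derivatives *)

Section derive_along.
Context (R : realType).

(** A directional derivative only sees the function on a line; the maps that insert a
    coordinate and the parametrized lines are affine, so no differentiability is
    involved. *)
Lemma derive_comp_affine (U V : normedModType R) (F : U -> R) (phi : V -> U)
    (a v : V) (w : U) :
  (forall h : R, phi (h *: v + a) = h *: w + phi a) ->
  (derivable (F \o phi) a v = derivable F (phi a) w) *
  ('D_v (F \o phi) a = 'D_w F (phi a)).
Proof.
move=> phiE; have E : (fun h : R => h^-1 *: ((F \o phi) (h *: v + a) - (F \o phi) a)) =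
    (fun h : R => h^-1 *: (F (h *: w + phi a) - F (phi a))).
  by apply/funext => h /=; rewrite phiE.
by split; [rewrite /derivable|rewrite /derive]; under eq_fun do rewrite /= phiE.
Qed.

Lemma lipschitz1_continuous (V W : normedModType R) (f : V -> W) :
  (forall x y, `|f x - f y| <= `|x - y|) -> continuous f.
Proof.
move=> fl x; apply/cvgrPdist_lt => e e0; near=> y.
apply: le_lt_trans (fl _ _) _; near: y.
by apply: cvgr_dist_lt => //; exact: cvg_id.
Unshelve. all: by end_near. Qed.

Lemma snoc_lipl n (y : R) (x x' : 'rV[R]_n) :
  `|snoc (x, y) - snoc (x', y)| <= `|x - x'|.
Proof.
apply: norm_le_coord => // i; case: (unliftP ord_max i) => [k|] ->; rewrite mxE [X in _ + X]mxE.
  by rewrite !snocK; apply: le_trans (coord_le_norm _ k); rewrite !mxE.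
by rewrite !snoc_max subrr normr0.
Qed.

Lemma snoc_lipr n (x : 'rV[R]_n) (y y' : R) :
  `|snoc (x, y) - snoc (x, y')| <= `|y - y'|.
Proof.
apply: norm_le_coord => // i; case: (unliftP ord_max i) => [k|] ->; rewrite mxE [X in _ + X]mxE.
  by rewrite !snocK subrr normr0.
by rewrite !snoc_max.
Qed.

Lemma snoc_deltal n (y : R) (x : 'rV[R]_n) (k : 'I_n) h :
  snoc (h *: delta_mx ord0 k + x, y) =
  h *: delta_mx ord0 (lift ord_max k) + snoc (x, y).
Proof.
apply/rowP => i; case: (unliftP ord_max i) => [j|] ->; rewrite 2![in RHS]mxE.
  by rewrite !snocK !mxE eqxx /= (inj_eq lift_inj).
by rewrite !snoc_max !mxE eqxx/= (negbTE (neq_lift _ _)) mulr0 add0r.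
Qed.

Lemma snoc_deltar n (y : R) (x : 'rV[R]_n) (h : R) :
  snoc (x, h *: 1 + y) = h *: delta_mx ord0 ord_max + snoc (x, y).
Proof.
apply/rowP => i; case: (unliftP ord_max i) => [j|] ->; rewrite 2![in RHS]mxE.
  by rewrite !snocK !mxE eqxx /= eq_sym (negbTE (neq_lift _ _)) mulr0 add0r.
by rewrite !snoc_max !mxE !eqxx.
Qed.

Lemma norm_snocl n (x : 'rV[R]_n) (y : R) : `|x| <= `|snoc (x, y)|.
Proof.
apply: norm_le_coord => // i; rewrite -(snocK x y); exact: coord_le_norm.
Qed.

Lemma norm_snocr n (x : 'rV[R]_n) (y : R) : `|y| <= `|snoc (x, y)|.
Proof. by rewrite -{1}(snoc_max x y); exact: coord_le_norm. Qed.

End derive_along.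

Section integral_derivative.
Context (R : realType).

Lemma compact_box n M : compact (@box R n M).
Proof.
have [M0|M0] := leP 0 M.
  have -> : @box R n M = closed_ball_ (fun x => `|x|) 0 M.
    apply/seteqP; split => x; rewrite /closed_ball_/= sub0r normrN.
      exact: norm_le_coord.
    by move=> h i; exact: le_trans (coord_le_norm _ _) h.
  apply: bounded_closed_compact.
    exists M; split; first exact: num_real.
    by move=> t Mt x; rewrite /closed_ball_/= sub0r normrN => /le_trans; apply; exact: ltW.
  exact: closed_closed_ball_.
case: n => [|n].
  by rewrite (_ : box M = [set 0]); [exact: compact_set1|apply/seteqP; split=> x // _; [rewrite thinmx0|case]].
rewrite (_ : box M = set0); first exact: compact0.
by apply/seteqP; split=> x // /(_ ord0); rewrite leNgt (lt_le_trans M0).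
Qed.

Lemma continuous_bounded_box n (f : 'rV[R]_n -> R) M : continuous f ->
  exists2 B, 0 <= B & forall x, box M x -> `|f x| <= B.
Proof.
move=> cf; have : compact (f @` box M).
  by apply: continuous_compact (@compact_box n M); exact: continuous_subspaceT.
move=> /compact_bounded[B [_ /(_ (`|B| + 1))]].
rewrite (le_lt_trans (ler_norm _)) ?ltrDl// => /(_ erefl) Bf.
by exists (`|B| + 1) => // x Mx; apply: Bf; exists x.
Qed.

(** The function is dominated by a multiple of the indicator of a box. *)
Lemma integrable_bounded_support n (f : 'rV[R]_n -> R) (B M : R) :
  measurable_fun setT f -> (forall x, `|f x| <= B) ->
  (forall x, M < `|x| -> f x = 0) -> (leb R n).-integrable setT (EFin \o f).
Proof.
move=> mf fB f0; have B0 : 0 <= B := le_trans (normr_ge0 _) (fB 0).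
apply: (@le_integrable _ _ _ _ _ _ _ (EFin \o (fun x => B * \1_(box `|M|) x))) => //.
- exact/measurable_EFinP.
- move=> x _; rewrite /comp/= lee_fin indicE.
  have [_|] := boolP (x \in _); first by rewrite mulr1 (ger0_norm B0).
  rewrite notin_setE => xM; rewrite mulr0 f0 ?normr0//.
  rewrite ltNge; apply/negP => xM'; apply: xM => i.
  by rewrite (le_trans (coord_le_norm _ _))// (le_trans xM')// ler_norm.
- rewrite /comp/=; under eq_fun do rewrite EFinM.
  apply: integrableZl => //; have mb := @measurable_box R n `|M|.
  apply/integrableP; split; first exact/measurable_EFinP/measurable_indic.
  under eq_integral => x _ do rewrite gee0_abs ?lee_fin//.
  by rewrite integral_indic// setIT; exact: leb_box.
Qed.

Lemma near_norm_gt (V : normedModType R) (x : V) (M : R) :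
  M < `|x| -> \forall y \near x, M < `|y|.
Proof. by move=> Mx; apply: cvgr_norm_gt Mx; exact: cvg_id. Qed.

Lemma partial_support n (f : 'rV[R]_n -> R) i M :
  (forall x, M < `|x| -> f x = 0) -> forall x, M < `|x| -> partial i f x = 0.
Proof.
move=> f0 x Mx; rewrite /partial (@near_eq_derive _ _ _ _ (cst 0)) ?derive_cst//.
by near=> y; rewrite /cst f0//; near: y; exact: near_norm_gt Mx.
Unshelve. all: by end_near. Qed.

Lemma integrable_continuous_support n (f : 'rV[R]_n -> R) M : continuous f ->
  (forall x, M < `|x| -> f x = 0) -> (leb R n).-integrable setT (EFin \o f).
Proof.
move=> cf f0; have [B B0 fB] := continuous_bounded_box M cf.
apply: (@integrable_bounded_support _ _ B M) => //.
  exact: continuous_measurable_rV.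
move=> x; have [Mx|xM] := ltP M `|x|; first by rewrite f0// normr0.
by apply: fB => i; exact: le_trans (coord_le_norm _ _) xM.
Qed.

Lemma integral_derive_eq0 (F : R -> R) M : (forall y, derivable F y 1) ->
  continuous (fun y => 'D_1 F y) -> (forall y, M < `|y| -> F y = 0) ->
  (\int[lebesgue_measure]_y ('D_1 F y)%:E = 0)%E.
Proof.
move=> dF cF F0; pose N := `|M| + 1.
have MN : M < N by rewrite (le_lt_trans (ler_norm _))// ltrDl.
have N0 : 0 < N by rewrite ltr_wpDl.
have -> : (\int[lebesgue_measure]_y ('D_1 F y)%:E =
    \int[lebesgue_measure]_(y in `[(- N)%R, N%R]) ('D_1 F y)%:E)%E.
  rewrite [RHS]integral_mkcond; apply: eq_integral => y _; rewrite patchE.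
  have [//|] := boolP (y \in _); rewrite notin_setE/= in_itv/= -ler_norml => /negP.
  rewrite -ltNge => yN; rewrite (@near_eq_derive _ _ _ _ (cst 0)) ?derive_cst//.
  near=> z; rewrite /cst F0// (lt_trans MN)//; near: z.
  exact: (near_norm_gt (V := R^o)).
have cFF : continuous F.
  by move=> y; apply: differentiable_continuous; apply/derivable1_diffP.
rewrite (@continuous_FTC2 _ _ F) ?gtrN//.
- by rewrite !F0 ?normrN ?gtr0_norm// subee.
- exact: continuous_subspaceT.
- split; first by move=> y _; exact: dF.
  + by apply: cvg_at_right_filter; exact: cFF.
  + by apply: cvg_at_left_filter; exact: cFF.
- by move=> y _; rewrite derive1E.
Unshelve. all: by end_near. Qed.

(** By induction on the dimension. If the derivative is along the last coordinate, the
    inner integral in that coordinate vanishes by the fundamental theorem of calculus;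
    otherwise the inner integral in the other coordinates vanishes by induction. *)
Lemma integral_partial_eq0 n (f : 'rV[R]_n -> R) i M :
  (forall x, derivable f x (delta_mx ord0 i)) -> continuous (partial i f) ->
  (forall x, M < `|x| -> f x = 0) ->
  (\int[leb R n]_x (partial i f x)%:E = 0)%E.
Proof.
elim: n => [|n IH] in f i *; first by case: i.
move=> df cp f0.
have pi := integrable_continuous_support cp (partial_support i f0).
case: (unliftP ord_max i) => [k ik|im].
  rewrite integral_snoc21// integral0_eq// => y _.
  have E x := @derive_comp_affine R _ _ f (fun x => snoc (x, y)) x (delta_mx ord0 k) _
    (fun h => snoc_deltal y x k h).
  rewrite (eq_integral (fun x => (partial k (f \o (fun x => snoc (x, y))) x)%:E)); last first.
    by move=> x _; rewrite /partial (E x).2 ik.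
  apply: IH => [x||x Mx].
  - by rewrite (E x).1 -ik.
  - rewrite /partial; under eq_fun do rewrite (E _).2 -ik.
    move=> x; apply: (@continuous_comp _ _ _ (fun x => snoc (x, y)) (partial i f)); last exact: cp.
    by apply: lipschitz1_continuous; exact: snoc_lipl.
  - by rewrite /= f0// (lt_le_trans Mx)// norm_snocl.
rewrite integral_snoc12// integral0_eq// => x _.
have E y := @derive_comp_affine R _ R^o f (fun y => snoc (x, y)) y 1 _
  (fun h => snoc_deltar y x h).
transitivity (\int[@lebesgue_measure R]_y ('D_1 (f \o (fun y => snoc (x, y))) y)%:E)%E.
  by apply: eq_integral => y _; rewrite (E y).2 /partial im.
apply: (@integral_derive_eq0 (f \o (fun y => snoc (x, y))) M) => [y||y My].
- by rewrite (E y).1 -im.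
- under eq_fun do rewrite (E _).2 -im.
  move=> y; apply: (@continuous_comp _ _ _ (fun y => snoc (x, y)) (partial i f)); last exact: cp.
  by apply: (@lipschitz1_continuous R R^o); exact: snoc_lipr.
- by rewrite /= f0// (lt_le_trans My)// norm_snocr.
Qed.

End integral_derivative.

(** * Smooth functions and bump functions *)

Section continuous_real.
Context (R : realType) (T : topologicalType).
Implicit Types f g : T -> R.

Lemma continuous_add f g : continuous f -> continuous g ->
  continuous (fun x => f x + g x).
Proof. by move=> cf cg x; exact: (@cvgD R R^o _ _ _ f g _ _ (cf x) (cg x)). Qed.

Lemma continuous_mul f g : continuous f -> continuous g ->
  continuous (fun x => f x * g x).
Proof. by move=> cf cg x; exact: (@cvgM R _ _ _ f g _ _ (cf x) (cg x)). Qed.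

End continuous_real.

Section smooth_closure.
Context (R : realType) (n : nat).
Implicit Types f g : 'rV[R]_n -> R.

Lemma smooth_continuous f : smooth f -> continuous f.
Proof. by move=> /(_ [::])[]. Qed.

Lemma smooth_derivable f i x : smooth f -> derivable f x (delta_mx ord0 i).
Proof. by move=> /(_ [::])[_]; exact. Qed.

Lemma smooth_partial f i : smooth f -> smooth (partial i f).
Proof. by move=> sf s; have := sf (rcons s i); rewrite foldr_rcons. Qed.

(** Smoothness is the largest property of this kind: to show that a function is smooth,
    it suffices to exhibit a family that contains it and is stable under partial
    derivatives. *)
Lemma smooth_coind (P : ('rV[R]_n -> R) -> Prop) :
  (forall f, P f -> [/\ continuous f,
     forall i x, derivable f x (delta_mx ord0 i) & forall i, P (partial i f)]) ->
  forall f, P f -> smooth f.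
Proof.
move=> H f Pf s; have Ps : P (foldr (@partial R n) f s).
  by elim: s => //= i s /H[].
by have [] := H _ Ps.
Qed.

Lemma smooth_cst (c : R) : smooth (fun _ : 'rV[R]_n => c).
Proof.
apply: (smooth_coind (P := fun f => exists c, f = fun=> c)) => [f [d ->]|]; last by exists c.
split=> [|i x|i]; [exact: cst_continuous|exact: derivable_cst|].
by exists 0; apply/funext => x; rewrite /partial derive_cst.
Qed.

Lemma derive_coord (i j : 'I_n) (x : 'rV[R]_n) :
  derivable (fun x : 'rV[R]_n => x ord0 i) x (delta_mx ord0 j) *
  (partial j (fun x : 'rV[R]_n => x ord0 i) x = (j == i)%:R).
Proof.
have hE (h : R) :
    (h *: delta_mx ord0 j + x) ord0 i = h *: ((j == i)%:R : R^o) + x ord0 i.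
  by rewrite !mxE eqxx /= eq_sym.
rewrite /partial.
have [|-> ->] := @derive_comp_affine R R^o _ id (fun x : 'rV[R]_n => x ord0 i) x
  (delta_mx ord0 j) (j == i)%:R; first exact: hE.
by split; [exact: derivable_id|exact: derive_id].
Qed.

Lemma smooth_coord i : smooth (fun x : 'rV[R]_n => x ord0 i).
Proof.
apply: (smooth_coind (P := fun f => f = (fun x => x ord0 i) \/ smooth f)); last by left.
move=> f [->|sf]; last first.
  split; [exact: smooth_continuous|by move=> *; exact: smooth_derivable|].
  by move=> j; right; exact: smooth_partial.
split=> [|j x|j]; first exact: coord_continuous.
  exact: (derive_coord i j x).1.
right; rewrite (_ : partial j _ = fun=> (j == i)%:R); first exact: smooth_cst.
by apply/funext => x; exact: (derive_coord i j x).2.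
Qed.

Lemma smooth_lin (c : R) f g : smooth f -> smooth g -> smooth (fun x => c * f x + g x).
Proof.
move=> sf sg; apply: (smooth_coind (P := fun u => exists f g,
  [/\ smooth f, smooth g & u = fun x => c * f x + g x])); last by exists f, g.
move=> _ {sf sg}[{}f [{}g [sf sg ->]]].
have dcf i x : derivable (fun x => c * f x) x (delta_mx ord0 i).
  by apply: derivableZ; exact: smooth_derivable.
split=> [|i x|i].
- apply: continuous_add (smooth_continuous sg).
  apply: continuous_mul (smooth_continuous sf); exact: cst_continuous.
- by apply: derivableD => //; exact: smooth_derivable.
exists (partial i f), (partial i g); split; try exact: smooth_partial.
apply/funext => x; rewrite /partial deriveD//; last exact: smooth_derivable.
by congr (_ + _); rewrite deriveZ//; exact: smooth_derivable.
Qed.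

(** The smallest family that contains the products of smooth functions and is stable
    under derivation, by the Leibniz rule. *)
Inductive sum_of_products : ('rV[R]_n -> R) -> Prop :=
| sum_of_products_M f g : smooth f -> smooth g -> sum_of_products (fun x => f x * g x)
| sum_of_products_D f g : sum_of_products f -> sum_of_products g ->
    sum_of_products (fun x => f x + g x).

Lemma partialM i f g x : smooth f -> smooth g ->
  partial i (fun x => f x * g x) x = f x * partial i g x + g x * partial i f x.
Proof. by move=> sf sg; rewrite /partial deriveM//; exact: smooth_derivable. Qed.

Lemma smoothM f g : smooth f -> smooth g -> smooth (fun x => f x * g x).
Proof.
move=> sf sg; apply: (smooth_coind (P := sum_of_products)); last by constructor.
move=> u; elim=> {u f g sf sg} [f g sf sg|f g _ [cf df Pf] _ [cg dg Pg]]; [split=> [|i x|i]|split=> [|i x|i]].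
- exact: continuous_mul (smooth_continuous sf) (smooth_continuous sg).
- by apply: derivableM; exact: smooth_derivable.
- rewrite (_ : partial _ _ = fun x => f x * partial i g x + g x * partial i f x).
    by do 2![constructor=> //]; exact: smooth_partial.
  by apply/funext => x; rewrite partialM.
- exact: continuous_add.
- by apply: derivableD; [exact: df|exact: dg].
- rewrite (_ : partial _ _ = fun x => partial i f x + partial i g x).
    by constructor.
  by apply/funext => x; rewrite /partial deriveD.
Qed.

Lemma smooth_prod (I : Type) (r : seq I) (F : I -> 'rV[R]_n -> R) :
  (forall i, smooth (F i)) -> smooth (fun x => \prod_(i <- r) F i x).
Proof.
move=> sF; elim: r => [|i r IH].
  by under eq_fun do rewrite big_nil; exact: smooth_cst.
by under eq_fun do rewrite big_cons; exact: smoothM.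
Qed.

End smooth_closure.

Section flat.
Context (R : realType).
Implicit Types (p : {poly R}) (t s : R).

(** For p = 1 this is the standard smooth function that vanishes on the negative half
    line; the polynomials p make the family stable under derivation. *)
Definition flat p t : R := if 0 < t then p.[t^-1] * expR (- t^-1) else 0.

Lemma exprn_le_expR m s : 0 <= s -> s ^+ m <= m%:R ^+ m * expR s.
Proof.
case: m => [|m] s0; first by rewrite !expr0 mul1r -expR0 ler_expR.
have m0 : 0 < m.+1%:R :> R by rewrite ltr0n.
rewrite -[X in X ^+ _ <= _](mulfVK (lt0r_neq0 m0)) mulrC exprMn ler_wpM2l ?exprn_ge0//.
have -> : s = m.+1%:R * (s / m.+1%:R) by rewrite mulrC mulfVK// lt0r_neq0.
rewrite [in X in _ <= X]expRM_natl lerXn2r ?nnegrE ?expR_ge0//.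
  by rewrite divr_ge0 ?mulr_ge0// ?divr_ge0// ltW.
rewrite mulrAC mulfV ?lt0r_neq0// mul1r.
by apply: le_trans (expR_ge1Dx _); rewrite lerDr.
Qed.

Lemma poly_le_expR p : exists2 C, 0 <= C & forall s, 0 <= s -> `|p.[s]| <= C * expR s.
Proof.
exists (\sum_(i < size p) `|p`_i| * i%:R ^+ i).
  by apply: sumr_ge0 => i _; rewrite mulr_ge0// exprn_ge0.
move=> s s0; rewrite horner_coef (le_trans (ler_norm_sum _ _ _))// mulr_suml.
apply: ler_sum => i _; rewrite normrM -mulrA ler_wpM2l//.
by rewrite ger0_norm ?exprn_ge0// exprn_le_expR.
Qed.

(** The exponential beats the polynomial p X at 1/t. Applied to p X, this bound says
    that the difference quotients of flat p at 0 tend to 0. *)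
Lemma flat_le p : exists C, forall t, `|flat p t| <= C * `|t|.
Proof.
have [C C0 pC] := poly_le_expR (p * 'X); exists C => t; rewrite /flat.
case: ifPn => [t0|_]; last by rewrite normr0 mulr_ge0.
have := pC t^-1; rewrite invr_ge0 ltW// => /(_ erefl).
rewrite hornerMX !normrM (gtr0_norm t0) (@gtr0_norm _ t^-1) ?invr_gt0// ler_pdivrMr// => h.
by rewrite (gtr0_norm (expR_gt0 _)) expRN ler_pdivrMr ?expR_gt0// mulrAC.
Qed.

Lemma is_derive_flat p t : is_derive t 1 (flat p) (flat ('X^2 * (p - p^`())) t).
Proof.
case: (ltrgtP 0 t) => [t0|t0|<-].
- have it0 : 0 < t^-1 by rewrite invr_gt0.
  have tn0 : t != 0 by rewrite lt0r_neq0.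
  have E : \near t, p.[t^-1] * expR (- t^-1) = flat p t.
    by near=> u; rewrite /flat ifT//; near: u; exact: lt_nbhsr.
  apply: near_eq_is_derive E _.
  have dV : is_derive t 1 (fun u : R => u^-1) (- t ^- 2).
    by have := @is_deriveV R id t 1 1 tn0 (is_derive_id _ _); rewrite /GRing.scale/= mulr1.
  have dp : is_derive t 1 (fun u : R => p.[u^-1]) (p^`().[t^-1] * - t ^- 2).
    exact: (@is_derive1_comp _ (horner p)).
  have de : is_derive t 1 (fun u : R => expR (- u^-1)) (expR (- t^-1) * t ^- 2).
    have := @is_derive1_comp _ expR (fun u => - u^-1) t _ _ (is_derive_expR _) (is_deriveN dV).
    by rewrite opprK.
  apply: is_derive_eq.
  rewrite /flat t0 !hornerE /GRing.scale/= exprVn; ring.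
- have E : \near t, (0 : R) = flat p t.
    near=> u; rewrite /flat ifF//; apply/negbTE; rewrite -leNgt ltW//; near: u.
    exact: lt_nbhsl.
  apply: near_eq_is_derive E _; rewrite /flat ltNge ltW//=; exact: is_derive_cst.
- rewrite {2}/flat ltxx.
  have [C fC] := flat_le (p * 'X).
  have dE : (fun h : R => h^-1 *: (flat p (h *: 1 + 0) - flat p 0)) @ 0^' --> (0 : R).
    have E h : h^-1 *: (flat p (h *: 1 + 0) - flat p 0) = flat (p * 'X) h.
      rewrite /flat ltxx subr0 addr0 /GRing.scale/= mulr1; case: ifPn => _; last by rewrite mulr0.
      by rewrite hornerMX mulrA [h^-1 * _]mulrC.
    under eq_fun do rewrite E.
    apply/cvgr0Pnorm_lt => e e0; near=> h.
    apply: (le_lt_trans (fC h)); apply: (@le_lt_trans _ _ (`|C| * `|h|)).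
      by rewrite ler_wpM2r// ler_norm.
    apply: (@le_lt_trans _ _ ((`|C| + 1) * `|h|)); first by rewrite ler_wpM2r// lerDl.
    rewrite mulrC -ltr_pdivlMr ?ltr_wpDl//; near: h.
    apply: dnbhs0_lt; by rewrite divr_gt0// ltr_wpDl.
  by split; [apply/cvg_ex; exists 0|exact: cvg_lim].
Unshelve. all: by end_near. Qed.

Lemma smooth_flat n p (i : 'I_n) (a b : R) :
  smooth (fun x : 'rV[R]_n => flat p (a * x ord0 i + b)).
Proof.
apply: (smooth_coind (P := fun f => exists p,
  f = fun x : 'rV[R]_n => flat p (a * x ord0 i + b))); last by exists p.
move=> _ [{}p ->].
have cf : continuous (flat p).
  move=> t; apply: differentiable_continuous; apply/derivable1_diffP.
  by have [] := is_derive_flat p t.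
have dw (t w : R) : derivable (flat p) t w * ('D_w (flat p) t = flat (w *: ('X^2 * (p - p^`()))) t).
  have [df dE] := is_derive_flat p t; move/derivable1_diffP : (df) => ddf.
  split; first exact: diff_derivable.
  rewrite deriveE// deriv1E// derive1E dE /flat /GRing.scale/=; case: ifP => _.
    by rewrite hornerZ mulrA.
  by rewrite mulr0.
have E j x := @derive_comp_affine R R^o _ (flat p) (fun x : 'rV[R]_n => a * x ord0 i + b) x
  (delta_mx ord0 j) (a * (j == i)%:R).
have {}E j x : derivable (fun x : 'rV[R]_n => flat p (a * x ord0 i + b)) x (delta_mx ord0 j) *
   ('D_(delta_mx ord0 j) (fun x : 'rV[R]_n => flat p (a * x ord0 i + b)) x =
    flat ((a * (j == i)%:R) *: ('X^2 * (p - p^`()))) (a * x ord0 i + b)).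
  have [|-> ->] := E j x.
    move=> h; rewrite !mxE eqxx /= eq_sym /GRing.scale/=; ring.
  by split; [exact: (dw _ _).1|exact: (dw _ _).2].
split=> [|j x|j].
- move=> x; apply: (@continuous_comp _ _ _ (fun x : 'rV[R]_n => a * x ord0 i + b)); last exact: cf.
  apply: continuous_add; last exact: cst_continuous.
  apply: continuous_mul; [exact: cst_continuous|exact: coord_continuous].
- exact: (E j x).1.
- by exists ((a * (j == i)%:R) *: ('X^2 * (p - p^`()))); apply/funext => x; exact: (E j x).2.
Qed.

Lemma flat1_ge0 t : 0 <= flat 1 t.
Proof. by rewrite /flat; case: ifP => // _; rewrite hornerC mul1r expR_ge0. Qed.

Lemma flat1_le1 t : flat 1 t <= 1.
Proof.
rewrite /flat; case: ifPn => // t0; rewrite hornerC mul1r -expR0 ler_expR.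
by rewrite oppr_le0 invr_ge0 ltW.
Qed.

Lemma flat1_le0 t : t <= 0 -> flat 1 t = 0.
Proof. by rewrite /flat ltNge => ->. Qed.

Lemma flat1_cvg t : 0 < t -> (fun k : nat => flat 1 (k.+1%:R * t)) @ \oo --> (1 : R).
Proof.
move=> t0.
have E (k : nat) : flat 1 (k.+1%:R * t) = expR (- (k.+1%:R^-1 * t^-1)).
  by rewrite /flat pmulr_rgt0 ?ltr0n// t0 hornerC mul1r invfM.
under eq_fun do rewrite E.
have H : (fun k : nat => expR (- (k.+1%:R^-1 * t^-1))) @ \oo --> expR (- (0 * t^-1)).
  apply: (@cvg_comp _ _ _ (fun k : nat => - (k.+1%:R^-1 * t^-1)) expR); last exact: continuous_expR.
  by apply: cvgN; apply: cvgM; [exact: cvg_harmonic|exact: cvg_cst].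
by rewrite mul0r oppr0 expR0 in H.
Qed.

End flat.

Section bump.
Context (R : realType) (n : nat) (a b : 'rV[R]_n).
Local Notation obox := (obox a b).
Local Notation cbox := (cbox a b).

(** As k grows, each factor tends to 1 inside the box and stays 0 outside, so these
    functions tend pointwise to the indicator of the open box. *)
Definition box_bump (k : nat) (x : 'rV[R]_n) : R :=
  \prod_i (flat 1 (k.+1%:R * (x ord0 i - a ord0 i)) *
           flat 1 (k.+1%:R * (b ord0 i - x ord0 i))).

Lemma compact_cbox : compact cbox.
Proof.
have := @rV_compact R n (fun i => `[a ord0 i, b ord0 i]%classic) (fun i => @segment_compact _ _ _).
by congr compact; apply/seteqP; split => x /= h i; have := h i; rewrite in_itv.
Qed.

Lemma smooth_bump k : smooth (box_bump k).
Proof.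
apply: smooth_prod => i; apply: smoothM.
  under eq_fun do rewrite mulrBr; exact: smooth_flat.
under eq_fun do rewrite mulrBr addrC -mulNr; exact: smooth_flat.
Qed.

Lemma bump_ge0_le1 k x : 0 <= box_bump k x <= 1.
Proof.
rewrite prodr_ge0/=; last by move=> i _; rewrite mulr_ge0// flat1_ge0.
by apply: prodr_ile1 => i _; rewrite mulr_ge0 ?flat1_ge0// mulr_ile1 ?flat1_ge0// flat1_le1.
Qed.

Lemma bump_out k x : ~ obox x -> box_bump k x = 0.
Proof.
move=> /existsNP[i /negP]; rewrite negb_and -!leNgt => xi.
rewrite /box_bump (bigD1 i)//=; case/orP: xi => xi.
  by rewrite flat1_le0 ?mul0r// mulr_ge0_le0// subr_le0.
by rewrite [flat 1 (_ * (b ord0 i - _))]flat1_le0 ?mulr0 ?mul0r// mulr_ge0_le0// subr_le0.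
Qed.

Lemma bump_cvg x : (fun k => box_bump k x) @ \oo --> (\1_obox x : R).
Proof.
rewrite indicE; have [|] := boolP (x \in obox).
  rewrite inE => xab; rewrite /box_bump.
  elim: (index_enum _) => [|i r IH].
    under eq_fun do rewrite big_nil; exact: cvg_cst.
  under eq_fun do rewrite big_cons; have /andP[ax xb] := xab i.
  have H : flat 1 (k.+1%:R * (x ord0 i - a ord0 i)) *
      flat 1 (k.+1%:R * (b ord0 i - x ord0 i)) @[k --> \oo] --> (1 * 1 : R).
    by apply: cvgM; apply: flat1_cvg; rewrite subr_gt0.
  rewrite [X in nbhs X](_ : 1 = 1 * 1 * 1); last by rewrite !mulr1.
  exact: cvgM H IH.
rewrite notin_setE => xab; under eq_fun do rewrite bump_out//; exact: cvg_cst.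
Qed.

Lemma test_bump (D : set 'rV[R]_n) k : cbox `<=` D -> test_function D (box_bump k).
Proof.
move=> abD; split; first exact: smooth_bump.
exists cbox; split=> //; first exact: compact_cbox.
move=> x xab; apply: bump_out => xo; apply: xab => i.
by have /andP[/ltW-> /ltW->] := xo i.
Qed.

End bump.

(** * Symmetry of second derivatives *)

Section schwarz.
Context (R : realType) (n : nat).
Implicit Types (f : 'rV[R]_n -> R) (i j : 'I_n).
Local Notation e i := (delta_mx ord0 i : 'rV[R]_n).

Lemma is_derive_line f i x (s : R) : smooth f ->
  is_derive s 1 (fun s : R => f (s *: e i + x)) (partial i f (s *: e i + x)).
Proof.
move=> sf.
have := @derive_comp_affine R _ R^o f (fun s : R => s *: e i + x) s 1 (e i).
move=> [h|dE DE]; first by rewrite scalerDl addrA /GRing.scale/= mulr1.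
by split; [rewrite dE; exact: smooth_derivable|exact: DE].
Qed.

(** The mean value theorem is applied once in each of the two directions. *)
Lemma second_difference f i j x (t : R) : smooth f -> 0 < t ->
  exists2 y, `|y - x| <= t *+ 2 &
    f (t *: e i + (t *: e j + x)) - f (t *: e i + x) - (f (t *: e j + x) - f x) =
    t ^+ 2 * partial j (partial i f) y.
Proof.
move=> sf t0.
have [s _||c + E] := @MVT_segment R (fun s : R => f (s *: e i + (t *: e j + x)) - f (s *: e i + x))
  (fun s : R => partial i f (s *: e i + (t *: e j + x)) - partial i f (s *: e i + x)) 0 t (ltW t0).
- by apply: is_deriveB; exact: is_derive_line.
- have cl z : continuous (fun s : R => f (s *: e i + z)).
    move=> s; apply: differentiable_continuous; apply/derivable1_diffP.
    by have [] := is_derive_line i z s sf.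
  apply: continuous_subspaceT => s; apply: (@continuousB _ R^o R^o); exact: cl.
rewrite in_itv/= => /andP[c0 ct].
have [s _||d + E'] := @MVT_segment R (fun s : R => partial i f (s *: e j + (c *: e i + x)))
  (fun s : R => partial j (partial i f) (s *: e j + (c *: e i + x))) 0 t (ltW t0).
- by apply: is_derive_line; exact: smooth_partial.
- apply: continuous_subspaceT => s; apply: differentiable_continuous; apply/derivable1_diffP.
  by have [] := is_derive_line j (c *: e i + x) s (smooth_partial i sf).
rewrite in_itv/= => /andP[d0 dt].
have ne k : `|e k| <= 1.
  by apply: norm_le_coord => // l; rewrite mxE; case: (_ && _); rewrite ?normr1 ?normr0.
exists (d *: e j + (c *: e i + x)).
  rewrite addrA addrK (le_trans (ler_normD _ _))// mulr2n lerD// normrZ ger0_norm//.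
    by rewrite (le_trans (ler_pM _ _ dt (ne j)))// mulr1.
  by rewrite (le_trans (ler_pM _ _ ct (ne i)))// mulr1.
move: E E'; rewrite !scale0r !add0r !subr0 => ->.
rewrite addrCA => ->; rewrite expr2; ring.
Qed.

(** The second difference is symmetric in i and j, so both mixed derivatives take the
    same value at points that are arbitrarily close to x; they are continuous. *)
Lemma partialC f i j x : smooth f ->
  partial i (partial j f) x = partial j (partial i f) x.
Proof.
move=> sf; apply/eqP; rewrite -subr_eq0 -normr_le0; apply/ler_addgt0Pr => eps eps0.
rewrite add0r.
have cont i' j' : \forall y \near x, `|partial i' (partial j' f) x - partial i' (partial j' f) y| < eps / 2.
  have := smooth_continuous (smooth_partial i' (smooth_partial j' sf)) (x := x).
  by move=> /cvgrPdist_lt; apply; rewrite divr_gt0.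
have nx : nbhs x ([set y | `|partial i (partial j f) x - partial i (partial j f) y| < eps / 2] `&`
    [set y | `|partial j (partial i f) x - partial j (partial i f) y| < eps / 2]).
  by apply: filterI; exact: cont.
have /nbhs_ballP[d /= d0 dP] := nx.
have t0 : 0 < d / 3 by rewrite divr_gt0.
have t3 y : `|y - x| <= (d / 3) *+ 2 -> ball x d y.
  rewrite -ball_normE/= distrC => /le_lt_trans; apply.
  by rewrite mulr2n; lra.
have [y /t3/dP[_ h1] E1] := second_difference i j x sf t0.
have [z /t3/dP[h2 _] E2] := second_difference j i x sf t0.
have E0 : f (d / 3 *: e i + (d / 3 *: e j + x)) - f (d / 3 *: e i + x) - (f (d / 3 *: e j + x) - f x) =
    f (d / 3 *: e j + (d / 3 *: e i + x)) - f (d / 3 *: e j + x) - (f (d / 3 *: e i + x) - f x).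
  have -> : d / 3 *: e j + (d / 3 *: e i + x) = d / 3 *: e i + (d / 3 *: e j + x) by rewrite addrCA.
  move: (f (_ + (_ + _))) (f (_ *: e i + x)) (f (_ *: e j + x)) (f x).
  by move=> A B C D; ring.
have {E0} : (d / 3) ^+ 2 * partial j (partial i f) y = (d / 3) ^+ 2 * partial i (partial j f) z.
  by apply: (etrans (esym E1)); apply: etrans E0 E2.
have d30 : (d / 3) ^+ 2 != 0 by rewrite expf_neq0// lt0r_neq0.
move=> /(mulfI d30) yz; move: h2; rewrite /= -yz => h2.
move: h1 h2; rewrite /=.
move: (partial i (partial j f) x) (partial j (partial i f) x) (partial j (partial i f) y).
move=> A B C h1 h2; clear -h1 h2.
apply: le_trans (ler_distD C A B) _.
rewrite [X in _ <= X]splitr; apply: lerD; first exact: ltW.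
by rewrite distrC; exact: ltW.
Qed.

End schwarz.

(** * Semi-inner products and square integrable fields *)

Section semi_inner_product.
Context (R : realType).

Definition linear_subspace (X : lmodType R) (S : set X) :=
  S 0 /\ forall (a : R) x y, S x -> S y -> S (a *: x + y).

(** Weak derivatives are only determined up to null sets, and linear in the function
    only as long as it has such derivatives. Therefore the laws are asked for on a
    subspace S, and ip x x = 0 does not force x = 0. *)
Record semi_inner_product (X : lmodType R) (S : set X) (ip : X -> X -> R) : Prop := {
  sip_subspace : linear_subspace S;
  sip_lin : forall a x y z, S x -> S y -> S z ->
    ip (a *: x + y) z = a * ip x z + ip y z;
  sip_sym : forall x y, S x -> S y -> ip x y = ip y x;
  sip_ge0 : forall x, S x -> 0 <= ip x x }.

Definition snorm (X : lmodType R) (ip : X -> X -> R) x : R := Num.sqrt (ip x x).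

Section linear_subspace.
Context (X : lmodType R) (S : set X) (sS : linear_subspace S).

Lemma subspace_add x y : S x -> S y -> S (x + y).
Proof. by move=> Sx Sy; rewrite -[x]scale1r; exact: sS.2. Qed.

Lemma subspace_scale (a : R) x : S x -> S (a *: x).
Proof. by move=> Sx; rewrite -[_ *: _]addr0; apply: sS.2 => //; exact: sS.1. Qed.

Lemma subspace_sub x y : S x -> S y -> S (x - y).
Proof. by move=> Sx Sy; rewrite addrC -scaleN1r; exact: sS.2. Qed.

Lemma subspace_sum (I : Type) (r : seq I) (F : I -> X) :
  (forall i, S (F i)) -> S (\sum_(i <- r) F i).
Proof.
move=> SF; elim: r => [|i r IH]; first by rewrite big_nil; exact: sS.1.
by rewrite big_cons; exact: subspace_add.
Qed.

End linear_subspace.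

Section linear_on.
Context (X : lmodType R) (S : set X) (sS : linear_subspace S) (f : X -> R).
Hypothesis fl : forall a x y, S x -> S y -> f (a *: x + y) = a * f x + f y.

Lemma linear_on0 : f 0 = 0.
Proof. by have := fl (-1) sS.1 sS.1; rewrite scaler0 addr0 mulN1r addNr. Qed.

Lemma linear_onZ a x : S x -> f (a *: x) = a * f x.
Proof. by move=> Sx; have := fl a Sx sS.1; rewrite !addr0 linear_on0 addr0. Qed.

Lemma linear_onD x y : S x -> S y -> f (x + y) = f x + f y.
Proof. by move=> Sx Sy; rewrite -[x in LHS]scale1r fl// mul1r. Qed.

Lemma linear_onB x y : S x -> S y -> f (x - y) = f x - f y.
Proof. by move=> Sx Sy; rewrite addrC -scaleN1r fl// mulN1r addrC. Qed.

Lemma linear_on_sum (I : Type) (r : seq I) (F : I -> X) :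
  (forall i, S (F i)) -> f (\sum_(i <- r) F i) = \sum_(i <- r) f (F i).
Proof.
move=> SF; elim: r => [|i r IH]; first by rewrite !big_nil linear_on0.
by rewrite !big_cons linear_onD ?IH//; exact: subspace_sum.
Qed.

End linear_on.

(** The discriminant of a nonnegative quadratic polynomial is nonpositive. *)
Lemma quadratic_ge0 (a b c : R) : 0 <= a -> 0 <= c ->
  (forall t, 0 <= a + 2 * t * b + t ^+ 2 * c) ->
  `|b| <= Num.sqrt a * Num.sqrt c.
Proof.
move=> a0 c0 h.
have H : b ^+ 2 <= a * c.
  have [c00|] := eqVneq c 0.
    (* if c = 0, the polynomial is affine in t, hence b = 0 *)
    rewrite c00 mulr0; apply: contraT; rewrite -ltNge => b2.
    have bn0 : b != 0 by apply: contraTneq b2 => ->; rewrite expr0n/= ltxx.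
    have := h (- (a + 1) / (2 * b)); rewrite c00 mulr0 addr0.
    have -> : 2 * (- (a + 1) / (2 * b)) * b = - (a + 1) by field.
    by rewrite opprD addNKr; lra.
  move=> cn0; have cp : 0 < c by rewrite lt0r cn0.
  have := h (- b / c); have -> : a + 2 * (- b / c) * b + (- b / c) ^+ 2 * c = a - b ^+ 2 / c.
    by field.
  by rewrite subr_ge0 ler_pdivrMr.
by rewrite -sqrtrM// -sqrtr_sqr ler_wsqrtr.
Qed.

Section theory.
Context (X : lmodType R) (S : set X) (ip : X -> X -> R).
Hypothesis sip : semi_inner_product S ip.
Let sS := sip_subspace sip.

Lemma snorm_ge0 x : 0 <= snorm ip x.
Proof. exact: sqrtr_ge0. Qed.

Lemma sqr_snorm x : S x -> snorm ip x ^+ 2 = ip x x.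
Proof. by move=> Sx; rewrite sqr_sqrtr// (sip_ge0 sip). Qed.

Lemma sip_linr a x y z : S x -> S y -> S z ->
  ip z (a *: x + y) = a * ip z x + ip z y.
Proof.
move=> Sx Sy Sz; rewrite !(sip_sym sip Sz)//; last exact: sS.2.
exact: (sip_lin sip).
Qed.

Lemma sip_expand x y t : S x -> S y ->
  ip (t *: y + x) (t *: y + x) = ip x x + 2 * t * ip x y + t ^+ 2 * ip y y.
Proof.
move=> Sx Sy; have Sz := sS.2 t y x Sy Sx.
rewrite (sip_lin sip)// !sip_linr// (sip_sym sip Sy Sx); ring.
Qed.

Lemma sip_sum_ge0 x y : S x -> S y -> 0 <= ip x x + 2 * ip x y + ip y y.
Proof.
move=> Sx Sy; have := sip_ge0 sip (sS.2 1 y x Sy Sx).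
by rewrite sip_expand// mulr1 expr1n mul1r.
Qed.

Lemma sip_young x y : S x -> S y -> 2 * ip x y <= ip x x + ip y y.
Proof.
move=> Sx Sy; have := sip_ge0 sip (sS.2 (-1) y x Sy Sx).
rewrite sip_expand//; move: (ip x x) (ip x y) (ip y y) => p q w; lra.
Qed.

Lemma cauchy_schwarz x y : S x -> S y -> `|ip x y| <= snorm ip x * snorm ip y.
Proof.
move=> Sx Sy; apply: quadratic_ge0 => [||t]; rewrite -?sip_expand//;
  try exact: (sip_ge0 sip).
by apply: (sip_ge0 sip); exact: sS.2.
Qed.

Lemma snormZ (a : R) x : S x -> snorm ip (a *: x) = `|a| * snorm ip x.
Proof.
move=> Sx; have Sax := subspace_scale sS a Sx.
rewrite /snorm; have -> : ip (a *: x) (a *: x) = a ^+ 2 * ip x x.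
  rewrite (linear_onZ sS (f := ip^~ _))//; last by move=> *; exact: (sip_lin sip).
  rewrite (linear_onZ sS (f := ip x))//; last by move=> *; exact: sip_linr.
  by rewrite expr2 mulrA.
by rewrite sqrtrM ?sqr_ge0// sqrtr_sqr.
Qed.

Lemma snorm_triangle x y : S x -> S y -> snorm ip (x + y) <= snorm ip x + snorm ip y.
Proof.
move=> Sx Sy; rewrite -(@ler_pXn2r _ 2)// ?nnegrE ?addr_ge0 ?snorm_ge0//.
rewrite sqr_snorm; last exact: subspace_add.
have := sip_expand 1 Sx Sy; rewrite scale1r addrC => ->.
rewrite sqrrD !sqr_snorm// mulr1 expr1n mul1r lerD2r lerD2l -[X in _ <= X]mulr_natl ler_wpM2l//.
exact: le_trans (ler_norm _) (cauchy_schwarz Sx Sy).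
Qed.

Lemma snorm_triangleB x y : S x -> S y -> snorm ip (x - y) <= snorm ip x + snorm ip y.
Proof.
move=> Sx Sy; rewrite (le_trans (snorm_triangle Sx _))//; last first.
  by rewrite -scaleN1r snormZ// normrN1 mul1r.
by rewrite -scaleN1r; exact: subspace_scale.
Qed.

Lemma sip_sub (T : set X) : linear_subspace T -> T `<=` S -> semi_inner_product T ip.
Proof.
move=> sT TS; split => //.
- by move=> a x y z /TS ? /TS ? /TS ?; exact: (sip_lin sip).
- by move=> x y /TS ? /TS ?; exact: (sip_sym sip).
- by move=> x /TS ?; exact: (sip_ge0 sip).
Qed.

End theory.

(** L is only assumed to be linear when tested against T: this is what weak derivatives
    satisfy, as functions chosen in their classes. *)
Lemma sip_pullback (X Y : lmodType R) (S : set X) (T : set Y) (ip : Y -> Y -> R) (L : X -> Y) :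
  semi_inner_product T ip -> linear_subspace S -> (forall x, S x -> T (L x)) ->
  (forall a x y z, S x -> S y -> T z ->
    ip (L (a *: x + y)) z = a * ip (L x) z + ip (L y) z) ->
  semi_inner_product S (fun x y => ip (L x) (L y)).
Proof.
move=> sip sS ST Ll; split => //.
- by move=> a x y z Sx Sy Sz; apply: Ll => //; exact: ST.
- by move=> x y /ST ? /ST ?; exact: (sip_sym sip).
- by move=> x /ST; exact: (sip_ge0 sip).
Qed.

Lemma sip_add (X : lmodType R) (S : set X) (ip1 ip2 : X -> X -> R) :
  semi_inner_product S ip1 -> semi_inner_product S ip2 ->
  semi_inner_product S (fun x y => ip1 x y + ip2 x y).
Proof.
move=> s1 s2; split.
- exact: sip_subspace s1.
- by move=> a x y z Sx Sy Sz; rewrite (sip_lin s1)// (sip_lin s2)//; ring.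
- by move=> x y Sx Sy; rewrite (sip_sym s1)// (sip_sym s2).
- by move=> x Sx; rewrite addr_ge0// ?(sip_ge0 s1)// (sip_ge0 s2).
Qed.

Lemma sip_sum (X : lmodType R) (S : set X) (I : Type) (r : seq I) (ip : I -> X -> X -> R) :
  linear_subspace S -> (forall i, semi_inner_product S (ip i)) ->
  semi_inner_product S (fun x y => \sum_(i <- r) ip i x y).
Proof.
move=> sS s; elim: r => [|i r IH].
  by split => // *; rewrite ?big_nil ?mulr0 ?addr0.
have := sip_add (s i) IH; congr semi_inner_product.
by apply/funext => x; apply/funext => y; rewrite big_cons.
Qed.

End semi_inner_product.

Section L2_theory.
Context (R : realType) (n : nat) (mu : {measure set 'rV[R]_n -> \bar R}).
Context (D : set 'rV[R]_n) (mD : measurable D).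
Local Notation X := ('rV[R]_n -> R^o).
Implicit Types f g : 'rV[R]_n -> R.

(** The product is dominated by the sum of the squares. *)
Lemma L2_integrableM f g : L2 mu D f -> L2 mu D g ->
  mu.-integrable D (EFin \o (fun x => f x * g x)).
Proof.
move=> [mf if2] [mg ig2].
apply: (le_integrable mD _ _ (integrableD mD if2 ig2)).
  by apply/measurable_EFinP; exact: measurable_funM.
move=> x Dx /=; rewrite lee_fin [X in _ <= X]ger0_norm ?addr_ge0 ?sqr_ge0//= normrM.
rewrite -(real_normK (num_real (f x))) -(real_normK (num_real (g x))).
by have := sqr_ge0 (`|f x| - `|g x|); have := normr_ge0 (f x); have := normr_ge0 (g x); nra.
Qed.

Lemma L2_subspace : linear_subspace (L2 mu D : set X).
Proof.
split=> [|a f g Lf Lg].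
  split; first exact: measurable_cst.
  rewrite (_ : (fun x => _) = cst 0%E); first exact: integrable0.
  by apply/funext => x; rewrite /= expr0n.
have fg := L2_integrableM Lf Lg; case: (Lf) (Lg) => [mf if2] [mg ig2]; split.
  apply: measurable_funD => //; apply: measurable_funM => //; exact: measurable_cst.
rewrite (_ : (fun x => _) = ((fun x => (a ^+ 2)%:E * (f x ^+ 2)%:E) \+
    ((fun x => (2 * a)%:E * (f x * g x)%:E) \+ (fun x => (g x ^+ 2)%:E)))%E).
  by apply: integrableD => //; [|apply: integrableD => //]; apply: integrableZl.
apply/funext => x; rewrite /= -!EFinM -!EFinD; congr (_%:E).
rewrite -[(a *: f + g) x]/(a * f x + g x); ring.
Qed.

Lemma inner_lin a f g h : L2 mu D f -> L2 mu D g -> L2 mu D h ->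
  inner mu D (fun x => a * f x + g x) h = a * inner mu D f h + inner mu D g h.
Proof.
move=> Lf Lg Lh; rewrite /inner.
have fh := L2_integrableM Lf Lh; have gh := L2_integrableM Lg Lh.
have afh := L2_integrableM (subspace_scale L2_subspace a Lf) Lh.
transitivity (\int[mu]_(x in D) (a * f x * h x + g x * h x)).
  by apply: eq_Rintegral => x _; rewrite mulrDl.
rewrite RintegralD//; congr (_ + _); rewrite -RintegralZl//.
by apply: eq_Rintegral => x _; rewrite mulrA.
Qed.

Lemma innerC f g : inner mu D f g = inner mu D g f.
Proof. by apply: eq_Rintegral => x _; rewrite mulrC. Qed.

Lemma inner_ge0 f : 0 <= inner mu D f f.
Proof. by apply: Rintegral_ge0 => x _; rewrite -expr2 sqr_ge0. Qed.

Lemma L2_sip : semi_inner_product (L2 mu D : set X) (inner mu D : X -> X -> R).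
Proof.
split; [exact: L2_subspace|by move=> *; exact: inner_lin| |].
- by move=> *; exact: innerC.
- by move=> *; exact: inner_ge0.
Qed.

Lemma eq_inner f f' g g' : {in D, f =1 f'} -> {in D, g =1 g'} ->
  inner mu D f g = inner mu D f' g'.
Proof. by move=> ff gg; apply: eq_Rintegral => x Dx; rewrite ff// gg. Qed.

Lemma ae_inner f f' g : L2 mu D f -> L2 mu D g -> measurable_fun D f' ->
  {ae mu, forall x, D x -> f' x = f x} -> inner mu D f' g = inner mu D f g.
Proof.
move=> [mf _] [mg _] mf' ff; rewrite /inner /Rintegral; congr fine.
apply: ae_eq_integral => //.
- by apply/measurable_EFinP; exact: measurable_funM.
- by apply/measurable_EFinP; exact: measurable_funM.
by apply: filterS ff => x h Dx /=; rewrite h.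
Qed.

Lemma ae_L2 f f' : L2 mu D f -> measurable_fun D f' ->
  {ae mu, forall x, D x -> f' x = f x} -> L2 mu D f'.
Proof.
move=> [mf if2] mf' ff; split => //.
have mf2 : measurable_fun D (fun x => (f x ^+ 2)%:E) by have /integrableP[] := if2.
have mf2' : measurable_fun D (fun x => (f' x ^+ 2)%:E).
  by apply/measurable_EFinP; exact: measurable_funX.
have /integrableP[_ h] := if2; apply/integrableP; split => //.
apply: le_lt_trans h; rewrite le_eqVlt; apply/orP; left; apply/eqP.
apply: ae_eq_integral => //; try exact: measurableT_comp.
by apply: filterS ff => x e Dx /=; rewrite e.
Qed.

Lemma inner_eq0_ae f : L2 mu D f -> inner mu D f f = 0 ->
  {ae mu, forall x, D x -> f x = 0}.
Proof.
move=> Lf; have ff := L2_integrableM Lf Lf; rewrite /inner /Rintegral => h.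
have {}h : (\int[mu]_(x in D) `|(f x * f x)%:E| = 0)%E.
  under eq_integral => x _ do rewrite gee0_abs ?lee_fin -?expr2 ?sqr_ge0//.
  by rewrite -[LHS]fineK ?h//; exact: integrable_fin_num.
have /integrableP[mff _] := ff.
move/(ae_eq_integral_abs _ mD mff) : h; apply: filterS => x /= h Dx.
by have [] := h Dx; move/eqP; rewrite mulf_eq0 orbb => /eqP.
Qed.

Section fields.
Context (p q : nat).
Local Notation Y := ('rV[R]_n -> 'M[R]_(p, q)).
Implicit Types F G : Y.
Local Notation L2Y := (@L2m R n mu D p q : set Y).

Lemma L2m_subspace : linear_subspace L2Y.
Proof.
split=> [i j|a F G LF LG i j].
  have := L2_subspace.1; congr (L2 mu D); apply/funext => x; by rewrite /= !mxE.
have := L2_subspace.2 a _ _ (LF i j) (LG i j); congr (L2 mu D).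
by apply/funext => x; rewrite /= !mxE.
Qed.

Lemma L2m_sip : semi_inner_product L2Y (@innerm R n mu D p q : Y -> Y -> R).
Proof.
apply: sip_sum; first exact: L2m_subspace.
move=> i; apply: sip_sum; first exact: L2m_subspace.
move=> j; apply: (@sip_pullback _ Y X _ _ _ (fun F x => F x i j) L2_sip).
- exact: L2m_subspace.
- by move=> F; apply.
- move=> a F G h LF LG Lh; rewrite -inner_lin//.
  by apply: eq_inner => // x _; rewrite !mxE.
Qed.

End fields.

End L2_theory.

(** * The fundamental lemma of the calculus of variations *)

Section bounded_domain.
Context (R : realType) (n : nat).
Implicit Types f : 'rV[R]_n -> R.

Lemma bounded_setP (D : set 'rV[R]_n) : bounded_set D -> exists2 M, 0 <= M & D `<=` box M.
Proof.
move=> /= [M [_ /(_ (`|M| + 1))]]; rewrite (le_lt_trans (ler_norm _)) ?ltrDl// => /(_ erefl) h.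
by exists (`|M| + 1) => // x Dx i; exact: le_trans (coord_le_norm _ _) (h _ Dx).
Qed.

Lemma leb_bounded (D : set 'rV[R]_n) : measurable D -> bounded_set D -> (leb R n D < +oo)%E.
Proof.
move=> mD /bounded_setP[M _ DM]; apply: (@le_lt_trans _ _ (leb R n (box M))); last exact: leb_box.
by apply: le_measure => //; rewrite inE//; exact: measurable_box.
Qed.

(** Continuous functions are bounded on bounded sets. *)
Lemma continuous_L2 (mu : {measure set 'rV[R]_n -> \bar R}) (D : set 'rV[R]_n) f :
  measurable D -> bounded_set D -> (mu D < +oo)%E -> continuous f -> L2 mu D f.
Proof.
move=> mD /bounded_setP[M _ DM] muD cf.
have mf : measurable_fun D f by apply: measurable_funTS; exact: continuous_measurable_rV.
split => //; have [B B0 fB] := continuous_bounded_box M cf.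
apply: (@measurable_bounded_integrable _ _ _ _ (fun x => f x ^+ 2)) => //.
  exact: measurable_funX.
exists (B ^+ 2); split; first exact: num_real.
move=> C BC x Dx /=; apply: le_trans (ltW BC); rewrite normrX lerXn2r ?nnegrE//.
exact: fB (DM _ Dx).
Qed.

End bounded_domain.

(** Orthants are stable under intersection, and an orthant cuts a box in a box: they are
    the generating class to which Dynkin's theorem is applied below. *)
Lemma measurable_orthants (R : realType) n :
  measurable = <<s [set B : set 'rV[R]_n | exists a : 'I_n -> R,
    B = [set x | forall i, a i < x ord0 i]] >> :> set (set 'rV[R]_n).
Proof.
set G := [set B | _]; apply/seteqP; split; last first.
  apply: smallest_sub; first exact: sigma_algebra_measurable.
  move=> _ [a ->].
  have E : [set x : 'rV[R]_n | forall i, `]a i, +oo[%classic (x ord0 i)] =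
      [set x : 'rV[R]_n | forall i, a i < x ord0 i].
    by apply/seteqP; split=> x /= h i; have := h i; rewrite /= in_itv/= andbT.
  apply: (eq_ind _ measurable _ _ E).
  by apply: (@measurable_forall_coord _ _ (fun i => `]a i, +oo[%classic)) => i; exact: measurable_itv.
apply: smallest_sub; first exact: smallest_sigma_algebra.
move=> B; rewrite -bigcup_seq => -[i _ [Y mY <-]].
have : measurable_fun [set: g_sigma_algebraType G] (fun x : 'rV[R]_n => x ord0 i).
  apply: (@measurability _ _ _ _ _ _ (@RGenOInfty.G R)); first exact: RGenOInfty.measurableE.
  move=> _ [_ [c ->] <-]; rewrite setTI.
  have -> : (fun x : 'rV[R]_n => x ord0 i) @^-1` `]c, +oo[ =
      \bigcup_k [set x | forall j, (if j == i then c else - k%:R) < x ord0 j].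
    apply/seteqP; split => x /=; rewrite in_itv/= andbT.
      move=> cx; exists (Num.bound `|x|) => // j; case: eqP => [->//|_].
      rewrite ltrNl (le_lt_trans _ (archi_boundP (normr_ge0 x)))//.
      by rewrite (le_trans _ (coord_le_norm x j))// -normrN ler_norm.
    by move=> [k _ /(_ i)]; rewrite eqxx.
  apply: bigcupT_measurable => k; apply: sub_sigma_algebra.
  by exists (fun j => if j == i then c else - k%:R).
by move=> /(_ measurableT Y mY).
Qed.

Section weak_derivatives.
Context (R : realType) (n : nat) (D : set 'rV[R]_n).
Hypotheses (oD : open D) (bD : bounded_set D).
Let mD : measurable D := open_measurable_rV oD.
Local Notation X := ('rV[R]_n -> R^o).
Local Notation lam := (leb R n).
Local Notation L2D := (L2 lam D).
Local Notation inn := (inner lam D).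
Implicit Types (f g phi : 'rV[R]_n -> R).

Lemma smooth_L2 f : smooth f -> L2D f.
Proof.
by move=> /smooth_continuous; apply: continuous_L2 => //; exact: leb_bounded.
Qed.

Lemma test_L2 phi : test_function D phi -> L2D phi.
Proof. by case=> sp _; exact: smooth_L2. Qed.

Lemma test_partial phi i : test_function D phi -> test_function D (partial i phi).
Proof.
move=> [sp [K [cK KD p0]]]; split; first exact: smooth_partial.
exists K; split => // x nKx; rewrite /partial (@near_eq_derive _ _ _ _ (cst 0)) ?derive_cst//.
have : open (~` K) by apply: closed_openC; apply: compact_closed => //; exact: norm_hausdorff.
rewrite openE => /(_ x nKx); apply: filterS => y; exact: p0.
Qed.

Lemma testM f phi : smooth f -> test_function D phi -> test_function D (fun x => f x * phi x).
Proof.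
move=> sf [sp [K [cK KD p0]]]; split; first exact: smoothM.
by exists K; split => // x /p0 ->; rewrite mulr0.
Qed.

Lemma test_bounded phi : test_function D phi ->
  exists M, forall x, M < `|x| -> phi x = 0.
Proof.
move=> [_ [K [_ KD p0]]]; have [M [_ hM]] := bD; exists (`|M| + 1) => x Mx.
apply: p0 => /KD/(hM (`|M| + 1)); rewrite (le_lt_trans (ler_norm _)) ?ltrDl// => /(_ erefl).
by move=> /(lt_le_trans Mx); rewrite ltxx.
Qed.

Lemma integral_test_partial phi i : test_function D phi ->
  \int[lam]_(x in D) partial i phi x = 0.
Proof.
move=> tphi; have [M pM] := test_bounded tphi.
have [_ [K [_ KD p0]]] := test_partial i tphi.
rewrite Rintegral_mkcond /Rintegral.
have -> : partial i phi \_ D = partial i phi.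
  apply/funext => x; rewrite patchE; case: ifPn => //; rewrite notin_setE => Dx.
  by rewrite p0// => /KD.
rewrite (@integral_partial_eq0 _ _ _ _ M)// => [x|].
  by apply: smooth_derivable; case: tphi.
by apply: smooth_continuous; apply: smooth_partial; case: tphi.
Qed.

(** Integrate the derivative of the product, which is a test function. *)
Lemma inner_partial f phi i : smooth f -> test_function D phi ->
  inn f (partial i phi) = - inn (partial i f) phi.
Proof.
move=> sf tphi; have [sphi _] := tphi; apply/eqP; rewrite -addr_eq0; apply/eqP.
have Lf := smooth_L2 sf; have Lphi := test_L2 tphi.
have Ldf := smooth_L2 (smooth_partial i sf); have Ldphi := test_L2 (test_partial i tphi).
rewrite /inner -RintegralD//; try exact: L2_integrableM.
rewrite -[RHS](integral_test_partial i (testM sf tphi)).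
by apply: eq_Rintegral => x _; rewrite partialM// [phi x * _]mulrC.
Qed.

(** Bumps approximate the indicators of the boxes, so g has integral zero on every box
    whose closure lies in D. By Dynkin's theorem its integral vanishes on all Borel
    subsets of such a box, hence g vanishes almost everywhere there; countably many of
    them cover D. *)
Lemma du_bois_reymond g : L2D g ->
  (forall phi, test_function D phi -> inn g phi = 0) ->
  {ae lam, forall x, D x -> g x = 0}.
Proof.
move=> Lg g0; have [mg _] := Lg.
have L1 : L2D (cst 1) by apply: smooth_L2; exact: smooth_cst.
have ig : lam.-integrable D (EFin \o g).
  by have := L2_integrableM mD Lg L1; congr (_.-integrable); apply/funext => x /=; rewrite mulr1.
have gbox a b : cbox a b `<=` D -> (\int[lam]_(x in obox a b) (g x)%:E = 0)%E.
  move=> abD.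
  have oD' : obox a b `<=` D by move=> x h; apply: abD => i; have /andP[/ltW-> /ltW->] := h i.
  have mo := measurable_obox a b.
  have oE : D `&` obox a b = obox a b by apply/setIidPr.
  have mbump k : measurable_fun D (box_bump a b k).
    exact: measurable_funTS (continuous_measurable_rV (smooth_continuous (smooth_bump a b k))).
  have [] := @dominated_convergence _ _ _ lam D mD
    (fun k x => (g x * box_bump a b k x)%:E) ((EFin \o g) \_ (obox a b)) (abse \o (EFin \o g)).
  - by move=> k; apply/measurable_EFinP; exact: measurable_funM.
  - apply/(measurable_restrict _ mo mD); rewrite ?oE ?[_ `&` D]setIC ?oE.
    by apply: (measurable_funS mD oD'); exact/measurable_EFinP.
  - apply: aeW => x Dx; rewrite patchE.
    have : (g x * box_bump a b k x)%:E @[k --> \oo] --> (g x * \1_(obox a b) x)%:E.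
      apply: cvg_EFin; first exact: nearW.
      by apply: cvgM; [exact: cvg_cst|exact: bump_cvg].
    by rewrite indicE; case: ifP => _; rewrite ?mulr1// mulr0.
  - exact: integrable_abse.
  - apply: aeW => x k Dx; rewrite /= lee_fin normrM ler_piMr//.
    by have /andP[h0 h1] := bump_ge0_le1 a b k x; rewrite ger0_norm.
  move=> _ _; rewrite -integral_mkcondr oE => h.
  have E k : (\int[lam]_(x in D) (g x * box_bump a b k x)%:E = 0)%E.
    have := g0 _ (test_bump k abD); rewrite /inner /Rintegral => gk.
    rewrite -[LHS]fineK ?gk//.
    exact: (integrable_fin_num mD (L2_integrableM mD Lg (test_L2 (test_bump k abD)))).
  move: h; rewrite (_ : [sequence _]_n = cst 0%E); last by apply/funext => k; exact: E.
  by move=> /cvg_lim <-//; rewrite lim_cst.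
(* pass from D to the countably many rational boxes inside D *)
pose A (q : 'rV[rat]_n * 'rV[rat]_n) := obox (ratr_mx R q.1) (ratr_mx R q.2).
pose C (q : 'rV[rat]_n * 'rV[rat]_n) := cbox (ratr_mx R q.1) (ratr_mx R q.2).
suff H q : C q `<=` D -> {ae lam, forall x, A q x -> g x = 0}.
  have : {ae lam, forall x (k : nat), if unpickle k is Some q then C q `<=` D -> A q x -> g x = 0 else True}.
    apply: ae_foralln => k; case: (unpickle k) => [q|]; last exact: aeW.
    have [CD|CD] := pselect (C q `<=` D); last by apply: aeW => x /CD.
    by apply: filterS (H q CD) => x h _; exact: h.
  apply: filterS => x h Dx; move: (Dx); rewrite [in X in X -> _](open_bigcup_obox oD) => -[q /= CD Aq].
  by have := h (pickle q); rewrite pickleK; apply.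
move=> CD; have mA : measurable (A q) by exact: measurable_obox.
have AD : A q `<=` D by move=> x h; apply: CD => i; have /andP[/ltW-> /ltW->] := h i.
have iA : lam.-integrable (A q) (EFin \o g) by exact: integrableS ig.
have gS S : measurable S -> (\int[lam]_(x in A q `&` S) (g x)%:E = 0)%E.
  move=> mS; pose G := [set B : set 'rV[R]_n | exists a, B = [set x | forall i, a i < x ord0 i]].
  have mG : measurable = <<s G >> :> set (set 'rV[R]_n) := measurable_orthants R n.
  apply: (@dynkin_induction _ _ G (fun S => (\int[lam]_(x in A q `&` S) (g x)%:E = 0)%E) mG).
  - move=> _ _ [a ->] [b ->]; exists (fun i => Num.max (a i) (b i)).
    apply/seteqP; split => x /= => [[ha hb] i|h]; first by rewrite gt_max ha hb.
    by split=> i; have := h i; rewrite gt_max => /andP[].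
  - rewrite setIT; exact: gbox.
  - move=> _ [a ->].
    have -> : A q `&` [set x | forall i, a i < x ord0 i] =
        obox (\row_i Num.max (a i) (ratr_mx R q.1 ord0 i)) (ratr_mx R q.2).
      apply/seteqP; split => x => [[hA ha] i|h].
        by rewrite mxE gt_max ha; exact: hA.
      split=> i; have := h i; rewrite mxE gt_max => /andP[/andP[h1 h2] h3] //.
      by rewrite h2 h3.
    apply: gbox => x h; apply: CD => i; have := h i; rewrite mxE ge_max => /andP[/andP[_ ->]].
    by [].
  - move=> B mB hB.
    have := @integral_setU _ _ _ lam (A q `&` B) (A q `&` ~` B) (EFin \o g).
    rewrite -setIUr setUv setIT hB add0r => <- //.
    + exact: gbox.
    + exact: measurableI.
    + by apply: measurableI => //; exact: measurableC.
    + by case/integrableP : iA.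
    + by apply/disj_setPS; rewrite setIACA setICr setI0.
  - move=> F mF tF hF; rewrite setI_bigcupr integral_bigcup.
    + by rewrite eseries0.
    + exact: trivIset_setIl.
    + by move=> k; exact: measurableI.
    + apply: integrableS iA => //; first by apply: bigcup_measurable => k _; exact: measurableI.
      by move=> x [k _ []].
  by rewrite -mG.
have : ae_eq lam (A q) (EFin \o g) (cst 0%E).
  apply: integral_ae_eq => // E EA mE.
  by rewrite integral_cst// mul0e -[RHS](gS E mE); congr integral; apply/esym/setIidPr.
by apply: filterS => x h Ax; have /= [] := h Ax.
Qed.

End weak_derivatives.

(** * Weak derivatives and divergences *)

Section sobolev_theory.
Context (R : realType) (n : nat) (D : set 'rV[R]_n).
Hypotheses (oD : open D) (bD : bounded_set D).
Let mD : measurable D := open_measurable_rV oD.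
Local Notation X := ('rV[R]_n -> R^o).
Local Notation lam := (leb R n).
Local Notation L2D := (L2 lam D).
Local Notation inn := (inner lam D : X -> X -> R).
Local Notation Y := ('rV[R]_n -> 'M[R]_n).
Local Notation Z := ('rV[R]_n -> 'rV[R]_n).
Implicit Types (f g h u v z phi : 'rV[R]_n -> R).

Let L2s : semi_inner_product (L2D : set X) inn := L2_sip lam mD.

(** The difference vanishes almost everywhere by the fundamental lemma. In place of
    pointwise identities between weak derivatives, everything below is stated by testing
    them against square integrable functions, as this lemma allows. *)
Lemma eq_inner_test g h : L2D g -> L2D h ->
  (forall phi, test_function D phi -> inn g phi = inn h phi) ->
  forall z, L2D z -> inn g z = inn h z.
Proof.
move=> Lg Lh gh z Lz.
have sS := sip_subspace L2s.
have Lgh : L2D ((g : X) - h) := subspace_sub sS Lg Lh.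
have ae0 : {ae lam, forall x, D x -> ((g : X) - h) x = 0}.
  apply: (du_bois_reymond oD bD Lgh) => phi tphi; have Lphi := test_L2 oD bD tphi.
  rewrite [LHS](linear_onB (S := L2D : set X) (f := inn^~ phi))//; first by rewrite gh// subrr.
  by move=> a x y Lx Ly; exact: (sip_lin L2s).
symmetry; apply: ae_inner => //; first by case: Lh.
by apply: filterS ae0 => x h0 Dx; apply/eqP; rewrite eq_sym -subr_eq0; apply/eqP; exact: h0.
Qed.

Lemma weak_partial_lin i (a : R) u v g h : L2D u -> L2D v ->
  weak_partial D i u g -> weak_partial D i v h ->
  weak_partial D i (fun x => a * u x + v x) (fun x => a * g x + h x).
Proof.
move=> Lu Lv [Lg ug] [Lh vh]; split; first exact: (sip_subspace L2s).2.
move=> phi tphi; have Lphi := test_L2 oD bD tphi.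
have Ldphi := test_L2 oD bD (test_partial i tphi).
by rewrite !inner_lin// ug// vh//; ring.
Qed.

Lemma weak_partial_unique i u g h z : weak_partial D i u g -> weak_partial D i u h ->
  L2D z -> inn g z = inn h z.
Proof.
move=> [Lg ug] [Lh uh]; apply: eq_inner_test => // phi tphi.
by apply: oppr_inj; rewrite -ug// uh.
Qed.

(** Functions in the same class have the same weak derivatives. *)
Lemma weak_partial_ext i u u' g : (forall z, L2D z -> inn u z = inn u' z) ->
  weak_partial D i u g -> weak_partial D i u' g.
Proof.
move=> uu [Lg ug]; split => // phi tphi; rewrite -ug//; symmetry; apply: uu.
exact: test_L2 (test_partial i tphi).
Qed.

Lemma wDP i u : (exists g, weak_partial D i u g) -> weak_partial D i u (wD D i u).
Proof. by move=> [g ug]; exact: (xgetPex (fun=> 0) (ex_intro _ g ug)). Qed.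

Lemma H1_L2 u : H1 D u -> L2D u. Proof. by case. Qed.

Lemma H1_wD u i : H1 D u -> weak_partial D i u (wD D i u).
Proof. by case=> _ /(_ i); exact: wDP. Qed.

Lemma H1_wD_L2 u i : H1 D u -> L2D (wD D i u).
Proof. by move=> /(H1_wD i)[]. Qed.

Lemma H1_subspace : linear_subspace (H1 D : set X).
Proof.
split=> [|a u v Hu Hv].
  split=> [|i]; first exact: (sip_subspace L2s).1.
  exists (fun=> 0); split; first exact: (sip_subspace L2s).1.
  move=> phi tphi; rewrite (linear_on0 (sip_subspace L2s) (f := inn^~ _)).
    rewrite (linear_on0 (sip_subspace L2s) (f := inn^~ _)) ?oppr0//.
    by move=> b x y Lx Ly; apply: (sip_lin L2s) => //; exact: test_L2.
  move=> b x y Lx Ly; apply: (sip_lin L2s) => //; exact: test_L2 (test_partial i tphi).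
split=> [|i]; first by apply: (sip_subspace L2s).2; exact: H1_L2.
exists (fun x => a * wD D i u x + wD D i v x).
by apply: weak_partial_lin; [exact: H1_L2|exact: H1_L2|exact: H1_wD|exact: H1_wD].
Qed.

Lemma wD_lin i (a : R) u v z : H1 D u -> H1 D v -> L2D z ->
  inn (wD D i (fun x => a * u x + v x)) z = a * inn (wD D i u) z + inn (wD D i v) z.
Proof.
move=> Hu Hv Lz; have Huv : H1 D (fun x => a * u x + v x) := H1_subspace.2 a _ _ Hu Hv.
rewrite -(inner_lin mD a (H1_wD_L2 i Hu) (H1_wD_L2 i Hv) Lz).
apply: weak_partial_unique (H1_wD i Huv) _ Lz.
by apply: weak_partial_lin; [exact: H1_L2|exact: H1_L2|exact: H1_wD|exact: H1_wD].
Qed.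

Lemma smooth_weak_partial i f : smooth f -> weak_partial D i f (partial i f).
Proof.
move=> sf; split; first by apply: smooth_L2 => //; exact: smooth_partial.
by move=> phi tphi; exact: inner_partial.
Qed.

Lemma smooth_H1 f : smooth f -> H1 D f.
Proof.
move=> sf; split; first exact: smooth_L2.
by move=> i; exists (partial i f); exact: smooth_weak_partial.
Qed.

Lemma wD_smooth i f z : smooth f -> L2D z -> inn (wD D i f) z = inn (partial i f) z.
Proof.
move=> sf; apply: weak_partial_unique; first by apply: H1_wD; exact: smooth_H1.
exact: smooth_weak_partial.
Qed.

Definition grad_ip u v : R := \sum_i inn (wD D i u) (wD D i v).

Definition H1_ip u v : R := inn u v + grad_ip u v.

Lemma wD_sip i : semi_inner_product (H1 D : set X) (fun u v => inn (wD D i u) (wD D i v)).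
Proof.
apply: (@sip_pullback R X X _ _ _ (fun u => wD D i u) L2s).
- exact: H1_subspace.
- by move=> u; exact: H1_wD_L2.
- by move=> a u v z Hu Hv Lz; exact: wD_lin.
Qed.

Lemma grad_sip : semi_inner_product (H1 D : set X) (grad_ip : X -> X -> R).
Proof. by apply: sip_sum; [exact: H1_subspace|exact: wD_sip]. Qed.

Lemma H1_sip : semi_inner_product (H1 D : set X) (H1_ip : X -> X -> R).
Proof.
apply: (sip_add (ip1 := inn) (ip2 := (grad_ip : X -> X -> R))); last exact: grad_sip.
exact: (sip_sub L2s H1_subspace H1_L2).
Qed.

Lemma sqr_norm0 u : norm0 lam D u ^+ 2 = inn u u.
Proof. by rewrite sqr_sqrtr// inner_ge0. Qed.

Lemma H1_semiE u : H1_semi D u = snorm (grad_ip : X -> X -> R) u.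
Proof. by rewrite /H1_semi /snorm; congr Num.sqrt; apply: eq_bigr => i _; rewrite sqr_norm0. Qed.

Lemma sqr_H1_semi u : H1_semi D u ^+ 2 = grad_ip u u.
Proof.
by rewrite H1_semiE sqr_sqrtr// sumr_ge0// => i _; exact: inner_ge0.
Qed.

Lemma H1_normE u : H1_norm D u = snorm (H1_ip : X -> X -> R) u.
Proof. by rewrite /H1_norm sqr_norm0 sqr_H1_semi. Qed.

Lemma norm0_le_H1_norm u : norm0 lam D u <= H1_norm D u.
Proof.
rewrite H1_normE /norm0 /snorm ler_wsqrtr// /H1_ip lerDl sumr_ge0// => i _.
exact: inner_ge0.
Qed.

Lemma wD_le_H1_norm i u : norm0 lam D (wD D i u) <= H1_norm D u.
Proof.
rewrite H1_normE /norm0 /snorm ler_wsqrtr// /H1_ip.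
apply: ler_wpDl; first exact: inner_ge0.
by rewrite /grad_ip (bigD1 i)//= lerDl sumr_ge0// => j _; exact: inner_ge0.
Qed.

Lemma innermE_row (g h : Z) :
  innerm lam D g h = \sum_i inn (fun x => g x ord0 i) (fun x => h x ord0 i).
Proof. by rewrite /innerm big_ord1. Qed.

Lemma L2m_row (g : Z) : L2m lam D g <-> forall i, L2D (fun x => g x ord0 i).
Proof. by split=> [h i|h i j]; [exact: h|rewrite ord1; exact: h]. Qed.

Lemma weak_div_unique (tau : Y) (g h z : Z) : weak_div D tau g -> weak_div D tau h ->
  L2m lam D z -> innerm lam D g z = innerm lam D h z.
Proof.
move=> [Lg tg] [Lh th] Lz; rewrite !innermE_row; apply: eq_bigr => i _.
apply: eq_inner_test; [exact: Lg|exact: Lh| |exact: Lz].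
by move=> phi tphi; apply: oppr_inj; rewrite -tg// th.
Qed.

Lemma weak_div_lin (a : R) (s t : Y) (g h : Z) : L2m lam D s -> L2m lam D t ->
  weak_div D s g -> weak_div D t h -> weak_div D (a *: s + t) (a *: g + h).
Proof.
move=> Ls Lt [Lg sg] [Lh th]; split; first exact: (L2m_subspace lam mD 1 n).2.
move=> i phi tphi; have Lphi := test_L2 oD bD tphi.
have -> : inner lam D (fun x => (a *: g + h) x ord0 i) phi =
    a * inn (fun x => g x ord0 i) phi + inn (fun x => h x ord0 i) phi.
  rewrite -inner_lin//; by apply: eq_inner => // x _; rewrite !mxE.
rewrite opprD -mulrN -sg// -th// mulr_sumr -big_split/=; apply: eq_bigr => j _.
rewrite -inner_lin//; last exact: test_L2 (test_partial j tphi).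
by apply: eq_inner => // x _; rewrite !mxE.
Qed.

Lemma wdivP (tau : Y) : Hdiv D tau -> weak_div D tau (wdiv D tau).
Proof. by move=> [_ _ [g tg]]; exact: (xgetPex (fun=> 0) (ex_intro _ g tg)). Qed.

Lemma Hdiv_L2 (tau : Y) : Hdiv D tau -> L2m lam D tau.
Proof. by case. Qed.

Lemma wdiv_L2 (tau : Y) : Hdiv D tau -> L2m lam D (wdiv D tau).
Proof. by move=> /wdivP[]. Qed.

Lemma Hdiv_subspace : linear_subspace (Hdiv D : set Y).
Proof.
split=> [|a s t Hs Ht].
  split; first exact: (L2m_subspace lam mD n n).1.
    by move=> x _; rewrite trmx0.
  exists 0; split; first exact: (L2m_subspace lam mD 1 n).1.
  move=> i phi tphi; rewrite big1 => [|j _].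
    rewrite (_ : (fun x => _) = cst 0); last by apply/funext => x; rewrite mxE.
    rewrite /inner; under eq_Rintegral do rewrite mul0r.
    by rewrite Rintegral_cst// mul0r oppr0.
  rewrite (_ : (fun x => _) = cst 0); last by apply/funext => x; rewrite mxE.
  rewrite /inner; under eq_Rintegral do rewrite mul0r.
  by rewrite Rintegral_cst// mul0r.
split; first by apply: (L2m_subspace lam mD n n).2; exact: Hdiv_L2.
  move=> x Dx; case: Hs Ht => _ hs _ [_ ht _].
  by rewrite -[(a *: s + t) x]/(a *: s x + t x) linearD linearZ/= hs// ht.
by exists (a *: wdiv D s + wdiv D t); apply: weak_div_lin;
  [exact: Hdiv_L2|exact: Hdiv_L2|exact: wdivP|exact: wdivP].
Qed.

Lemma wdiv_lin (a : R) (s t : Y) (z : Z) : Hdiv D s -> Hdiv D t -> L2m lam D z ->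
  innerm lam D (wdiv D (a *: s + t)) z =
  a * innerm lam D (wdiv D s) z + innerm lam D (wdiv D t) z.
Proof.
move=> Hs Ht Lz; have Hst := Hdiv_subspace.2 a s t Hs Ht.
rewrite -(sip_lin (L2m_sip lam mD 1 n))//; try exact: wdiv_L2.
apply: weak_div_unique (wdivP Hst) _ Lz.
by apply: weak_div_lin; [exact: Hdiv_L2|exact: Hdiv_L2|exact: wdivP|exact: wdivP].
Qed.

Definition div_ip (s t : Y) : R :=
  innerm lam D s t + innerm lam D (wdiv D s) (wdiv D t).

Lemma div_sip : semi_inner_product (Hdiv D : set Y) div_ip.
Proof.
apply: (sip_add (ip1 := @innerm R n lam D n n : Y -> Y -> R)
  (ip2 := fun s t => innerm lam D (wdiv D s) (wdiv D t))).
  exact: (sip_sub (L2m_sip lam mD n n) Hdiv_subspace Hdiv_L2).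
apply: (sip_pullback (L := wdiv D) (L2m_sip lam mD 1 n)).
- exact: Hdiv_subspace.
- by move=> s; exact: wdiv_L2.
- by move=> a s t z Hs Ht Lz; exact: wdiv_lin.
Qed.

Lemma innerm_ge0 p q (F : 'rV[R]_n -> 'M[R]_(p, q)) : 0 <= innerm lam D F F.
Proof. by apply: sumr_ge0 => i _; apply: sumr_ge0 => j _; exact: inner_ge0. Qed.

Lemma sqr_norm0m p q (F : 'rV[R]_n -> 'M[R]_(p, q)) : norm0m lam D F ^+ 2 = innerm lam D F F.
Proof. by rewrite sqr_sqrtr// innerm_ge0. Qed.

Lemma sqr_Hdiv_norm (tau : Y) : Hdiv_norm D tau ^+ 2 = div_ip tau tau.
Proof. by rewrite sqr_sqrtr ?addr_ge0 ?sqr_ge0// !sqr_norm0m. Qed.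

Lemma Hdiv_normE (tau : Y) : Hdiv_norm D tau = snorm div_ip tau.
Proof. by rewrite /Hdiv_norm !sqr_norm0m. Qed.

End sobolev_theory.

(** * The Poincare inequality and integration by parts *)

Section poincare_korn.
Context (R : realType) (n : nat) (D : set 'rV[R]_n).
Hypotheses (oD : open D) (bD : bounded_set D).
Let mD : measurable D := open_measurable_rV oD.
Local Notation X := ('rV[R]_n -> R^o).
Local Notation lam := (leb R n).
Local Notation L2D := (L2 lam D).
Local Notation inn := (inner lam D : X -> X -> R).
Implicit Types (f g h u v z phi psi : 'rV[R]_n -> R).

Let L2s : semi_inner_product (L2D : set X) inn := L2_sip lam mD.
Let H1s := H1_sip oD bD.

(** The norms are made opaque below; these equations unfold them. *)
Lemma norm0E u : norm0 lam D u = snorm inn u. Proof. by []. Qed.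

Lemma norm0_sqrt u : norm0 lam D u = Num.sqrt (inn u u). Proof. by []. Qed.

Lemma norm0_ge0 u : 0 <= norm0 lam D u. Proof. exact: sqrtr_ge0. Qed.

Lemma inner_le_norm0 u v : L2D u -> L2D v -> `|inn u v| <= norm0 lam D u * norm0 lam D v.
Proof. by move=> Lu Lv; exact: (cauchy_schwarz L2s). Qed.

Lemma test_H1 phi : test_function D phi -> H1 D phi.
Proof. by case=> sp _; exact: smooth_H1. Qed.

Lemma norm0_wD_test i phi : test_function D phi ->
  norm0 lam D (wD D i phi) = norm0 lam D (partial i phi).
Proof.
move=> tp; have [sp _] := tp; have Hp := test_H1 tp.
have Ld := test_L2 oD bD (test_partial i tp).
rewrite /norm0 wD_smooth//; last exact: H1_wD_L2.
by rewrite innerC wD_smooth.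
Qed.

Lemma le_norm0 f g : L2D f -> L2D g -> (forall x, D x -> `|f x| <= `|g x|) ->
  norm0 lam D f <= norm0 lam D g.
Proof.
move=> Lf Lg fg; apply: ler_wsqrtr; apply: le_Rintegral => //; try exact: L2_integrableM.
move=> x Dx; rewrite -!expr2 -(real_normK (num_real (f x))) -(real_normK (num_real (g x))).
by rewrite lerXn2r ?nnegrE// fg.
Qed.

(** Integrating by parts the product of x_i phi and the i-th derivative of phi gives
    (phi, phi) = - 2 (x_i phi, d_i phi), and |x_i| is at most M on D. *)
Lemma poincare_test M i phi : 0 <= M -> D `<=` box M -> test_function D phi ->
  norm0 lam D phi <= 2 * M * norm0 lam D (partial i phi).
Proof.
move=> M0 DM tp; have [sp _] := tp.
have sx := @smooth_coord R n i.
pose psi (x : 'rV[R]_n) : R := x ord0 i * phi x; have spsi : smooth psi by exact: smoothM.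
have Lp := test_L2 oD bD tp; have Ld := test_L2 oD bD (test_partial i tp).
have Lpsi : L2D psi by exact: smooth_L2.
have E : inn phi phi = - (2 * inn psi (partial i phi)).
  have := inner_partial oD bD i spsi tp.
  have -> : partial i psi = fun x => 1 * (x ord0 i * partial i phi x) + phi x.
    by apply/funext => x; rewrite partialM// (derive_coord _ _ _).2 eqxx mulr1 mul1r.
  have Lxd : L2D (fun x => x ord0 i * partial i phi x).
    apply: (smooth_L2 oD bD); apply: (smoothM sx); exact: smooth_partial.
  rewrite (inner_lin mD 1 Lxd Lp Lp).
  have -> : inner lam D (fun x => x ord0 i * partial i phi x) phi = inn psi (partial i phi).
    by apply: eq_Rintegral => x _; rewrite /psi mulrAC.
  by move: (inner _ _ _ _) (inner _ _ _ _) => a b h; lra.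
have hpsi : norm0 lam D psi <= M * norm0 lam D phi.
  rewrite -[M in leRHS](ger0_norm M0) -(snormZ L2s)//.
  apply: le_norm0 => //; first exact: (subspace_scale (sip_subspace L2s)).
  by move=> x Dx; rewrite /psi !normrM (ger0_norm M0) ler_wpM2r//; exact: DM.
have : norm0 lam D phi ^+ 2 <= 2 * (M * norm0 lam D phi * norm0 lam D (partial i phi)).
  rewrite sqr_norm0 E -mulrN ler_wpM2l//; apply: le_trans (ler_norm _) _; rewrite normrN.
  apply: le_trans (inner_le_norm0 Lpsi Ld) _.
  by apply: ler_wpM2r => //; exact: norm0_ge0.
have := norm0_ge0 (partial i phi).
have := norm0_ge0 phi; rewrite le_eqVlt => /orP[/eqP <- d0 _|p0 _].
  by rewrite !mulr_ge0.
rewrite expr2 => h; rewrite -(ler_pM2l p0); apply: le_trans h _.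
by rewrite le_eqVlt; apply/orP; left; apply/eqP; ring.
Qed.

Definition hess_ip u v : R :=
  \sum_i \sum_j inn (wD D j (wD D i u)) (wD D j (wD D i v)).

Lemma sqr_H2_semi u : H2_semi D u ^+ 2 = hess_ip u u.
Proof.
rewrite sqr_sqrtr; last by do 2!(apply: sumr_ge0 => ? _); rewrite sqr_ge0.
by do 2!(apply: eq_bigr => ? _); rewrite sqr_norm0.
Qed.

Lemma H2_semi_ge0 u : 0 <= H2_semi D u. Proof. exact: sqrtr_ge0. Qed.

Local Opaque inner wD norm0 H1_norm H1_semi H2_semi.

Lemma norm_sub_le2 (a b p q : R) : `|a| <= p * q -> `|b| <= p * q -> `|a - b| <= 2 * q * p.
Proof. by move=> ha hb; apply: le_trans (ler_normB _ _) _; lra. Qed.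

Lemma le_mul_swap (a p q N : R) : 0 <= q -> p <= N -> a <= p * q -> a <= q * N.
Proof. by move=> q0 pN h; apply: (le_trans h); rewrite mulrC ler_wpM2l. Qed.

Lemma linear_comb_sub (a p p1 p2 q q1 q2 : R) : p = a * p1 + p2 -> q = a * q1 + q2 ->
  p - q = a * (p1 - q1) + (p2 - q2).
Proof. by move=> -> ->; ring. Qed.

Lemma linear_comb_add (a p p1 p2 q q1 q2 : R) : p = a * p1 + p2 -> q = a * q1 + q2 ->
  p + q = a * (p1 + q1) + (p2 + q2).
Proof. by move=> -> ->; ring. Qed.

Lemma H1_norm_ge0 u : 0 <= H1_norm D u. Proof. by rewrite H1_normE sqrtr_ge0. Qed.

Lemma H1_semi_ge0 u : 0 <= H1_semi D u. Proof. by rewrite H1_semiE sqrtr_ge0. Qed.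

Lemma sqr_H1_norm u : H1_norm D u ^+ 2 = norm0 lam D u ^+ 2 + H1_semi D u ^+ 2.
Proof.
rewrite H1_normE sqr_sqrtr ?sqr_norm0 ?sqr_H1_semi// addr_ge0 ?inner_ge0//.
by rewrite sumr_ge0// => i _; exact: inner_ge0.
Qed.

Lemma H10_H1 u : H10 D u -> H1 D u. Proof. by case. Qed.

Lemma H10_approx u (e : R) : H10 D u -> 0 < e ->
  exists2 phi, test_function D phi & H1_norm D ((u : X) - phi) < e.
Proof.
move=> [Hu [phi tphi]] /cvgr0Pnorm_lt h /h [k _ /(_ k (leqnn k)) hk].
exists (phi k) => //; apply: le_lt_trans hk; exact: ler_norm.
Qed.

Lemma norm0m_le_H1v p (v : 'rV[R]_n -> 'rV[R]_p) : norm0m lam D v <= H1v_norm D v.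
Proof.
apply: ler_wsqrtr; rewrite /innerm big_ord1; apply: ler_sum => i _.
by rewrite -sqr_norm0 sqr_H1_norm lerDl sqr_ge0.
Qed.

(** F u = F (u - phi) is small when phi is a test function close to u. *)
Lemma H10_density (F : X -> R) C :
  (forall a u v, H1 D u -> H1 D v -> F (a *: u + v) = a * F u + F v) ->
  (forall u, H1 D u -> `|F u| <= C * H1_norm D u) ->
  (forall phi, test_function D phi -> F phi = 0) ->
  forall u, H10 D u -> F u = 0.
Proof.
move=> FB FC F0 u Hu; apply/eqP; rewrite -normr_le0; apply/ler_addgt0Pr => e e0; rewrite add0r.
have e1 : 0 < e / (`|C| + 1) by rewrite divr_gt0// ltr_wpDl.
have [phi tphi hphi] := H10_approx Hu e1.
have H1u := H10_H1 Hu; have H1p := test_H1 tphi.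
have -> : F u = F ((u : X) - phi) by rewrite (linear_onB FB H1u H1p) (F0 _ tphi) subr0.
have H1up : H1 D ((u : X) - phi) := subspace_sub (sip_subspace H1s) H1u H1p.
apply: le_trans (FC _ H1up) _.
have N0 := H1_norm_ge0 ((u : X) - phi).
apply: (@le_trans _ _ ((`|C| + 1) * H1_norm D ((u : X) - phi))).
  by rewrite ler_wpM2r// (le_trans (ler_norm _))// lerDl.
by rewrite mulrC -ler_pdivlMr ?ltr_wpDl//; exact: ltW.
Qed.

Lemma poincare M i u : 0 <= M -> D `<=` box M -> H10 D u ->
  norm0 lam D u <= 2 * M * norm0 lam D (wD D i u).
Proof.
move=> M0 DM Hu; apply/ler_addgt0Pr => e e0.
have e1 : 0 < e / (1 + 2 * M) by rewrite divr_gt0// ltr_pwDl// mulr_ge0.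
have [phi tphi hphi] := H10_approx Hu e1.
have H1u := H10_H1 Hu; have H1p := test_H1 tphi.
have H1pu : H1 D ((u : X) - phi) := subspace_sub (sip_subspace H1s) H1u H1p.
have sw := wD_sip oD bD i.
pose w : X -> R := snorm (fun u v => inn (wD D i u) (wD D i v)).
have hw : norm0 lam D (partial i phi) <= w u + H1_norm D ((u : X) - phi).
  rewrite -norm0_wD_test// -[norm0 _ _ _]/(w phi).
  have E : (phi : X) = (u : X) - ((u : X) - phi) by rewrite subKr.
  rewrite [X in w X]E (le_trans (snorm_triangleB sw H1u H1pu))// lerD2l.
  exact: wD_le_H1_norm.
have hn : norm0 lam D u <= H1_norm D ((u : X) - phi) + norm0 lam D phi.
  have E : (u : X) = ((u : X) - phi) + phi by rewrite subrK.
  rewrite !norm0E [X in snorm _ X <= _]E.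
  apply: le_trans (snorm_triangle L2s (H1_L2 H1pu) (H1_L2 H1p)) _.
  by rewrite lerD2r; exact: norm0_le_H1_norm.
apply: le_trans hn _; apply: le_trans (lerD (lexx _) (poincare_test i M0 DM tphi)) _.
apply: (@le_trans _ _ (H1_norm D ((u : X) - phi) + 2 * M * (w u + H1_norm D ((u : X) - phi)))).
  by rewrite lerD2l ler_wpM2l// mulr_ge0.
rewrite mulrDr addrCA lerD2l -{1}[H1_norm _ _]mul1r -mulrDl mulrC.
by rewrite -ler_pdivlMr ?ltW// ltr_pwDl// mulr_ge0.
Qed.

(** For test functions, integrate by parts twice and use that second derivatives
    commute. Density extends this to both arguments, one after the other. *)
Lemma inner_wDC i j u v : H10 D u -> H10 D v ->
  inn (wD D i u) (wD D j v) = inn (wD D j u) (wD D i v).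
Proof.
have wL k w : H1 D w -> L2D (wD D k w) by exact: H1_wD_L2.
have bound k l w w' : H1 D w -> H1 D w' ->
    `|inn (wD D k w) (wD D l w')| <= H1_norm D w * H1_norm D w'.
  move=> Hw Hw'; apply: le_trans (inner_le_norm0 (wL _ _ Hw) (wL _ _ Hw')) _.
  by apply: ler_pM; rewrite ?norm0_ge0// wD_le_H1_norm.
(* density in the first argument, for a fixed second one *)
have key w : H1 D w -> (forall phi, test_function D phi ->
    inn (wD D i phi) (wD D j w) = inn (wD D j phi) (wD D i w)) ->
    forall u, H10 D u -> inn (wD D i u) (wD D j w) = inn (wD D j u) (wD D i w).
  move=> Hw H u' Hu'; apply/eqP; rewrite -subr_eq0; apply/eqP.
  pose F : X -> R := fun u => inn (wD D i u) (wD D j w) - inn (wD D j u) (wD D i w).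
  apply: (@H10_density F (2 * H1_norm D w)) Hu' => [a x y Hx Hy|x Hx|phi tphi].
  - exact: (linear_comb_sub (wD_lin oD bD i a Hx Hy (wL j _ Hw)) (wD_lin oD bD j a Hx Hy (wL i _ Hw))).
  - exact: (norm_sub_le2 (bound i j _ _ Hx Hw) (bound j i _ _ Hx Hw)).
  - by apply/eqP; rewrite subr_eq0; apply/eqP; exact: H.
move=> Hu Hv; have H1v := H10_H1 Hv.
apply: (key _ H1v) Hu => phi tphi.
suff h : inn (wD D i v) (wD D j phi) = inn (wD D j v) (wD D i phi).
  exact: (etrans (innerC _ _ _ _) (etrans (esym h) (innerC _ _ _ _))).
have H1p := test_H1 tphi; have [sp _] := tphi.
apply/eqP; rewrite -subr_eq0; apply/eqP.
pose F : X -> R := fun u => inn (wD D i u) (wD D j phi) - inn (wD D j u) (wD D i phi).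
apply: (@H10_density F (2 * H1_norm D phi)) Hv => [a x y Hx Hy|x Hx|psi tpsi].
- exact: (linear_comb_sub (wD_lin oD bD i a Hx Hy (wL j _ H1p)) (wD_lin oD bD j a Hx Hy (wL i _ H1p))).
- exact: (norm_sub_le2 (bound i j _ _ Hx H1p) (bound j i _ _ Hx H1p)).
have H1q := test_H1 tpsi; have [sq _] := tpsi.
have E k l : inn (wD D k psi) (wD D l phi) = - inn (partial l (partial k psi)) phi.
  have Lk := test_L2 oD bD (test_partial k tpsi).
  rewrite (wD_smooth oD bD k sq (wL l _ H1p)) innerC (wD_smooth oD bD l sp Lk) innerC.
  by apply: inner_partial => //; exact: smooth_partial.
have C : partial j (partial i psi) = partial i (partial j psi).
  by apply/funext => x; exact: partialC.
apply/eqP; rewrite subr_eq0; apply/eqP.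
exact: (etrans (E i j) (etrans (congr1 (fun g => - inn g phi) C) (esym (E j i)))).
Qed.

Lemma H2_H1 u : H2 D u -> H1 D u. Proof. by case. Qed.

Lemma H2_wD u i : H2 D u -> H1 D (wD D i u). Proof. by case=> _; exact. Qed.

(** The weak gradient of a combination agrees with the combination of the weak gradients
    only almost everywhere, but this does not affect its derivatives. *)
Lemma wD2_weak_partial i j (a : R) u v : H2 D u -> H2 D v ->
  weak_partial D j (wD D i (fun x => a * u x + v x))
    (fun x => a * wD D j (wD D i u) x + wD D j (wD D i v) x).
Proof.
move=> Hu Hv; have [H1u H1v] := (H2_H1 Hu, H2_H1 Hv).
have [Hiu Hiv] := (H2_wD i Hu, H2_wD i Hv).
apply: (weak_partial_ext oD bD (u := fun x => a * wD D i u x + wD D i v x)).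
  by move=> z Lz; rewrite inner_lin ?wD_lin//; exact: H1_L2.
by apply: weak_partial_lin => //; [exact: H1_L2|exact: H1_L2|exact: H1_wD|exact: H1_wD].
Qed.

Lemma H2_subspace : linear_subspace (H2 D : set X).
Proof.
have z0 : H2 D 0.
  have sw i : forall z, L2D z -> inn 0 z = inn (wD D i 0) z.
    move=> z Lz; rewrite (linear_on0 (sip_subspace (wD_sip oD bD i)) (f := fun u => inn (wD D i u) z)).
      rewrite (linear_on0 (sip_subspace L2s) (f := inn^~ z))// => a x y Lx Ly.
      exact: (sip_lin L2s).
    by move=> a x y Hx Hy; exact: wD_lin.
  have H10 := (sip_subspace H1s).1; split => // i; split; first exact: H1_wD_L2.
  move=> j; exists 0; apply: (weak_partial_ext oD bD (sw i)).
  split; first exact: (sip_subspace L2s).1.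
  have [_ h] := smooth_weak_partial oD bD j (smooth_cst (n := n) (0 : R)).
  move=> phi tphi; rewrite -[X in inner _ _ X _]/(fun=> 0) h//.
  congr (- _); apply: eq_inner => // x _; by rewrite /partial derive_cst.
split; [exact: z0|move=> a u v Hu Hv].
have H1u := H2_H1 Hu; have H1v := H2_H1 Hv.
have H1uv : H1 D (a *: (u : X) + v) := (sip_subspace H1s).2 a u v H1u H1v.
split; [exact: H1uv|move=> i; split; first exact: (H1_wD_L2 i H1uv)].
by move=> j; eexists; exact: wD2_weak_partial.
Qed.

Lemma wD2_lin i j (a : R) u v z : H2 D u -> H2 D v -> L2D z ->
  inn (wD D j (wD D i (fun x => a * u x + v x))) z =
  a * inn (wD D j (wD D i u)) z + inn (wD D j (wD D i v)) z.
Proof.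
move=> Hu Hv Lz; have [Hiu Hiv] := (H2_wD i Hu, H2_wD i Hv).
have Huv : H2 D (fun x => a * u x + v x) := H2_subspace.2 a u v Hu Hv.
rewrite -inner_lin//; try exact: H1_wD_L2.
apply: (weak_partial_unique oD bD _ (wD2_weak_partial i j a Hu Hv) Lz).
by apply: H1_wD; exact: H2_wD.
Qed.

Lemma hess_sip : semi_inner_product (H2 D : set X) (hess_ip : X -> X -> R).
Proof.
apply: sip_sum; [exact: H2_subspace|move=> i].
apply: sip_sum; [exact: H2_subspace|move=> j].
apply: (@sip_pullback R X X _ _ _ (fun u => wD D j (wD D i u)) L2s).
- exact: H2_subspace.
- by move=> u Hu; apply: H1_wD_L2; exact: H2_wD.
- by move=> a u v z Hu Hv Lz; exact: wD2_lin.
Qed.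

Lemma H2_semiE u : H2_semi D u = snorm (hess_ip : X -> X -> R) u.
Proof. by rewrite /snorm -sqr_H2_semi sqrtr_sqr ger0_norm// H2_semi_ge0. Qed.

Lemma ler_sum_term (I : finType) (F : I -> R) i : (forall k, 0 <= F k) -> F i <= \sum_k F k.
Proof. by move=> F0; rewrite (bigD1 i)//= lerDl sumr_ge0. Qed.

Lemma wD2_le_H2_semi i j u : norm0 lam D (wD D j (wD D i u)) <= H2_semi D u.
Proof.
rewrite H2_semiE norm0_sqrt; apply: ler_wsqrtr; rewrite /hess_ip.
have g k l : 0 <= inn (wD D l (wD D k u)) (wD D l (wD D k u)) by exact: inner_ge0.
apply: le_trans (@ler_sum_term _ (fun k => \sum_l inn (wD D l (wD D k u)) (wD D l (wD D k u))) i _); last first.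
  by move=> k; apply: sumr_ge0.
exact: (@ler_sum_term _ (fun l => inn (wD D l (wD D i u)) (wD D l (wD D i u))) j (g i)).
Qed.

Lemma wD_le_H1_semi i u : norm0 lam D (wD D i u) <= H1_semi D u.
Proof.
rewrite H1_semiE norm0_sqrt; apply: ler_wsqrtr.
by apply: (@ler_sum_term _ (fun i => inn (wD D i u) (wD D i u))) => k; exact: inner_ge0.
Qed.

(** For u a test function in one argument, this is the definition of the weak
    derivatives of the gradient of u; both sides are continuous in that argument in the
    norm of H1. *)
Lemma grad_ip_laplacian u : H2 D u -> H10 D u ->
  grad_ip D u u = - \sum_i inn (wD D i (wD D i u)) u.
Proof.
move=> H2u H10u; have H1u := H2_H1 H2u; apply/eqP; rewrite -addr_eq0; apply/eqP.
pose F : X -> R := fun v => grad_ip D v u + \sum_i inn (wD D i (wD D i u)) v.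
have L2w i : L2D (wD D i (wD D i u)) by apply: H1_wD_L2; exact: H2_wD.
apply: (@H10_density F (\sum_i (norm0 lam D (wD D i u) + norm0 lam D (wD D i (wD D i u))))) H10u.
- move=> a x y Hx Hy; apply: linear_comb_add; first exact: (sip_lin (grad_sip oD bD)).
  rewrite mulr_sumr -big_split/=; apply: eq_bigr => i _.
  exact: (sip_linr L2s a (H1_L2 Hx) (H1_L2 Hy) (L2w i)).
- move=> x Hx; rewrite /F -big_split/=; apply: le_trans (ler_norm_sum _ _ _) _; rewrite mulr_suml.
  apply: ler_sum => i _; apply: le_trans (ler_normD _ _) _; rewrite mulrDl; apply: lerD.
    have h := inner_le_norm0 (H1_wD_L2 i Hx) (H1_wD_L2 i H1u).
    exact: (le_mul_swap (norm0_ge0 _) (wD_le_H1_norm _ _ _) h).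
  have h := inner_le_norm0 (L2w i) (H1_L2 Hx); apply: (le_trans h).
  by apply: ler_wpM2l; [exact: norm0_ge0|exact: norm0_le_H1_norm].
- move=> phi tphi; rewrite /F -big_split/=; apply: big1 => i _.
  have [sp _] := tphi; rewrite (wD_smooth oD bD i sp (H1_wD_L2 i H1u)) innerC.
  by have [_ ->] := H1_wD i (H2_wD i H2u); rewrite ?addNr.
Qed.

(** In the formula |u|_1^2 = - (u, Laplacian u) the Poincare inequality bounds u by 2 M
    |u|_1, and each of the n second derivatives is bounded by |u|_2. *)
Lemma H1_semi_le_H2_semi M u : (0 < n)%N -> 0 <= M -> D `<=` box M -> H2 D u -> H10 D u ->
  H1_semi D u <= 2 * M * n%:R * H2_semi D u.
Proof.
move=> n0 M0 DM H2u H10u; have H1u := H10_H1 H10u.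
have [->|u0] := eqVneq (H1_semi D u) 0.
  by rewrite !mulr_ge0// H2_semi_ge0.
have up : 0 < H1_semi D u by rewrite lt0r u0 H1_semi_ge0.
rewrite -(ler_pM2r up) -expr2 sqr_H1_semi grad_ip_laplacian//.
rewrite (le_trans (ler_norm _))// normrN (le_trans (ler_norm_sum _ _ _))//.
have -> : 2 * M * n%:R * H2_semi D u * H1_semi D u =
    \sum_(i < n) (H2_semi D u * (2 * M * H1_semi D u)).
  rewrite sumr_const card_ord -mulr_natl; ring.
apply: ler_sum => i _; rewrite (le_trans (inner_le_norm0 _ (H1_L2 H1u)))//.
  by apply: H1_wD_L2; exact: H2_wD.
apply: ler_pM; rewrite ?norm0_ge0 ?wD2_le_H2_semi//.
apply: le_trans (poincare (Ordinal n0) M0 DM H10u) _.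
by rewrite ler_wpM2l ?mulr_ge0// wD_le_H1_semi.
Qed.

Lemma H1_norm_le_semi M u : (0 < n)%N -> 0 <= M -> D `<=` box M -> H10 D u ->
  H1_norm D u <= (2 * M + 1) * H1_semi D u.
Proof.
move=> n0 M0 DM Hu; have s0 : 0 <= H1_semi D u := H1_semi_ge0 u.
have h : norm0 lam D u <= 2 * M * H1_semi D u.
  apply: le_trans (poincare (Ordinal n0) M0 DM Hu) _.
  by rewrite ler_wpM2l ?mulr_ge0// wD_le_H1_semi.
rewrite -(@ler_pXn2r _ 2)// ?nnegrE ?H1_norm_ge0 ?mulr_ge0 ?addr_ge0 ?mulr_ge0//.
rewrite sqr_H1_norm.
have := norm0_ge0 u; move: h s0; move: (norm0 _ _ _) (H1_semi _ _) => a b h b0 a0.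
have : a ^+ 2 <= (2 * M * b) ^+ 2 by rewrite lerXn2r// nnegrE (le_trans a0 h).
by have := mulr_ge0 M0 (sqr_ge0 b); nra.
Qed.

End poincare_korn.

(** * Traces and the Green formula *)

Section surface.
Context (R : realType).

Lemma surf_finite m n (bd : seq (m.+1.-tuple 'rV[R]_n)) A : measurable A -> (surf bd A < +oo)%E.
Proof.
move=> mA; elim: bd => [|K bd IH]; first by rewrite /= /mzero ltry.
change (measure_add (facet_measure K) (surf bd) A < +oo)%E.
rewrite measure_addE lte_add_pinfty//.
rewrite /facet_measure /= /mscale/= lte_mul_pinfty//.
rewrite /pushforward /mrestr/=.
apply: (@le_lt_trans _ _ (leb R m (box 1))); last exact: leb_box.
apply: le_measure; rewrite ?inE.
- apply: measurableI; last exact: measurable_ref_simplex.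
  by rewrite -[X in measurable X]setTI; exact: measurable_facet_map.
- exact: measurable_box.
- move=> y [_ [y0 y1]] i; rewrite ger0_norm//; apply: le_trans y1.
  by rewrite (bigD1 i)//= lerDl sumr_ge0.
Qed.

Lemma measurable_bdry n (D : set 'rV[R]_n) : open D -> measurable (bdry D).
Proof.
move=> oD; apply: measurableD; last exact: open_measurable_rV.
rewrite -(setCK (closure D)); apply: measurableC; apply: open_measurable_rV.
by apply: closed_openC; exact: closed_closure.
Qed.

Lemma bounded_bdry n (D : set 'rV[R]_n) : bounded_set D -> bounded_set (bdry D).
Proof.
move=> [M [_ hM]]; exists (`|M| + 1); split; first exact: num_real.
move=> C MC x [xD _] /=.
have cB : closed (closed_ball_ (fun x : 'rV[R]_n => `|x|) 0 (`|M| + 1)) by exact: closed_closed_ball_.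
have DB : D `<=` closed_ball_ (fun x : 'rV[R]_n => `|x|) 0 (`|M| + 1).
  move=> y Dy; rewrite /closed_ball_/= sub0r normrN; apply: hM => //.
  by rewrite (le_lt_trans (ler_norm _))// ltrDl.
have E := (closure_id _).1 cB; have := closureS DB xD; rewrite -E.
by rewrite /closed_ball_/= sub0r normrN => /le_trans; apply; exact: ltW.
Qed.

Lemma measurable_plane (Gamma : set 'rV[R]_2) : open Gamma -> measurable (@plane R @` Gamma).
Proof.
move=> oG; pose p (y : 'rV[R]_3) : 'rV[R]_2 := \row_i y ord0 (lift ord_max i).
have mp : measurable_fun setT p.
  by apply: measurable_fun_rV => i; under eq_fun do rewrite mxE; exact: measurable_coord.
have -> : @plane R @` Gamma = (p @^-1` Gamma) `&` ((fun y : 'rV[R]_3 => y ord0 ord_max) @^-1` [set 0]).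
  apply/seteqP; split => y.
    move=> [x Gx <-]; split; last by rewrite /= /plane snoc_max.
    have e : p (plane x) = x by apply/rowP => i; rewrite mxE /plane snocK.
    by rewrite /preimage/= e.
  move=> [Gy /= y0]; exists (p y) => //; apply/rowP => i.
  by case: (unliftP ord_max i) => [k|] ->; rewrite /plane ?snocK ?snoc_max// mxE.
apply: measurableI.
  by rewrite -[X in measurable X]setTI; apply: mp => //; exact: open_measurable_rV.
by rewrite -[X in measurable X]setTI; apply: measurable_coord => //; exact: measurable_set1.
Qed.

End surface.

Section trace_theory.
Context (R : realType) (m : nat) (D : set 'rV[R]_m.+1) (bd : seq (m.+1.-tuple 'rV[R]_m.+1)).
Hypotheses (oD : open D) (bD : bounded_set D).
Let mD : measurable D := open_measurable_rV oD.
Let n := m.+1.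
Local Notation X := ('rV[R]_n -> R^o).
Local Notation Y := ('rV[R]_n -> 'M[R]_n).
Local Notation Z := ('rV[R]_n -> 'rV[R]_n).
Local Notation lam := (leb R n).
Local Notation mu := (surf bd).
Local Notation B := (bdry D).
Local Notation innB := (inner mu B : X -> X -> R).
Implicit Types (g h u v : 'rV[R]_n -> R) (E F : Z).

Let mB : measurable B := measurable_bdry oD.
Let L2Bs : semi_inner_product (L2 mu B : set X) innB := L2_sip mu mB.
Let H1s := H1_sip oD bD.

Lemma smooth_L2_bdry f : smooth f -> L2 mu B f.
Proof.
move=> /smooth_continuous; apply: continuous_L2 => //; first exact: bounded_bdry.
exact: surf_finite.
Qed.

Lemma norm0_bdryE u : norm0 mu B u = snorm innB u. Proof. by []. Qed.

Local Opaque inner wD norm0 H1_norm H1_semi.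

(** Combine the two approximating sequences; the same estimate serves for the norm of H1
    on the domain and for the norm of L2 on the boundary. *)
Lemma has_trace_lin (a : R) u v g h : H1 D u -> H1 D v -> has_trace D bd u g -> has_trace D bd v h ->
  has_trace D bd (fun x => a * u x + v x) (fun x => a * g x + h x).
Proof.
move=> Hu Hv [Lg [uk [suk cu ctu]]] [Lh [vk [svk cv ctv]]].
split; first exact: (sip_subspace L2Bs).2.
have comb (N : X -> R) (S : set X) (ip : X -> X -> R) (p q : nat -> X) (x y : X) :
    semi_inner_product S ip -> N = snorm ip -> (forall k, S (p k)) -> (forall k, S (q k)) -> S x -> S y ->
    (fun k => N (fun t => p k t - x t)) @ \oo --> (0 : R) ->
    (fun k => N (fun t => q k t - y t)) @ \oo --> (0 : R) ->
    (fun k => N (fun t => (a * p k t + q k t) - (a * x t + y t))) @ \oo --> (0 : R).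
  move=> sip -> Sp Sq Sx Sy cp cq.
  have sS := sip_subspace sip.
  have c0 : (fun k => `|a| * snorm ip (p k - x) + snorm ip (q k - y)) @ \oo --> (`|a| * 0 + 0 : R).
    by apply: cvgD => //; apply: cvgM; [exact: cvg_cst|exact: cp].
  rewrite mulr0 addr0 in c0.
  apply: (squeeze_cvgr _ (cvg_cst 0) c0); apply: nearW => k.
  have -> : (fun t => (a * p k t + q k t) - (a * x t + y t)) = a *: (p k - x) + (q k - y) :> X.
    apply/funext => t; rewrite -[RHS]/(a * (p k t - x t) + (q k t - y t)); ring.
  rewrite snorm_ge0 /=; have S1 : S (p k - x) by exact: subspace_sub.
  have S2 : S (q k - y) by exact: subspace_sub.
  rewrite -(snormZ sip a S1); apply: (snorm_triangle sip) => //; exact: subspace_scale.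
exists (fun k x => a * uk k x + vk k x); split.
- by move=> k; exact: smooth_lin.
- have eN : H1_norm D = snorm (H1_ip D : X -> X -> R) by apply/funext => w; exact: H1_normE.
  exact: (comb _ _ _ _ _ _ _ H1s eN (fun k => smooth_H1 oD bD (suk k))
    (fun k => smooth_H1 oD bD (svk k)) Hu Hv cu cv).
- have eN : norm0 mu B = snorm innB by apply/funext => w; exact: norm0_bdryE.
  exact: (comb _ _ _ _ _ _ _ L2Bs eN (fun k => smooth_L2_bdry (suk k))
    (fun k => smooth_L2_bdry (svk k)) Lg Lh ctu ctv).
Qed.

Lemma ae_norm0 f f' : L2 mu B f -> L2 mu B f' -> {ae mu, forall x, B x -> f' x = f x} ->
  inner mu B f' f' = inner mu B f f.
Proof.
move=> Lf Lf' e; have [mf' _] := Lf'.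
by rewrite (ae_inner mB Lf Lf' mf' e) innerC (ae_inner mB Lf Lf mf' e).
Qed.

Lemma has_trace_ae u g g' : has_trace D bd u g -> measurable_fun B g' ->
  {ae mu, forall x, B x -> g' x = g x} -> has_trace D bd u g'.
Proof.
move=> [Lg [uk [suk cu ctu]]] mg' gg'; have Lg' := ae_L2 mB Lg mg' gg'.
split=> //; exists uk; split=> //.
apply: cvg_trans ctu; apply: near_eq_cvg; apply: nearW => k.
have Lk := smooth_L2_bdry (suk k); have sS := sip_subspace L2Bs.
rewrite !norm0_bdryE /snorm; congr Num.sqrt; symmetry.
apply: ae_norm0.
- exact: (subspace_sub sS Lk Lg).
- exact: (subspace_sub sS Lk Lg').
- by apply: filterS gg' => x h Bx; rewrite h.
Qed.

Lemma row_lin (a : R) E F i :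
  (fun y => (a *: E + F) y ord0 i) = fun y => a * E y ord0 i + F y ord0 i.
Proof. by apply/funext => y; rewrite !mxE. Qed.

Lemma zero_comp i : (fun y => (0 : Z) y ord0 i) = fun=> 0.
Proof. by apply/funext => y; rewrite mxE. Qed.

Lemma lifting_lin (a : R) (v w E F : Z) : lifting D bd v E -> lifting D bd w F ->
  lifting D bd (a *: v + w) (a *: E + F).
Proof.
move=> [HE tE] [HF tF]; split=> i; rewrite row_lin.
  exact: ((sip_subspace H1s).2 a _ _ (HE i) (HF i)).
by rewrite row_lin; exact: (has_trace_lin a (HE i) (HF i) (tE i) (tF i)).
Qed.

(** With the gradient as a matrix field, the Green functional is a sum of two inner
    products of fields. *)
Definition gradm E : Y := fun x => \matrix_(i, j) wD D j (fun y => E y ord0 i) x.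

Lemma H1v_subspace : linear_subspace (H1v D : set Z).
Proof.
split=> [i|a E F HE HF i]; first by rewrite zero_comp; exact: (sip_subspace H1s).1.
by rewrite row_lin; exact: ((sip_subspace H1s).2 a _ _ (HE i) (HF i)).
Qed.

Lemma H1v_L2m E : H1v D E -> L2m lam D E.
Proof. by move=> HE; apply/L2m_row => i; exact: H1_L2 (HE i). Qed.

Lemma gradm_L2m E : H1v D E -> L2m lam D (gradm E).
Proof.
move=> HE i j; have := H1_wD_L2 j (HE i); congr (L2 lam D).
by apply/funext => x; rewrite mxE.
Qed.

Lemma greenE tau E : green D tau E = innerm lam D (wdiv D tau) E + innerm lam D tau (gradm E).
Proof.
congr (_ + _); do 2!(apply: eq_bigr => ? _).
by congr inner; apply/funext => x; rewrite mxE.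
Qed.

Lemma gradm_lin (a : R) E F (tau : Y) : H1v D E -> H1v D F -> L2m lam D tau ->
  innerm lam D (gradm (a *: E + F)) tau = a * innerm lam D (gradm E) tau + innerm lam D (gradm F) tau.
Proof.
move=> HE HF Lt; rewrite /innerm mulr_sumr -big_split/=; apply: eq_bigr => i _.
rewrite mulr_sumr -big_split/=; apply: eq_bigr => j _.
have e G : (fun x => gradm G x i j) = wD D j (fun y => G y ord0 i) by apply/funext => x; rewrite mxE.
rewrite !e row_lin; exact: (wD_lin oD bD j a (HE i) (HF i) (Lt i j)).
Qed.

Lemma green_linr (a : R) tau E F : Hdiv D tau -> H1v D E -> H1v D F ->
  green D tau (a *: E + F) = a * green D tau E + green D tau F.
Proof.
move=> Ht HE HF; rewrite !greenE.
have e1 := sip_linr (L2m_sip lam mD 1 n) a (H1v_L2m HE) (H1v_L2m HF) (wdiv_L2 Ht).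
have e2 := gradm_lin a HE HF (Hdiv_L2 Ht).
have sy E' : H1v D E' -> innerm lam D tau (gradm E') = innerm lam D (gradm E') tau.
  move=> HE'; exact: (sip_sym (L2m_sip lam mD n n) (Hdiv_L2 Ht) (gradm_L2m HE')).
rewrite (sy _ HE) (sy _ HF) (sy _ (H1v_subspace.2 a _ _ HE HF)).
exact: linear_comb_add e1 e2.
Qed.

Lemma green_linl (a : R) s t E : Hdiv D s -> Hdiv D t -> H1v D E ->
  green D (a *: s + t) E = a * green D s E + green D t E.
Proof.
move=> Hs Ht HE; rewrite !greenE.
have e1 := wdiv_lin oD bD a Hs Ht (H1v_L2m HE).
have e2 := sip_lin (L2m_sip lam mD n n) a (Hdiv_L2 Hs) (Hdiv_L2 Ht) (gradm_L2m HE).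
exact: linear_comb_add e1 e2.
Qed.

End trace_theory.

(** * The normal trace on a part of the boundary *)

Section normal_trace.
Context (R : realType) (m : nat) (D : set 'rV[R]_m.+1) (bd : seq (m.+1.-tuple 'rV[R]_m.+1)).
Context (S : set 'rV[R]_m.+1).
Hypotheses (oD : open D) (bD : bounded_set D) (mS : measurable S).
Let mD : measurable D := open_measurable_rV oD.
Let n := m.+1.
Local Notation Y := ('rV[R]_n -> 'M[R]_n).
Local Notation Z := ('rV[R]_n -> 'rV[R]_n).
Local Notation lam := (leb R n).
Local Notation mu := (surf bd).
Local Notation B := (bdry D).
Implicit Types (s t tau : Y) (v w z E F : Z).

Let mB : measurable B := measurable_bdry oD.

(** The fields whose normal trace vanishes off S; the stress space is the instance in
    which S is the interface. *)
Definition normal_trace_off (tau : Y) := Hdiv D tau /\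
  forall v, H00half D bd S v ->
    normal_pairing_is D bd tau (patch (fun=> 0) (~` S) v) 0.

Lemma norm0m_sqrt p q (F : 'rV[R]_n -> 'M[R]_(p, q)) :
  norm0m lam D F = Num.sqrt (innerm lam D F F).
Proof. by []. Qed.

Lemma norm0m_wdiv_le tau : norm0m lam D (wdiv D tau) <= Hdiv_norm D tau.
Proof.
rewrite Hdiv_normE; apply: ler_wsqrtr; rewrite /div_ip lerDr; exact: innerm_ge0.
Qed.

Lemma norm0m_le_Hdiv tau : norm0m lam D tau <= Hdiv_norm D tau.
Proof.
rewrite Hdiv_normE; apply: ler_wsqrtr; rewrite /div_ip lerDl; exact: innerm_ge0.
Qed.

Lemma Hdiv_norm_ge0 tau : 0 <= Hdiv_norm D tau. Proof. exact: sqrtr_ge0. Qed.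

Lemma norm0m_ge0 p q (F : 'rV[R]_n -> 'M[R]_(p, q)) : 0 <= norm0m lam D F.
Proof. exact: sqrtr_ge0. Qed.

Lemma norm0m_gradm_le E : norm0m lam D (gradm D E) <= H1v_norm D E.
Proof.
apply: ler_wsqrtr; apply: ler_sum => i _.
rewrite sqr_H1_norm sqr_H1_semi /grad_ip.
have -> : \sum_j inner lam D (fun x => gradm D E x i j) (fun x => gradm D E x i j) =
    \sum_j inner lam D (wD D j (fun y => E y ord0 i)) (wD D j (fun y => E y ord0 i)).
  by apply: eq_bigr => j _; congr inner; apply/funext => x; rewrite mxE.
by rewrite lerDr; exact: sqr_ge0.
Qed.

Local Opaque inner wD norm0 H1_norm H1_semi innerm norm0m wdiv Hdiv_norm H1v_norm green.

Lemma innerm_bound p q (F G : 'rV[R]_n -> 'M[R]_(p, q)) : L2m lam D F -> L2m lam D G ->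
  `|innerm lam D F G| <= norm0m lam D F * norm0m lam D G.
Proof.
by move=> LF LG; rewrite !norm0m_sqrt; exact: (cauchy_schwarz (L2m_sip lam mD p q) LF LG).
Qed.

Lemma green_bound tau E : Hdiv D tau -> H1v D E ->
  `|green D tau E| <= 2 * Hdiv_norm D tau * H1v_norm D E.
Proof.
move=> Ht HE; rewrite greenE.
have h1 := innerm_bound (wdiv_L2 Ht) (H1v_L2m HE).
have h2 := innerm_bound (Hdiv_L2 Ht) (gradm_L2m HE).
have k1 := ler_pM (norm0m_ge0 _) (norm0m_ge0 _) (norm0m_wdiv_le tau) (norm0m_le_H1v D E).
have k2 := ler_pM (norm0m_ge0 _) (norm0m_ge0 _) (norm0m_le_Hdiv tau) (norm0m_gradm_le E).
have l1 := le_trans h1 k1; have l2 := le_trans h2 k2.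
apply: le_trans (ler_normD _ _) _; apply: le_trans (lerD l1 l2) _.
by rewrite -mulrA mulr2n mulrDl mul1r.
Qed.

Lemma lifting_H1v v E : lifting D bd v E -> H1v D E. Proof. by case. Qed.

(** The zero function vanishes off S, so the condition on the normal trace applies to it
    and says that the Green functional vanishes on all its liftings. This is what makes
    the normal trace of such a field independent of the lifting. *)
Lemma normal_trace_kernel tau E : normal_trace_off tau -> lifting D bd (0 : Z) E ->
  green D tau E = 0.
Proof.
move=> [Ht h] l0.
have p0 : patch (fun=> 0) (~` S) (0 : Z) = 0.
  by apply/funext => x; rewrite /patch; case: ifP.
have H0 : H00half D bd S 0.
  split; last by rewrite p0; exists E.
  by exists 0; [exists E|apply: aeW].
by have := h _ H0; rewrite p0 => /(_ E l0).
Qed.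

Lemma green_lifting tau v E F : normal_trace_off tau -> lifting D bd v E -> lifting D bd v F ->
  green D tau E = green D tau F.
Proof.
move=> Pt lE lF; have [Ht _] := Pt.
have l0 : lifting D bd (0 : Z) (-1 *: F + E).
  have := lifting_lin oD bD (-1) lF lE.
  by rewrite scaleN1r addNr.
have := normal_trace_kernel Pt l0.
rewrite (green_linr oD bD (-1) Ht (lifting_H1v lF) (lifting_H1v lE)) mulN1r => h.
by apply/eqP; rewrite -subr_eq0 addrC h.
Qed.

Lemma normal_pairingE tau v E : normal_trace_off tau -> lifting D bd v E ->
  normal_pairing D bd tau v = green D tau E.
Proof.
move=> Pt lE; have P : normal_pairing_is D bd tau v (green D tau E).
  by move=> F lF; exact: (green_lifting Pt lF lE).
by symmetry; exact: (xgetPex 0 (ex_intro _ _ P) E lE).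
Qed.

(** Up to a null set, v is equal to its truncation to the complement of S; hence the
    lifting E of v is also a lifting of the truncation, on which the normal trace
    vanishes. *)
Lemma green_vanish tau v E : normal_trace_off tau -> lifting D bd v E ->
  {ae mu, forall x, S x -> v x = 0} -> green D tau E = 0.
Proof.
move=> Pt lE v0; have [Ht h] := Pt; have [HE tE] := lE.
have lp : lifting D bd (patch (fun=> 0) (~` S) v) E.
  split=> // i; apply: (has_trace_ae oD bD (tE i)).
    have -> : (fun x => patch (fun=> 0) (~` S) v x ord0 i) = (fun x => v x ord0 i) \_ (~` S).
      by apply/funext => x; rewrite /patch; case: ifP => _ //; rewrite mxE.
    have [[mv _] _] := tE i.
    apply: ((measurable_restrict _ (measurableC mS) mB).1 _).
    by apply: (measurable_funS mB _ mv) => x [].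
  apply: filterS v0 => x vx Bx; rewrite /patch; case: ifPn => //.
  by rewrite notin_setE /setC/= => /contrapT /vx ->.
apply: (h v _ E lp); split; last by exists E.
by exists v; [exists E|apply: aeW].
Qed.

(** Only the values on S matter: the difference of liftings of z and of the combination
    lifts a function that vanishes on S. *)
Lemma normal_pairing_linr (a : R) tau v w z : normal_trace_off tau ->
  Hhalf D bd v -> Hhalf D bd w -> Hhalf D bd z ->
  {ae mu, forall x, S x -> z x = a *: v x + w x} ->
  normal_pairing D bd tau z = a * normal_pairing D bd tau v + normal_pairing D bd tau w.
Proof.
move=> Pt [E lE] [F lF] [G lG] zvw; have [Ht _] := Pt.
rewrite (normal_pairingE Pt lE) (normal_pairingE Pt lF) (normal_pairingE Pt lG).
rewrite -(green_linr oD bD a Ht (lifting_H1v lE) (lifting_H1v lF)).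
have lEF := lifting_lin oD bD a lE lF.
have l0 := lifting_lin oD bD (-1) lEF lG.
have v0 : {ae mu, forall x, S x -> (-1 *: (a *: v + w) + z) x = 0}.
  apply: filterS zvw => x h Sx; have e := h Sx.
  rewrite -[LHS]/(-1 *: (a *: v x + w x) + z x) e scaleN1r; exact: addNr.
have := green_vanish Pt l0 v0.
rewrite (green_linr oD bD (-1) Ht (lifting_H1v lEF) (lifting_H1v lG)) mulN1r => h.
by apply/eqP; rewrite -subr_eq0 addrC h.
Qed.

Lemma normal_pairing_linl (a : R) s t v : normal_trace_off s -> normal_trace_off t ->
  normal_trace_off (a *: s + t) -> Hhalf D bd v ->
  normal_pairing D bd (a *: s + t) v = a * normal_pairing D bd s v + normal_pairing D bd t v.
Proof.
move=> Ps Pt Pst [E lE].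
rewrite (normal_pairingE Ps lE) (normal_pairingE Pt lE) (normal_pairingE Pst lE).
exact: (green_linl oD bD a Ps.1 Pt.1 (lifting_H1v lE)).
Qed.

(** The value is given by the Green formula at every lifting, and the norm of v is the
    infimum of the norms of the liftings. *)
Lemma normal_pairing_bound tau v : normal_trace_off tau -> Hhalf D bd v ->
  `|normal_pairing D bd tau v| <= 2 * Hdiv_norm D tau * Hhalf_norm D bd v.
Proof.
move=> Pt Hv; have [Ht _] := Pt; set p := normal_pairing D bd tau v.
have hb E : lifting D bd v E -> `|p| <= 2 * Hdiv_norm D tau * H1v_norm D E.
  by move=> lE; rewrite /p (normal_pairingE Pt lE); exact: (green_bound Ht (lifting_H1v lE)).
have ne : [set H1v_norm D E | E in lifting D bd v] !=set0.
  by case: Hv => E lE; exists (H1v_norm D E); exists E.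
have c0 : 0 <= 2 * Hdiv_norm D tau by apply: mulr_ge0; [|exact: Hdiv_norm_ge0].
move: c0; rewrite le_eqVlt => /orP[/eqP c0|c0].
  have [E lE] := Hv; have := hb E lE; rewrite -c0 mul0r => h.
  by rewrite mul0r.
rewrite mulrC -ler_pdivrMr//; apply: lb_le_inf => // _ [E lE <-].
by rewrite ler_pdivrMr// mulrC; exact: hb.
Qed.

End normal_trace.

(** * Isotropic material laws *)

Section isotropic_law.
Context (R : realType) (n p : nat) (D : set 'rV[R]_n) (mD : measurable D).
Local Notation lam := (leb R n).
Local Notation X := ('rV[R]_n -> R^o).
Local Notation Y := ('rV[R]_n -> 'M[R]_p).
Implicit Types F G : Y.
Let Ls := L2m_sip lam mD p p.
Let L2s := L2_sip lam mD.

(** The compliance tensor of the body and both laws of the plate are of this form. *)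
Definition isotropic (k1 k2 : R) (e : 'M[R]_p) : 'M[R]_p := k1 *: e + (k2 * \tr e)%:M.

Definition tr_ip F G : R := inner lam D (fun x => \tr (F x)) (fun x => \tr (G x)).

Definition isotropic_ip (k1 k2 : R) F G : R := k1 * innerm lam D F G + k2 * tr_ip F G.

Lemma L2_tr F : L2m lam D F -> L2 lam D (fun x => \tr (F x)).
Proof.
move=> LF; rewrite (_ : (fun x => _) = (\sum_i (fun x => F x i i)) :> X); last first.
  by apply/funext => x; rewrite /mxtrace fct_sumE.
by apply: (subspace_sum (sip_subspace L2s)) => i; exact: LF.
Qed.

Lemma tr_sip : semi_inner_product (@L2m R n lam D p p : set Y) tr_ip.
Proof.
apply: (@sip_pullback R Y X _ _ _ (fun F x => \tr (F x)) L2s).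
- exact: (sip_subspace Ls).
- by move=> F; exact: L2_tr.
- move=> a F G z LF LG Lz; rewrite -inner_lin//; try exact: L2_tr.
  apply: eq_inner => // x _.
  by rewrite -[(a *: F + G) x]/(a *: F x + G x) linearD linearZ.
Qed.

Lemma inner_isotropic k1 k2 F G : L2m lam D F -> L2m lam D G ->
  innerm lam D (fun x => isotropic k1 k2 (F x)) G = isotropic_ip k1 k2 F G.
Proof.
move=> LF LG; rewrite /isotropic_ip /innerm mulr_sumr.
have -> : tr_ip F G = \sum_i inner lam D (fun x => \tr (F x)) (fun x => G x i i).
  rewrite /tr_ip.
  have -> : (fun x => \tr (G x)) = (\sum_i (fun x => G x i i)) :> X.
    by apply/funext => x; rewrite /mxtrace fct_sumE.
  rewrite (linear_on_sum (sip_subspace L2s) (f := inner lam D (fun x => \tr (F x)) : X -> R))//.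
  by move=> a u v Lu Lv; apply: (sip_linr L2s) => //; exact: L2_tr.
rewrite mulr_sumr -big_split/=; apply: eq_bigr => i _.
rewrite mulr_sumr (bigD1 i)//= [in RHS](bigD1 i)//= [RHS]addrAC.
congr (_ + _).
  rewrite -(linear_onZ (sip_subspace L2s) (f := inner lam D ^~ (fun x => G x i i) : X -> R) _ k2); last 2 first.
  - by move=> a u v Lu Lv; apply: (sip_lin L2s) => //; exact: LG.
  - exact: L2_tr.
  rewrite -inner_lin//; last by apply: (subspace_scale (sip_subspace L2s)); exact: L2_tr.
  by apply: eq_inner => // x _; rewrite /isotropic !mxE eqxx mulr1n.
apply: eq_bigr => j ji; rewrite -(linear_onZ (sip_subspace L2s) (f := inner lam D ^~ (fun x => G x i j) : X -> R) _ k1); last 2 first.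
- by move=> a u v Lu Lv; apply: (sip_lin L2s) => //; exact: LG.
- exact: LF.
by apply: eq_inner => // x _; rewrite /isotropic !mxE eq_sym (negbTE ji) mulr0n addr0.
Qed.

Lemma isotropic_ip_linl k1 k2 a F G H : L2m lam D F -> L2m lam D G -> L2m lam D H ->
  isotropic_ip k1 k2 (a *: F + G) H = a * isotropic_ip k1 k2 F H + isotropic_ip k1 k2 G H.
Proof.
move=> LF LG LH; rewrite /isotropic_ip (sip_lin Ls a LF LG LH) (sip_lin tr_sip a LF LG LH); ring.
Qed.

Lemma isotropic_ipC k1 k2 F G : L2m lam D F -> L2m lam D G ->
  isotropic_ip k1 k2 F G = isotropic_ip k1 k2 G F.
Proof. by move=> LF LG; rewrite /isotropic_ip (sip_sym Ls LF LG) (sip_sym tr_sip LF LG). Qed.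

Lemma isotropic_sip k1 k2 : 0 <= k1 -> 0 <= k2 ->
  semi_inner_product (@L2m R n lam D p p : set Y) (isotropic_ip k1 k2).
Proof.
move=> k10 k20; split; first exact: (sip_subspace Ls).
- by move=> *; exact: isotropic_ip_linl.
- by move=> *; exact: isotropic_ipC.
- by move=> F LF; rewrite addr_ge0// mulr_ge0// ?(sip_ge0 Ls)// (sip_ge0 tr_sip).
Qed.

Lemma isotropic_ip_ge k1 k2 F : 0 <= k2 -> L2m lam D F ->
  k1 * innerm lam D F F <= isotropic_ip k1 k2 F F.
Proof. by move=> k20 LF; rewrite lerDl mulr_ge0// (sip_ge0 tr_sip). Qed.

Lemma entry_le_norm0m q r (F : 'rV[R]_n -> 'M[R]_(q, r)) i j :
  norm0 lam D (fun x => F x i j) <= norm0m lam D F.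
Proof.
apply: ler_wsqrtr; rewrite /innerm.
apply: le_trans (ler_sum_term (F := fun i => \sum_j inner lam D (fun x => F x i j) (fun x => F x i j)) i _).
  by apply: (ler_sum_term (F := fun j => inner lam D (fun x => F x i j) (fun x => F x i j))) => l; exact: inner_ge0.
by move=> k; apply: sumr_ge0 => l _; exact: inner_ge0.
Qed.

Lemma norm0_tr_le F : L2m lam D F -> norm0 lam D (fun x => \tr (F x)) <= p%:R * norm0m lam D F.
Proof.
move=> LF; have -> : (fun x => \tr (F x)) = (\sum_i (fun x => F x i i)) :> X.
  by apply/funext => x; rewrite /mxtrace fct_sumE.
have -> : p%:R * norm0m lam D F = \sum_(i < p) norm0m lam D F.
  by rewrite sumr_const card_ord mulr_natl.
suff H (r : seq 'I_p) : norm0 lam D (\sum_(i <- r) (fun x => F x i i) : X) <= \sum_(i <- r) norm0m lam D F.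
  exact: H.
have Li i : L2 lam D (fun x => F x i i) by exact: LF.
elim: r => [|i r IH].
  rewrite !big_nil /norm0 (linear_on0 (sip_subspace L2s) (f := inner lam D ^~ (0 : X) : X -> R)) ?sqrtr0//.
  by move=> a u v Lu Lv; apply: (sip_lin L2s) => //; exact: (sip_subspace L2s).1.
rewrite !big_cons; apply: le_trans (snorm_triangle L2s (Li i) _) _.
  by apply: (subspace_sum (sip_subspace L2s)).
by apply: lerD => //; exact: entry_le_norm0m.
Qed.

Lemma isotropic_ip_bound k1 k2 F G : L2m lam D F -> L2m lam D G ->
  `|isotropic_ip k1 k2 F G| <= (`|k1| + `|k2| * p%:R ^+ 2) * norm0m lam D F * norm0m lam D G.
Proof.
move=> LF LG; apply: le_trans (ler_normD _ _) _; rewrite !normrM -mulrA mulrDl; apply: lerD.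
  by apply: ler_wpM2l => //; exact: (cauchy_schwarz Ls).
rewrite -mulrA; apply: ler_wpM2l => //.
apply: le_trans (cauchy_schwarz tr_sip LF LG) _.
have h1 := norm0_tr_le LF; have h2 := norm0_tr_le LG.
have := ler_pM (sqrtr_ge0 _) (sqrtr_ge0 _) h1 h2; move/le_trans; apply.
by rewrite le_eqVlt; apply/orP; left; apply/eqP; ring.
Qed.

End isotropic_law.

Section compliance.
Context (R : realType) (E nu : R).
Hypotheses (E0 : 0 < E) (nu0 : 0 < nu < 1 / 2).

(** The law multiplies the trace by E / (1 - 2 nu), which is not zero; hence the trace
    of the preimage, and then the preimage, are determined by s. *)
Lemma C0inv_sym (s : 'M[R]_3) : s^T = s ->
  C0inv E nu s = isotropic ((1 + nu) / E) (- nu / E) s.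
Proof.
move=> ss; have /andP[n0 n1] := nu0.
have En : E != 0 by rewrite lt0r_neq0.
have d1 : 1 + nu != 0 by rewrite lt0r_neq0// addr_gt0.
have d2 : 1 - 2 * nu != 0 by rewrite lt0r_neq0//; lra.
have trI (c : R) : \tr (c%:M : 'M[R]_3) = 3 * c by rewrite mxtrace_scalar mulr_natl.
have trC0 e : \tr (C0 E nu e) = E / (1 - 2 * nu) * \tr e.
  rewrite /C0 linearD linearZ/= trI; by field; rewrite d1 d2.
have : (isotropic ((1 + nu) / E) (- nu / E) s)^T = isotropic ((1 + nu) / E) (- nu / E) s /\
    C0 E nu (isotropic ((1 + nu) / E) (- nu / E) s) = s.
  split; first by rewrite /isotropic linearD linearZ/= ss tr_scalar_mx.
  have tr_e : \tr (isotropic ((1 + nu) / E) (- nu / E) s) = (1 - 2 * nu) / E * \tr s.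
    by rewrite /isotropic linearD linearZ/= trI; field.
  rewrite /C0 tr_e /isotropic scalerDr scalerA scale_scalar_mx -addrA -raddfD/=.
  have -> : E / (1 + nu) * ((1 + nu) / E) = 1 by field; rewrite En d1.
  rewrite scale1r -[RHS]addr0; congr (_ + _).
  rewrite (_ : _ + _ = 0) ?raddf0//; by field; rewrite En d1 d2.
move=> h; have [_ he] := xgetPex (0 : 'M[R]_3) (ex_intro (fun e => e^T = e /\ C0 E nu e = s) _ h).
rewrite -/(C0inv E nu s) in he; move: (C0inv E nu s) he => e he.
have tre : \tr s = E / (1 - 2 * nu) * \tr e by rewrite -he trC0.
rewrite /isotropic tre -[in RHS]he /C0 scalerDr scalerA scale_scalar_mx -addrA -raddfD/=.
have -> : (1 + nu) / E * (E / (1 + nu)) = 1 by field; rewrite En d1.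
rewrite scale1r -[LHS]addr0; congr (_ + _).
rewrite (_ : _ + _ = 0) ?raddf0//; by field; rewrite En d1 d2.
Qed.

Lemma complianceE (D : set 'rV[R]_3) (s t : 'rV[R]_3 -> 'M[R]_3) : open D -> Hdiv D s -> Hdiv D t ->
  compliance E nu D s t = isotropic_ip D ((1 + nu) / E) (- nu / E) s t.
Proof.
move=> oD Hs Ht; have mD := open_measurable_rV oD.
rewrite -(inner_isotropic mD)//; try exact: Hdiv_L2.
apply: eq_bigr => i _; apply: eq_bigr => j _; apply: eq_inner => // x.
by rewrite inE => Dx; case: Hs => _ h _; rewrite C0inv_sym// h.
Qed.

End compliance.

(** * Finite-dimensional saddle point problems *)

Section galerkin.
Context (R : realType) (U : lmodType R) (S null : set U) (Phi : U -> U -> R) (L : U -> R).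
Hypotheses (sS : linear_subspace S)
  (Phil : forall a x y z, S x -> S y -> S z -> Phi (a *: x + y) z = a * Phi x z + Phi y z)
  (Phir : forall a x y z, S x -> S y -> S z -> Phi z (a *: x + y) = a * Phi z x + Phi z y)
  (Ll : forall a x y, S x -> S y -> L (a *: x + y) = a * L x + L y)
  (Phi_null : forall x y, S x -> S y -> null y -> Phi x y = 0)
  (L_null : forall y, S y -> null y -> L y = 0)
  (Phi_inj : forall x, S x -> (forall y, S y -> Phi x y = 0) -> null x).
Context (N : nat) (e : 'I_N -> U).
Hypotheses (Se : forall k, S (e k))
  (spanned : forall x, S x -> exists c : 'I_N -> R, null (x - \sum_k c k *: e k)).

Let comb (c : 'I_N -> R) := \sum_k c k *: e k.

Let Scomb c : S (comb c).
Proof. by apply: subspace_sum => // k; exact: subspace_scale. Qed.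

Let linear_comb (f : U -> R) c :
  (forall a x y, S x -> S y -> f (a *: x + y) = a * f x + f y) ->
  f (comb c) = \sum_k c k * f (e k).
Proof.
move=> fl; rewrite (linear_on_sum sS fl); last by move=> k; exact: subspace_scale.
by apply: eq_bigr => k _; rewrite (linear_onZ sS fl).
Qed.

Let linear_spanned (f : U -> R) y :
  (forall a x y, S x -> S y -> f (a *: x + y) = a * f x + f y) ->
  (forall y, S y -> null y -> f y = 0) -> S y ->
  exists c, f y = \sum_k c k * f (e k).
Proof.
move=> fl fn Sy; have [c yc] := spanned Sy; exists c.
rewrite -linear_comb//; apply/eqP; rewrite -subr_eq0 -(linear_onB fl)//; apply/eqP.
by apply: fn => //; exact: subspace_sub.
Qed.

(** The matrix of Phi is square, so its left and right kernels have the same dimension;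
    both consist of the coefficients of null vectors, on which L vanishes. So L is in
    the row space of the matrix. *)
Lemma galerkin_solvable : exists2 x, S x & forall y, S y -> Phi x y = L y.
Proof.
pose B : 'M[R]_N := \matrix_(k, l) Phi (e k) (e l).
pose l : 'rV[R]_N := \row_k L (e k).
have mulB (c : 'rV[R]_N) j : (c *m B) ord0 j = Phi (comb (c ord0)) (e j).
  rewrite (linear_comb (f := Phi^~ (e j))); last by move=> *; exact: Phil.
  by rewrite mxE; apply: eq_bigr => k _; rewrite mxE.
have ker (c : 'rV[R]_N) : c *m B = 0 -> B *m c^T = 0 /\ l *m c^T = 0.
  move=> c0; have cn : null (comb (c ord0)).
    apply: Phi_inj => // y Sy.
    have [d ->] := linear_spanned (f := Phi (comb (c ord0)))
      (fun a x y Sx Sy => Phir a Sx Sy (Scomb _)) (fun y Sy => Phi_null (Scomb _) Sy) Sy.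
    by rewrite big1// => k _; rewrite -mulB c0 mxE mulr0.
  split; apply/matrixP => i j.
    rewrite mxE (eq_bigr (fun k => c ord0 k * Phi (e i) (e k))); last first.
      by move=> k _; rewrite !mxE ord1 mulrC.
    rewrite -(linear_comb (f := Phi (e i))) ?Phi_null ?mxE//.
    by move=> *; exact: Phir.
  rewrite mxE (eq_bigr (fun k => c ord0 k * L (e k))); last first.
    by move=> k _; rewrite !mxE !ord1 mulrC.
  by rewrite -(linear_comb (f := L))// L_null ?mxE.
have kerM n (P : 'M[R]_(n, N)) : P *m B = 0 -> B *m P^T = 0 /\ l *m P^T = 0.
  move=> P0; have rP j : row j P *m B = 0 by rewrite -row_mul P0 row0.
  split; apply/matrixP => i j; have [h h'] := ker _ (rP j).
    have := congr1 (fun M : 'cV[R]_N => M i ord0) h; rewrite !mxE => h0; apply: etrans h0.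
    by apply: eq_bigr => k _; rewrite !mxE.
  have := congr1 (fun M : 'M[R]_1 => M i ord0) h'; rewrite !mxE => h0; apply: etrans h0.
  by apply: eq_bigr => k _; rewrite !mxE.
have kerBT : (kermx B^T <= kermx B)%MS.
  have sub : (kermx B <= kermx B^T)%MS.
    apply/sub_kermxP; apply: trmx_inj; rewrite trmx_mul trmxK trmx0.
    by have [] := kerM _ _ (mulmx_ker B).
  have := mxrank_leqif_sup sub; rewrite !mxrank_ker mxrank_tr => /leqifP.
  by case: ifP => // _; rewrite ltnn.
have : (l <= B)%MS.
  rewrite submxE; apply/eqP; apply: trmx_inj; rewrite trmx0.
  have cB : (cokermx B)^T *m B^T = 0 by rewrite -trmx_mul mulmx_coker trmx0.
  have : ((cokermx B)^T <= kermx B)%MS by apply: submx_trans kerBT; apply/sub_kermxP.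
  by move=> /sub_kermxP/kerM[_]; rewrite trmxK => ->; rewrite trmx0.
case/submxP => c lc; exists (comb (c ord0)) => // y Sy.
apply/eqP; rewrite -subr_eq0; apply/eqP.
have [|y0 Sy0 n0|d ->] := linear_spanned (f := fun y => Phi (comb (c ord0)) y - L y) _ _ Sy.
- by move=> a x z Sx Sz; rewrite Phir// Ll//; ring.
- by rewrite Phi_null// L_null// subrr.
rewrite big1// => k _; rewrite -mulB -lc mxE subrr mulr0.
by [].
Qed.

End galerkin.

Section spans.
Context (R : realType).

(** T is finite-dimensional up to null vectors. *)
Definition spans (W : lmodType R) (T null : set W) := exists N (e : 'I_N -> W),
  (forall k, T (e k)) /\ forall x, T x -> exists c : 'I_N -> R, null (x - \sum_k c k *: e k).

Lemma spans_mono (W : lmodType R) (T null null' : set W) : linear_subspace T ->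
  (forall x, T x -> null x -> null' x) -> spans T null -> spans T null'.
Proof.
move=> sT h [N [e [Te sp]]]; exists N, e; split=> // x Tx; have [c nc] := sp x Tx.
exists c; apply: h nc; apply: (subspace_sub sT Tx).
by apply: (subspace_sum sT) => k; exact: subspace_scale.
Qed.

Lemma spans_prod (X Q : lmodType R) (S null : set X) (V null' : set Q) : S 0 -> V 0 ->
  spans S null -> spans V null' ->
  spans ([set u | S u.1 /\ V u.2] : set (X * Q)%type) [set u | null u.1 /\ null' u.2].
Proof.
move=> S0 V0 [N [e [Se spe]]] [K [d [Sd spd]]]; pose U : lmodType R := (X * Q)%type.
pose ed (k : 'I_(N + K)%N) : U := match fintype.split k with inl i => (e i, 0) | inr j => (0, d j) end.
exists (N + K)%N, ed; split=> [k|u [Su Vu]].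
  rewrite /ed; case: (fintype.split k) => i; split; [exact: Se|exact: V0|exact: S0|exact: Sd].
have [c hc] := spe _ Su; have [c' hc'] := spd _ Vu.
exists (fun k => match fintype.split k with inl i => c i | inr j => c' j end).
have -> : \sum_k (match fintype.split k with inl i => c i | inr j => c' j end) *: ed k =
    (\sum_i c i *: e i, \sum_j c' j *: d j) :> U.
  rewrite big_split_ord/=.
  have E1 : \sum_(i < N) (match fintype.split (lshift K i) with inl i => c i | inr j => c' j end) *: ed (lshift K i)
      = (\sum_i c i *: e i, 0) :> U.
    rewrite (eq_bigr (fun i => (c i *: e i, 0 : Q) : U)).
      by elim/big_rec2 : _ => // i p q _ ->; congr pair; rewrite addr0.
    move=> i _; rewrite /ed; have -> : fintype.split (lshift K i) = inl i by exact: (unsplitK (inl i)).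
    by congr pair; rewrite scaler0.
  have E2 : \sum_(j < K) (match fintype.split (rshift N j) with inl i => c i | inr j => c' j end) *: ed (rshift N j)
      = (0, \sum_j c' j *: d j) :> U.
    rewrite (eq_bigr (fun j => (0 : X, c' j *: d j) : U)).
      by elim/big_rec2 : _ => // i p q _ ->; congr pair; rewrite addr0.
    move=> i _; rewrite /ed; have -> : fintype.split (rshift N i) = inr i by exact: (unsplitK (inr i)).
    by congr pair; rewrite scaler0.
  by rewrite E1 E2; congr pair; rewrite ?addr0 ?add0r.
by split.
Qed.

Lemma spans_image (W U : lmodType R) (phi : U -> W) (T null : set U) (T' null' : set W) :
  (forall (a : R) u v, phi (a *: u + v) = a *: phi u + phi v) ->
  (forall u, T u -> T' (phi u)) -> (forall x, T' x -> exists2 u, T u & x = phi u) ->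
  (forall u, null u -> null' (phi u)) -> spans T null -> spans T' null'.
Proof.
move=> phil TT' T'T nn [N [e [Te sp]]]; exists N, (phi \o e); split=> [k|x T'x]; first exact: TT'.
have phi0 : phi 0 = 0.
  by have := phil (-1) 0 0; rewrite scaler0 addr0 scaleN1r addNr.
have phiB u v : phi (u - v) = phi u - phi v by rewrite addrC -scaleN1r phil scaleN1r addrC.
have [u Tu ->] := T'T x T'x; have [c nc] := sp u Tu; exists c.
have -> : \sum_k c k *: (phi \o e) k = phi (\sum_k c k *: e k).
  elim/big_rec2 : _ => [|k y1 y2 _ ->]; first by rewrite phi0.
  by rewrite phil.
by rewrite -phiB; exact: nn.
Qed.

End spans.

Section brezzi.
Context (R : realType) (X Q : lmodType R) (S : set X) (V : set Q).
Context (ipX : X -> X -> R) (ipQ : Q -> Q -> R).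
Hypotheses (sX : semi_inner_product S ipX) (sQ : semi_inner_product V ipQ).
Let nX := snorm ipX.
Let nQ := snorm ipQ.
Let sS := sip_subspace sX.
Let sV := sip_subspace sQ.

Hypotheses (finX : spans S [set x | nX x = 0]) (finQ : spans V [set q | nQ q = 0]).
Context (b : Q -> X -> R) (M beta : R).
Hypotheses (beta0 : 0 < beta)
  (bl : forall a p q x, V p -> V q -> S x -> b (a *: p + q) x = a * b p x + b q x)
  (br : forall a x y q, S x -> S y -> V q -> b q (a *: x + y) = a * b q x + b q y)
  (bM : forall q x, V q -> S x -> `|b q x| <= M * nQ q * nX x)
  (infsup : forall q, V q -> nQ q != 0 ->
    exists2 x, S x & 0 < nX x /\ beta * nQ q * nX x <= b q x).

Record bounded_form (A : X -> X -> R) (K : R) : Prop := {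
  form_linl : forall a x y z, S x -> S y -> S z -> A (a *: x + y) z = a * A x z + A y z;
  form_linr : forall a x y z, S x -> S y -> S z -> A z (a *: x + y) = a * A z x + A z y;
  form_bound : forall x y, S x -> S y -> `|A x y| <= K * nX x * nX y }.

Record bounded_functional (W : lmodType R) (T : set W) (n : W -> R) (F : W -> R) (f : R) : Prop := {
  functional_lin : forall a x y, T x -> T y -> F (a *: x + y) = a * F x + F y;
  functional_bound : forall x, T x -> `|F x| <= f * n x }.

(** The inf-sup condition: q is controlled by the functional b q. *)
Lemma infsup_bound q f : V q -> 0 <= f -> (forall x, S x -> `|b q x| <= f * nX x) ->
  beta * nQ q <= f.
Proof.
move=> Vq f0 h; have [->|q0] := eqVneq (nQ q) 0; first by rewrite mulr0.
have [x Sx [x0 bx]] := infsup Vq q0.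
rewrite -(ler_pM2r x0); apply: le_trans bx _; exact: le_trans (ler_norm _) (h x Sx).
Qed.

Lemma null_form (A : X -> X -> R) K x y : bounded_form A K -> S x -> S y ->
  nX x = 0 \/ nX y = 0 -> A x y = 0.
Proof.
move=> bA Sx Sy h; apply/eqP; rewrite -normr_le0 (le_trans (form_bound bA Sx Sy))//.
by case: h => ->; rewrite ?mulr0 ?mul0r.
Qed.

(** The saddle point problem is one equation for the pair (x, q). If the data vanish,
    testing with x and q gives A x x = 0 with x in the kernel of b, so x is null; then b
    q = 0 and the inf-sup condition makes q null. *)
Lemma saddle_solvable (A : X -> X -> R) K0 F G f g : bounded_form A K0 ->
  (forall x, S x -> (forall q, V q -> b q x = 0) -> A x x <= 0 -> nX x = 0) ->
  bounded_functional S nX F f -> bounded_functional V nQ G g ->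
  exists x q, [/\ S x, V q, forall y, S y -> A x y + b q y = F y &
    forall r, V r -> b r x = G r].
Proof.
move=> bA def bF bG.
pose U : lmodType R := (X * Q)%type.
pose T : set U := [set u | S u.1 /\ V u.2].
pose null : set U := [set u | nX u.1 = 0 /\ nQ u.2 = 0].
pose Phi (u v : U) := A u.1 v.1 + b u.2 v.1 + b v.2 u.1.
pose L (u : U) := F u.1 + G u.2.
have sT : linear_subspace T.
  split; first by split; [exact: sS.1|exact: sV.1].
  by move=> a u v [Su Vu] [Sv Vv]; split; [exact: sS.2|exact: sV.2].
have b0l q x : V q -> S x -> nX x = 0 -> b q x = 0.
  by move=> Vq Sx x0; apply/eqP; rewrite -normr_le0 (le_trans (bM Vq Sx))// x0 mulr0.
have b0r q x : V q -> S x -> nQ q = 0 -> b q x = 0.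
  by move=> Vq Sx x0; apply/eqP; rewrite -normr_le0 (le_trans (bM Vq Sx))// x0 mulr0 mul0r.
have [N [ed [Ted sped]]] := spans_prod sS.1 sV.1 finX finQ.
have [//||||||[x q] [Sx Vq] h] := @galerkin_solvable R U T null Phi L sT _ _ _ _ _ _ N ed Ted sped.
- move=> a u v w [Su Vu] [Sv Vv] [Sw Vw]; rewrite /Phi /= (form_linl bA)// bl// br//; ring.
- move=> a u v w [Su Vu] [Sv Vv] [Sw Vw]; rewrite /Phi /= (form_linr bA)// bl// br//; ring.
- move=> a u v [Su Vu] [Sv Vv]; rewrite /L /= (functional_lin bF)// (functional_lin bG)//; ring.
- move=> u v [Su Vu] [Sv Vv] [nx nq]; rewrite /Phi (null_form bA Su Sv (or_intror nx)).
  by rewrite b0l// b0r// !addr0.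
- move=> v [Sv Vv] [nx nq]; apply/eqP; rewrite -normr_le0 (le_trans (ler_normD _ _))//.
  rewrite (le_trans (lerD (functional_bound bF Sv) (functional_bound bG Vv)))//.
  by rewrite nx nq !mulr0 addr0.
- move=> [x q] [/= Sx Vq] h.
  have hq r : V r -> b r x = 0.
    move=> Vr; have := h (0, r) (conj sS.1 Vr); rewrite /Phi/=.
    rewrite (linear_on0 sS (f := A x)); last by move=> *; exact: (form_linr bA).
    rewrite (linear_on0 sS (f := b q)) ?add0r//; by move=> *; exact: br.
  have hx y : S y -> A x y + b q y = 0.
    move=> Sy; have := h (y, 0) (conj Sy sV.1); rewrite /Phi/=.
    rewrite (linear_on0 sV (f := b^~ x)) ?addr0//; by move=> *; exact: bl.
  have x0 : nX x = 0.
    by apply: def => //; have := hx x Sx; rewrite hq// addr0 => ->.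
  split => //=; apply/eqP; rewrite eq_le snorm_ge0 andbT.
  rewrite -(pmulr_rle0 _ beta0); apply: infsup_bound => // y Sy.
  have := hx y Sy; rewrite (null_form bA Sx Sy (or_introl x0)) add0r => ->.
  by rewrite normr0 mul0r.
exists x, q; split => // [y Sy|r Vr].
  have := h (y, 0) (conj Sy sV.1); rewrite /Phi /L/=.
  rewrite (linear_on0 sV (f := b^~ x)) ?addr0; last by move=> *; exact: bl.
  by rewrite (linear_on0 sV (f := G)) ?addr0//; exact: functional_lin bG.
have := h (0, r) (conj sS.1 Vr); rewrite /Phi /L/=.
rewrite (linear_on0 sS (f := A x)); last by move=> *; exact: (form_linr bA).
rewrite (linear_on0 sS (f := b q)) ?add0r; last by move=> *; exact: br.
by rewrite (linear_on0 sS (f := F)) ?add0r//; exact: functional_lin bF.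
Qed.

Lemma sip_bounded_form : bounded_form ipX 1.
Proof.
split=> [a x y z Sx Sy Sz|a x y z Sx Sy Sz|x y Sx Sy].
- exact: (sip_lin sX).
- exact: (sip_linr sX).
- by rewrite mul1r; exact: (cauchy_schwarz sX).
Qed.

(** The solution of minimal norm is the first component of a saddle point of the inner
    product itself: nX x ^+ 2 = - b q x = - G q <= g * nQ q, and beta * nQ q <= nX x. *)
Lemma bounded_right_inverse G g : 0 <= g -> bounded_functional V nQ G g ->
  exists2 x, S x & (forall r, V r -> b r x = G r) /\ nX x <= g / beta.
Proof.
move=> g0 bG; have x2 x : S x -> nX x ^+ 2 = ipX x x by move=> Sx; exact: (sqr_snorm sX).
have def x : S x -> (forall q, V q -> b q x = 0) -> ipX x x <= 0 -> nX x = 0.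
  move=> Sx _; rewrite -x2// => x0; apply/eqP; rewrite -sqrf_eq0 eq_le x0.
  exact: sqr_ge0.
have bF : bounded_functional S nX (fun=> 0) 0.
  by split=> [a x y _ _|x _]; rewrite ?mulr0 ?addr0// normr0 mul0r.
have [x [q [Sx Vq xF xG]]] := saddle_solvable sip_bounded_form def bF bG.
exists x => //; split=> //; have X0 : 0 <= nX x := snorm_ge0 _ _.
have hq : beta * nQ q <= nX x.
  apply: infsup_bound => // y Sy; have /eqP := xF y Sy; rewrite addrC addr_eq0 => /eqP ->.
  by rewrite normrN; exact: (cauchy_schwarz sX).
have hx : nX x ^+ 2 <= g * nQ q.
  have /eqP := xF x Sx; rewrite xG// addr_eq0 -x2// => /eqP ->.
  by apply: le_trans (functional_bound bG Vq); rewrite -normrN; exact: ler_norm.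
rewrite ler_pdivlMr//; move: X0; rewrite le_eqVlt => /orP[/eqP <-|X0]; first by rewrite mul0r.
rewrite -(ler_pM2l X0) mulrA -expr2; apply: (le_trans (ler_wpM2r (ltW beta0) hx)).
have -> : g * nQ q * beta = beta * nQ q * g by ring.
exact: ler_wpM2r.
Qed.

(** The constant c bounds x, and the second term bounds q through the inf-sup condition. *)
Definition brezzi_cst K alpha := let c := beta^-1 + (1 + K / beta) / alpha in
  c + (1 + K * c) / beta.

(** Write x = y + x0, where x0 solves the constraint with a bound and y is in the kernel
    of b. Coercivity bounds y, and then the first equation and the inf-sup condition
    bound q. The same bound for the difference of two solutions, whose data vanish,
    gives uniqueness. *)
Theorem brezzi (A : X -> X -> R) K alpha F G f g : 0 <= K -> 0 < alpha ->
  bounded_form A K ->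
  (forall x, S x -> (forall q, V q -> b q x = 0) -> alpha * nX x ^+ 2 <= A x x) ->
  0 <= f -> 0 <= g -> bounded_functional S nX F f -> bounded_functional V nQ G g ->
  let solution x q := [/\ S x, V q, forall y, S y -> A x y + b q y = F y &
    forall r, V r -> b r x = G r] in
  exists x q, [/\ solution x q, forall x' q', solution x' q' -> nX (x' - x) = 0 /\ nQ (q' - q) = 0 &
    nX x + nQ q <= brezzi_cst K alpha * (f + g)].
Proof.
move=> K0 alpha0 bA coer f0 g0 bF bG solution.
have def x : S x -> (forall q, V q -> b q x = 0) -> A x x <= 0 -> nX x = 0.
  move=> Sx hx Ax; apply/eqP; rewrite -sqrf_eq0 eq_le sqr_ge0 andbT.
  by rewrite -(pmulr_rle0 _ alpha0); exact: le_trans (coer x Sx hx) Ax.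
have bound F' G' f' g' x q : 0 <= f' -> 0 <= g' -> bounded_functional S nX F' f' ->
    bounded_functional V nQ G' g' -> S x -> V q ->
    (forall y, S y -> A x y + b q y = F' y) -> (forall r, V r -> b r x = G' r) ->
    nX x + nQ q <= brezzi_cst K alpha * (f' + g').
  move=> {}f0 {}g0 {}bF {}bG Sx Vq xF xG.
  (* x0 has the constraint data, so y is in the kernel of b *)
  have [x0 Sx0 [x0G x0g]] := bounded_right_inverse g0 bG.
  pose y := x - x0; have Sy : S y := subspace_sub sS Sx Sx0.
  have yk r : V r -> b r y = 0.
    move=> Vr; rewrite (linear_onB (S := S) (f := b r))//; last by move=> *; exact: br.
    by rewrite xG// x0G// subrr.
  have Ay : A y y = F' y - A x0 y.
    rewrite -xF// yk// addr0 -(linear_onB (S := S) (f := A^~ y))// => a u v Su Sv.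
    exact: (form_linl bA).
  have Y0 : 0 <= nX y := snorm_ge0 _ _.
  have hy : alpha * nX y <= f' + K * (g' / beta).
    have h1 := coer y Sy yk; rewrite Ay in h1.
    have h2 := functional_bound bF Sy; have h3 := form_bound bA Sx0 Sy.
    have h4 : K * nX x0 * nX y <= K * (g' / beta) * nX y.
      by rewrite ler_wpM2r// ler_wpM2l.
    have h5 : alpha * nX y ^+ 2 <= (f' + K * (g' / beta)) * nX y.
      rewrite mulrDl (le_trans h1)// (le_trans (ler_norm _))// (le_trans (ler_normB _ _))//.
      by rewrite lerD// (le_trans h3).
    move: Y0; rewrite le_eqVlt => /orP[/eqP <-|Y0].
      by rewrite mulr0 addr_ge0// mulr_ge0// divr_ge0// ltW.
    by rewrite -(ler_pM2r Y0) -mulrA -expr2.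
  pose c := beta^-1 + (1 + K / beta) / alpha.
  have b0 : 0 <= beta^-1 by rewrite invr_ge0 ltW.
  have c0 : 0 <= c.
    by apply: addr_ge0 b0 (divr_ge0 (addr_ge0 ler01 (divr_ge0 K0 (ltW beta0))) (ltW alpha0)).
  have hx : nX x <= c * (f' + g').
    have -> : x = y + x0 by rewrite subrK.
    apply: le_trans (snorm_triangle sX Sy Sx0) _.
    have hy' : nX y <= (f' + K * (g' / beta)) / alpha by rewrite ler_pdivlMr// mulrC.
    apply: le_trans (lerD hy' x0g) _.
    have -> : c * (f' + g') = (f' + K * (g' / beta)) / alpha + g' / beta +
       (f' / beta + g' / alpha + K / beta * f' / alpha).
      by rewrite /c; field; rewrite !lt0r_neq0.
    by rewrite lerDl !addr_ge0// ?mulr_ge0// invr_ge0 ltW.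
  have hq : nQ q <= (1 + K * c) / beta * (f' + g').
    rewrite mulrAC ler_pdivlMr// mulrC; apply: infsup_bound => //.
      by rewrite mulr_ge0 ?addr_ge0// mulr_ge0.
    move=> z Sz; have /eqP := xF z Sz; rewrite addrC eq_sym -subr_eq => /eqP <-.
    have h2 := functional_bound bF Sz; have h3 := form_bound bA Sx Sz.
    apply: le_trans (ler_normB _ _) _; apply: le_trans (lerD h2 h3) _.
    rewrite -mulrDl ler_wpM2r ?snorm_ge0// mulrDl mul1r lerD ?lerDl// -mulrA ler_wpM2l//.
  by rewrite /brezzi_cst -/c mulrDl lerD.
have [x [q [Sx Vq xF xG]]] := saddle_solvable bA def bF bG.
exists x, q; split; [by []| |exact: bound bF bG _ _ xF xG].
move=> x' q' [Sx' Vq' xF' xG'].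
have b0S : bounded_functional S nX (fun=> 0) 0.
  by split=> [a u v _ _|u _]; rewrite ?mulr0 ?addr0// normr0 mul0r.
have b0V : bounded_functional V nQ (fun=> 0) 0.
  by split=> [a u v _ _|u _]; rewrite ?mulr0 ?addr0// normr0 mul0r.
have Sd : S (x' - x) by exact: subspace_sub.
have Vd : V (q' - q) by exact: subspace_sub.
have := bound _ _ _ _ _ _ (lexx 0) (lexx 0) b0S b0V Sd Vd.
have H1 y : S y -> A (x' - x) y + b (q' - q) y = 0.
  move=> Sy; rewrite (linear_onB (S := S) (f := A^~ y))//; last first.
    by move=> *; exact: (form_linl bA).
  rewrite (linear_onB (S := V) (f := b^~ y))//; last by move=> *; exact: bl.
  by rewrite addrACA -opprD xF'// xF// subrr.
have H2 r : V r -> b r (x' - x) = 0.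
  move=> Vr; rewrite (linear_onB (S := S) (f := b r))//; last by move=> *; exact: br.
  by rewrite xG// xG'// subrr.
move=> /(_ H1 H2); rewrite addr0 mulr0 => h.
have n1 : 0 <= nX (x' - x) := snorm_ge0 _ _; have n2 : 0 <= nQ (q' - q) := snorm_ge0 _ _.
by split; apply/eqP; rewrite eq_le ?n1 ?n2 andbT; lra.
Qed.

End brezzi.

(** * The energy of the plate *)

Section plate_theory.
Context (R : realType) (E nu t : R) (beta : set 'rV[R]_2).
Hypotheses (E0 : 0 < E) (nu0 : 0 < nu < 1 / 2) (t0 : 0 < t).
Hypotheses (ob : open beta) (bb : bounded_set beta).
Let mb : measurable beta := open_measurable_rV ob.
Local Notation P := ('rV[R]_2 -> 'rV[R]_3).
Local Notation Y := ('rV[R]_2 -> 'M[R]_2).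
Local Notation X := ('rV[R]_2 -> R^o).
Local Notation lam := (leb R 2).
Local Notation inn := (inner lam beta : X -> X -> R).
Implicit Types u v w : P.
Let L2s := L2_sip lam mb.
Let Ls := L2m_sip lam mb 2 2.

Definition plate_comp v (I : 'I_2) : 'rV[R]_2 -> R := fun x => inplane v x ord0 I.

Definition plate_space : set P :=
  [set v | (forall I, H1 beta (plate_comp v I)) /\ H2 beta (deflection v)].

Definition clamped_space : set P :=
  [set v | (forall I, H10 beta (plate_comp v I)) /\ (H2 beta (deflection v) /\ H10 beta (deflection v))].

Lemma clamped_plate : clamped_space `<=` plate_space.
Proof. by move=> v [h [h2 _]]; split=> // I; have [] := h I. Qed.

Lemma plate_comp_lin (a : R) u v I :
  plate_comp (a *: u + v) I = fun x => a * plate_comp u I x + plate_comp v I x.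
Proof. by apply/funext => x; rewrite /plate_comp !mxE. Qed.

Lemma deflection_lin (a : R) u v :
  deflection (a *: u + v) = fun x => a * deflection u x + deflection v x.
Proof. by apply/funext => x; rewrite /deflection !mxE. Qed.

Lemma plate_subspace : linear_subspace plate_space.
Proof.
split.
  split=> [I|].
    rewrite (_ : plate_comp 0 I = 0); first exact: (H1_subspace ob bb).1.
    by apply/funext => x; rewrite /plate_comp !mxE.
  rewrite (_ : deflection 0 = 0); first exact: (H2_subspace ob bb).1.
  by apply/funext => x; rewrite /deflection mxE.
move=> a u v [hu ku] [hv kv]; split=> [I|].
  by rewrite plate_comp_lin; exact: ((H1_subspace ob bb).2 a _ _ (hu I) (hv I)).
by rewrite deflection_lin; exact: ((H2_subspace ob bb).2 a _ _ ku kv).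
Qed.

Definition plate_ip u v : R :=
  \sum_I grad_ip beta (plate_comp u I) (plate_comp v I)
  + hess_ip beta (deflection u) (deflection v).

Lemma plate_sip : semi_inner_product plate_space plate_ip.
Proof.
apply: (sip_add (ip1 := fun u v => \sum_I grad_ip beta (plate_comp u I) (plate_comp v I))
  (ip2 := fun u v => hess_ip beta (deflection u) (deflection v))).
  apply: sip_sum; first exact: plate_subspace.
  move=> I; apply: (@sip_pullback R P X _ _ _ (plate_comp^~ I) (grad_sip ob bb)).
  - exact: plate_subspace.
  - by move=> v [h _]; exact: h.
  - move=> a u v z [hu _] [hv _] Hz; rewrite plate_comp_lin.
    exact: (sip_lin (grad_sip ob bb) a (hu I) (hv I) Hz).
apply: (@sip_pullback R P X _ _ _ (@deflection R) (hess_sip ob bb)).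
- exact: plate_subspace.
- by move=> v [_ h].
- move=> a u v z [_ hu] [_ hv] Hz; rewrite deflection_lin.
  exact: (sip_lin (hess_sip ob bb) a hu hv Hz).
Qed.

Lemma strainE v I J : (fun x => plate_strain beta v x I J) =
  (2^-1 *: ((wD beta I (plate_comp v J) : X) + wD beta J (plate_comp v I)) : X).
Proof. by apply/funext => x; rewrite mxE. Qed.

Lemma curvatureE v I J : (fun x => curvature beta v x I J) =
  (-1 *: (wD beta J (wD beta I (deflection v)) : X) : X).
Proof. by apply/funext => x; rewrite mxE scaleN1r. Qed.

Lemma comb_scale (a c x y z x' y' z' : R) : z' = c * z -> x' = c * x -> y' = c * y ->
  z = a * x + y -> z' = a * x' + y'.
Proof. by move=> -> -> -> ->; ring. Qed.

Lemma comb_eq (a x y z x' y' z' : R) : z' = z -> x' = x -> y' = y ->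
  z = a * x + y -> z' = a * x' + y'.
Proof. by move=> -> -> -> ->. Qed.

Local Opaque inner wD norm0 H1_norm H1_semi H2_semi.

Lemma comp_wD_L2 v I J : plate_space v -> L2 lam beta (wD beta I (plate_comp v J)).
Proof. by move=> [h _]; exact: (H1_wD_L2 I (h J)). Qed.

Lemma defl_wD_L2 v I J : plate_space v -> L2 lam beta (wD beta J (wD beta I (deflection v))).
Proof. by move=> [_ h]; exact: (H1_wD_L2 J (H2_wD I h)). Qed.

Lemma strain_L2m v : plate_space v -> L2m lam beta (plate_strain beta v).
Proof.
move=> hv I J; rewrite strainE; apply: (subspace_scale (sip_subspace L2s)).
by apply: (subspace_add (sip_subspace L2s)); exact: comp_wD_L2.
Qed.

Lemma curvature_L2m v : plate_space v -> L2m lam beta (curvature beta v).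
Proof.
by move=> hv I J; rewrite curvatureE; apply: (subspace_scale (sip_subspace L2s)); exact: defl_wD_L2.
Qed.

Lemma inner_half (f g z : X) : L2 lam beta f -> L2 lam beta g -> L2 lam beta z ->
  inn (2^-1 *: (f + g)) z = 2^-1 * (inn f z + inn g z).
Proof.
move=> Lf Lg Lz; have fl a x y (Lx : L2 lam beta x) (Ly : L2 lam beta y) := sip_lin L2s a Lx Ly Lz.
rewrite (linear_onZ (sip_subspace L2s) fl).
  by rewrite (linear_onD fl Lf Lg).
exact: (subspace_add (sip_subspace L2s) Lf Lg).
Qed.

Lemma strain_lin (a : R) u v (z : Y) : plate_space u -> plate_space v -> L2m lam beta z ->
  innerm lam beta (plate_strain beta (a *: u + v)) z =
  a * innerm lam beta (plate_strain beta u) z + innerm lam beta (plate_strain beta v) z.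
Proof.
move=> hu hv Lz; have huv := plate_subspace.2 a u v hu hv.
rewrite /innerm mulr_sumr -big_split/=; apply: eq_bigr => I _.
rewrite mulr_sumr -big_split/=; apply: eq_bigr => J _.
have e w (hw : plate_space w) : inn (fun x => plate_strain beta w x I J) (fun x => z x I J) =
    2^-1 * (inn (wD beta I (plate_comp w J)) (fun x => z x I J) +
            inn (wD beta J (plate_comp w I)) (fun x => z x I J)).
  by rewrite strainE; exact: (inner_half (comp_wD_L2 I J hw) (comp_wD_L2 J I hw) (Lz I J)).
have e1 := etrans (congr1 (fun f => inn (wD beta I f) (fun x => z x I J)) (plate_comp_lin a u v J))
  (wD_lin ob bb I a (hu.1 J) (hv.1 J) (Lz I J)).
have e2 := etrans (congr1 (fun f => inn (wD beta J f) (fun x => z x I J)) (plate_comp_lin a u v I))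
  (wD_lin ob bb J a (hu.1 I) (hv.1 I) (Lz I J)).
exact: (comb_scale (e _ huv) (e _ hu) (e _ hv) (linear_comb_add e1 e2)).
Qed.

Lemma curvature_lin (a : R) u v (z : Y) : plate_space u -> plate_space v -> L2m lam beta z ->
  innerm lam beta (curvature beta (a *: u + v)) z =
  a * innerm lam beta (curvature beta u) z + innerm lam beta (curvature beta v) z.
Proof.
move=> hu hv Lz; have huv := plate_subspace.2 a u v hu hv.
rewrite /innerm mulr_sumr -big_split/=; apply: eq_bigr => I _.
rewrite mulr_sumr -big_split/=; apply: eq_bigr => J _.
have e w (hw : plate_space w) : inn (fun x => curvature beta w x I J) (fun x => z x I J) =
    -1 * (inn (wD beta J (wD beta I (deflection w))) (fun x => z x I J)).
  rewrite curvatureE; apply: (linear_onZ (sip_subspace L2s)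
    (fun a x y Lx Ly => sip_lin L2s a Lx Ly (Lz I J))); exact: defl_wD_L2.
have e1 := etrans
  (congr1 (fun f => inn (wD beta J (wD beta I f)) (fun x => z x I J)) (deflection_lin a u v))
  (wD2_lin ob bb I J a hu.2 hv.2 (Lz I J)).
exact: (comb_scale (e _ huv) (e _ hu) (e _ hv) e1).
Qed.

Let km := E * t / (1 - nu ^+ 2).
Let kb := E * t ^+ 3 / (12 * (1 - nu ^+ 2)).

Definition plate_form u v : R :=
  innerm lam beta (plate_stress E nu t beta u) (plate_strain beta v)
  + innerm lam beta (moment E nu t beta u) (curvature beta v).

Lemma plate_law_isotropic (k : R) (e : 'M[R]_2) :
  plate_law nu k e = isotropic (k * (1 - nu)) (k * nu) e.
Proof. by rewrite /plate_law /isotropic scalerDr scalerA scale_scalar_mx mulrA. Qed.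

Lemma plate_formE u v : plate_space u -> plate_space v -> plate_form u v =
  isotropic_ip beta (km * (1 - nu)) (km * nu) (plate_strain beta u) (plate_strain beta v)
  + isotropic_ip beta (kb * (1 - nu)) (kb * nu) (curvature beta u) (curvature beta v).
Proof.
move=> hu hv; rewrite -!(inner_isotropic mb); try exact: strain_L2m; try exact: curvature_L2m.
congr (_ + _); congr innerm; apply/funext => x; exact: plate_law_isotropic.
Qed.

Let km0 : 0 < km.
Proof.
have /andP[n0 n1] := nu0; rewrite divr_gt0 ?mulr_gt0// subr_gt0 expr_lt1 ?ltW//.
by rewrite (lt_trans n1)// ltr_pdivrMr// mul1r ltr1n.
Qed.

Let kb0 : 0 < kb.
Proof.
have /andP[n0 n1] := nu0; rewrite divr_gt0 ?mulr_gt0 ?exprn_gt0// subr_gt0 expr_lt1 ?ltW//.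
by rewrite (lt_trans n1)// ltr_pdivrMr// mul1r ltr1n.
Qed.

Let nu1 : 0 < 1 - nu.
Proof. by have /andP[n0 n1] := nu0; lra. Qed.

Let nup : 0 < nu. Proof. by have /andP[] := nu0. Qed.

Let isom : semi_inner_product (@L2m R 2 lam beta 2 2 : set Y) (isotropic_ip beta (km * (1 - nu)) (km * nu)).
Proof. exact: (isotropic_sip 2 mb (mulr_ge0 (ltW km0) (ltW nu1)) (mulr_ge0 (ltW km0) (ltW nup))). Qed.

Let isob : semi_inner_product (@L2m R 2 lam beta 2 2 : set Y) (isotropic_ip beta (kb * (1 - nu)) (kb * nu)).
Proof. exact: (isotropic_sip 2 mb (mulr_ge0 (ltW kb0) (ltW nu1)) (mulr_ge0 (ltW kb0) (ltW nup))). Qed.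

(** The isotropic form against z is the inner product with the isotropic image of z. *)
Lemma isotropic_ip_linear k1 k2 (F G H z : Y) a : L2m lam beta F -> L2m lam beta G -> L2m lam beta H ->
  L2m lam beta z ->
  (forall z, L2m lam beta z -> innerm lam beta H z = a * innerm lam beta F z + innerm lam beta G z) ->
  isotropic_ip beta k1 k2 H z = a * isotropic_ip beta k1 k2 F z + isotropic_ip beta k1 k2 G z.
Proof.
move=> LF LG LH Lz h.
have Liz : L2m lam beta (fun x => isotropic k1 k2 (z x)).
  have -> : (fun x => isotropic k1 k2 (z x)) = k1 *: z + (fun x => (k2 * \tr (z x))%:M) :> Y by [].
  apply: (sip_subspace Ls).2 => // i j.
  have -> : (fun x => ((k2 * \tr (z x))%:M : 'M[R]_2) i j) = ((k2 *+ (i == j)) *: (fun x => \tr (z x)) : X).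
    by apply/funext => x; rewrite mxE -[RHS]/((k2 *+ (i == j)) * \tr (z x)) mulrnAl.
  by apply: (subspace_scale (sip_subspace L2s)); exact: (L2_tr mb).
have e (w : Y) : L2m lam beta w -> isotropic_ip beta k1 k2 w z = innerm lam beta w (fun x => isotropic k1 k2 (z x)).
  move=> Lw; rewrite (isotropic_ipC mb _ _ Lw Lz) -(inner_isotropic mb _ _ Lz Lw).
  exact: (sip_sym Ls).
by rewrite (e _ LF) (e _ LG) (e _ LH); exact: h.
Qed.

Lemma plate_form_sip : semi_inner_product plate_space plate_form.
Proof.
have s1 : semi_inner_product plate_space (fun u v =>
    isotropic_ip beta (km * (1 - nu)) (km * nu) (plate_strain beta u) (plate_strain beta v)).
  apply: (sip_pullback (L := plate_strain beta) isom plate_subspace); first exact: strain_L2m.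
  move=> a u v z hu hv Lz; have huv := plate_subspace.2 a u v hu hv.
  apply: isotropic_ip_linear => //; try exact: strain_L2m.
  by move=> z' Lz'; exact: strain_lin.
have s2 : semi_inner_product plate_space (fun u v =>
    isotropic_ip beta (kb * (1 - nu)) (kb * nu) (curvature beta u) (curvature beta v)).
  apply: (sip_pullback (L := curvature beta) isob plate_subspace); first exact: curvature_L2m.
  move=> a u v z hu hv Lz; have huv := plate_subspace.2 a u v hu hv.
  apply: isotropic_ip_linear => //; try exact: curvature_L2m.
  by move=> z' Lz'; exact: curvature_lin.
have s := sip_add s1 s2; split; first exact: plate_subspace.
- move=> a u v w hu hv hw; have huv := plate_subspace.2 a u v hu hv.
  exact: (comb_eq (plate_formE huv hw) (plate_formE hu hw) (plate_formE hv hw) (sip_lin s a hu hv hw)).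
- move=> u v hu hv.
  exact: (etrans (plate_formE hu hv) (etrans (sip_sym s hu hv) (esym (plate_formE hv hu)))).
- by move=> u hu; rewrite (plate_formE hu hu); exact: (sip_ge0 s hu).
Qed.

Lemma inner_strain v I J : plate_space v ->
  inn (fun x => plate_strain beta v x I J) (fun x => plate_strain beta v x I J) =
  4^-1 * (inn (wD beta I (plate_comp v J)) (wD beta I (plate_comp v J))
        + 2 * inn (wD beta I (plate_comp v J)) (wD beta J (plate_comp v I))
        + inn (wD beta J (plate_comp v I)) (wD beta J (plate_comp v I))).
Proof.
move=> hv; have Lf := comp_wD_L2 I J hv; have Lg := comp_wD_L2 J I hv.
rewrite strainE; move: (wD beta I _) (wD beta J _) Lf Lg => f g Lf Lg.
have Lfg := subspace_add (sip_subspace L2s) Lf Lg.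
have Lh := subspace_scale (sip_subspace L2s) 2^-1 Lfg.
rewrite (inner_half Lf Lg Lh) (sip_sym L2s Lf Lh) (sip_sym L2s Lg Lh).
rewrite (inner_half Lf Lg Lf) (inner_half Lf Lg Lg) (sip_sym L2s Lg Lf).
move: (inn f f) (inn f g) (inn g g) => p q r; by field.
Qed.

(** The curvature is minus the matrix of second derivatives of the deflection. *)
Lemma inner_curvature v : plate_space v ->
  innerm lam beta (curvature beta v) (curvature beta v) = hess_ip beta (deflection v) (deflection v).
Proof.
move=> hv; apply: eq_bigr => I _; apply: eq_bigr => J _.
rewrite curvatureE; have Lf := defl_wD_L2 I J hv; move: (wD _ _ _) Lf => f Lf.
have := snormZ L2s (-1) Lf; rewrite normrN1 mul1r => h.
have := congr1 (fun x => x ^+ 2) h.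
by rewrite !(sqr_snorm L2s)//; exact: (subspace_scale (sip_subspace L2s)).
Qed.

Lemma sum_I2 (F : 'I_2 -> R) : \sum_I F I = F ord0 + F (lift ord0 ord0).
Proof. by rewrite !big_ord_recl big_ord0 addr0. Qed.

Lemma sum_strain v : plate_space v ->
  innerm lam beta (plate_strain beta v) (plate_strain beta v) =
  \sum_I \sum_J 4^-1 * (inn (wD beta I (plate_comp v J)) (wD beta I (plate_comp v J))
        + 2 * inn (wD beta I (plate_comp v J)) (wD beta J (plate_comp v I))
        + inn (wD beta J (plate_comp v I)) (wD beta J (plate_comp v I))).
Proof. by move=> pv; apply: eq_bigr => I _; apply: eq_bigr => J _; exact: inner_strain. Qed.

Lemma korn_algebra (A C : 'I_2 -> 'I_2 -> R) (i := ord0 : 'I_2) (j := lift ord0 ord0 : 'I_2) :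
  (forall k, C k k = A k k) -> C j i = C i j -> 0 <= A i i + 2 * C i j + A j j ->
  \sum_I \sum_J A J I <= 2 * \sum_I \sum_J 4^-1 * (A I J + 2 * C I J + A J I).
Proof.
move=> CA Cji; rewrite !sum_I2 -/i -/j !CA Cji.
move: (A i i) (A i j) (A j i) (A j j) (C i j) => p q u v w h; lra.
Qed.

(** Integrating by parts twice, the mixed products of the first derivatives become (d_1
    v_1, d_2 v_2); together with the diagonal terms they make up the square of the
    divergence, which is nonnegative. *)
Lemma korn v : clamped_space v ->
  \sum_I grad_ip beta (plate_comp v I) (plate_comp v I) <=
  2 * innerm lam beta (plate_strain beta v) (plate_strain beta v).
Proof.
move=> hv; have pv := clamped_plate hv; have [h0 _] := hv.
rewrite (sum_strain pv).
pose A I J := inn (wD beta I (plate_comp v J)) (wD beta I (plate_comp v J)).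
pose C I J := inn (wD beta I (plate_comp v J)) (wD beta J (plate_comp v I)).
pose i : 'I_2 := ord0; pose j : 'I_2 := lift ord0 ord0.
have Lii := comp_wD_L2 i i pv; have Ljj := comp_wD_L2 j j pv.
have Cji : C j i = C i j := sip_sym L2s (comp_wD_L2 j i pv) (comp_wD_L2 i j pv).
have sw : C i j = inn (wD beta i (plate_comp v i)) (wD beta j (plate_comp v j)).
  exact: (etrans (inner_wDC ob bb i j (h0 j) (h0 i)) (sip_sym L2s Ljj Lii)).
have ge : 0 <= A i i + 2 * C i j + A j j.
  exact: (eq_ind _ (fun c => 0 <= A i i + 2 * c + A j j) (sip_sum_ge0 L2s Lii Ljj) _ (esym sw)).
exact: (korn_algebra (A := A) (C := C) (fun k => erefl) Cji ge).
Qed.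

Lemma strain_algebra (A C : 'I_2 -> 'I_2 -> R) : (forall I J, 2 * C I J <= A I J + A J I) ->
  \sum_I \sum_J 4^-1 * (A I J + 2 * C I J + A J I) <= \sum_I \sum_J A J I.
Proof.
move=> AC; rewrite !sum_I2.
have := AC ord0 ord0; have := AC ord0 (lift ord0 ord0); have := AC (lift ord0 ord0) ord0.
have := AC (lift ord0 ord0) (lift ord0 ord0).
move: (A _ _) (A _ _) (A _ _) (A _ _) (C _ _) (C _ _) (C _ _) (C _ _) => *; lra.
Qed.

Lemma strain_le v : plate_space v ->
  innerm lam beta (plate_strain beta v) (plate_strain beta v) <=
  \sum_I grad_ip beta (plate_comp v I) (plate_comp v I).
Proof.
move=> pv; rewrite (sum_strain pv).
pose A I J := inn (wD beta I (plate_comp v J)) (wD beta I (plate_comp v J)).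
pose C I J := inn (wD beta I (plate_comp v J)) (wD beta J (plate_comp v I)).
have AC I J : 2 * C I J <= A I J + A J I := sip_young L2s (comp_wD_L2 I J pv) (comp_wD_L2 J I pv).
exact: (strain_algebra AC).
Qed.

Definition plate_coer : R := Num.min (km * (1 - nu) / 2) (kb * (1 - nu)).

Lemma plate_coer_gt0 : 0 < plate_coer.
Proof.
rewrite /plate_coer lt_min; apply/andP; split; last exact: (mulr_gt0 kb0 nu1).
by apply: divr_gt0; [exact: (mulr_gt0 km0 nu1)|].
Qed.

Lemma plate_form_coercive v : clamped_space v -> plate_coer * plate_ip v v <= plate_form v v.
Proof.
move=> hv; have pv := clamped_plate hv; rewrite (plate_formE pv pv) mulrDr.
have Ls' := strain_L2m pv; have Lc := curvature_L2m pv.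
have k2 : 0 <= km * nu := mulr_ge0 (ltW km0) (ltW nup).
have k2' : 0 <= kb * nu := mulr_ge0 (ltW kb0) (ltW nup).
have h1 := isotropic_ip_ge mb (km * (1 - nu)) k2 Ls'.
have h2 := isotropic_ip_ge mb (kb * (1 - nu)) k2' Lc.
rewrite (inner_curvature pv) in h2.
apply: lerD.
  apply: le_trans h1; apply: (@le_trans _ _ (km * (1 - nu) / 2 *
      \sum_I grad_ip beta (plate_comp v I) (plate_comp v I))).
    apply: ler_wpM2r; last by rewrite ge_min lexx.
    by apply: sumr_ge0 => I _; exact: (sip_ge0 (grad_sip ob bb) (pv.1 I)).
  rewrite -mulrA; apply: ler_wpM2l; first exact: (mulr_ge0 (ltW km0) (ltW nu1)).
  have := korn hv; move: (\sum_I _) (innerm _ _ _ _) => p q h; lra.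
apply: le_trans h2; apply: ler_wpM2r; first exact: (sip_ge0 (hess_sip ob bb) pv.2).
by rewrite ge_min lexx orbT.
Qed.

Definition plate_bound : R := (`|km * (1 - nu)| + `|km * nu| * 2%:R ^+ 2)
  + (`|kb * (1 - nu)| + `|kb * nu| * 2%:R ^+ 2).

Lemma plate_form_le v : plate_space v -> plate_form v v <= plate_bound * plate_ip v v.
Proof.
move=> pv; rewrite (plate_formE pv pv).
have Ls' := strain_L2m pv; have Lc := curvature_L2m pv.
have h1 := le_trans (ler_norm _) (isotropic_ip_bound mb (km * (1 - nu)) (km * nu) Ls' Ls').
have h2 := le_trans (ler_norm _) (isotropic_ip_bound mb (kb * (1 - nu)) (kb * nu) Lc Lc).
rewrite -mulrA -expr2 sqr_norm0m in h1; rewrite -mulrA -expr2 sqr_norm0m (inner_curvature pv) in h2.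
have h3 := strain_le pv.
have g0 : 0 <= \sum_I grad_ip beta (plate_comp v I) (plate_comp v I).
  by apply: sumr_ge0 => I _; exact: (sip_ge0 (grad_sip ob bb) (pv.1 I)).
have g1 := sip_ge0 (hess_sip ob bb) pv.2.
have a0 : 0 <= `|km * (1 - nu)| + `|km * nu| * 2%:R ^+ 2 by rewrite addr_ge0// mulr_ge0.
have b0 : 0 <= `|kb * (1 - nu)| + `|kb * nu| * 2%:R ^+ 2 by rewrite addr_ge0// mulr_ge0.
apply: le_trans (lerD (le_trans h1 (ler_wpM2l a0 h3)) h2) _.
rewrite /plate_bound /plate_ip.
move: (_ + _) (_ + _) (\sum_I _) (hess_ip _ _ _) a0 b0 g0 g1 => p q x y p0 q0 x0 y0.
by have := mulr_ge0 p0 y0; have := mulr_ge0 q0 x0; nra.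
Qed.

End plate_theory.

(** * Null functions and the norm of the plate *)

Section null_functions.
Context (R : realType) (n : nat) (D : set 'rV[R]_n).
Hypotheses (oD : open D) (bD : bounded_set D).
Let mD : measurable D := open_measurable_rV oD.
Local Notation X := ('rV[R]_n -> R^o).
Local Notation lam := (leb R n).
Local Notation L2D := (L2 lam D).
Local Notation inn := (inner lam D : X -> X -> R).
Implicit Types (f u z : 'rV[R]_n -> R).
Let L2s := L2_sip lam mD.

Lemma ae0_inner f z : L2D f -> L2D z -> {ae lam, forall x, D x -> f x = 0} -> inn f z = 0.
Proof.
move=> Lf Lz f0; have [mf _] := Lf; have L0 := (sip_subspace L2s).1.
have e := ae_inner mD L0 Lz mf f0.
apply: (etrans e); apply: (linear_on0 (sip_subspace L2s) (f := inn^~ z)).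
by move=> a x y Lx Ly; exact: (sip_lin L2s).
Qed.

(** A function that vanishes almost everywhere has the weak derivative zero. Hence such
    functions are null for each of the norms. *)
Lemma null_weak_partial i u : L2D u -> (forall z, L2D z -> inn u z = 0) -> weak_partial D i u (fun=> 0).
Proof.
move=> Lu u0; split; first exact: (sip_subspace L2s).1.
move=> phi tphi; rewrite u0; last exact: (test_L2 oD bD (test_partial i tphi)).
rewrite [X in _ = - X](_ : _ = 0) ?oppr0//.
apply: (linear_on0 (sip_subspace L2s) (f := inn^~ phi)) => a x y Lx Ly.
exact: (sip_lin L2s a Lx Ly (test_L2 oD bD tphi)).
Qed.

Lemma inner0l z : L2D z -> inn (fun=> 0) z = 0.
Proof.
move=> Lz; apply: (linear_on0 (sip_subspace L2s) (f := inn^~ z)) => a x y Lx Ly.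
exact: (sip_lin L2s a Lx Ly Lz).
Qed.

Lemma null_wD i u z : H1 D u -> (forall z, L2D z -> inn u z = 0) -> L2D z -> inn (wD D i u) z = 0.
Proof.
move=> Hu u0 Lz; have e := weak_partial_unique oD bD (H1_wD i Hu)
  (null_weak_partial i (H1_L2 Hu) u0) Lz.
exact: (etrans e (inner0l Lz)).
Qed.

Lemma null_grad_ip u : H1 D u -> {ae lam, forall x, D x -> u x = 0} -> grad_ip D u u = 0.
Proof.
move=> Hu u0; apply: big1 => i _; apply: null_wD => //; last exact: H1_wD_L2.
by move=> z Lz; exact: (ae0_inner (H1_L2 Hu) Lz u0).
Qed.

Lemma null_hess_ip u : H2 D u -> {ae lam, forall x, D x -> u x = 0} -> hess_ip D u u = 0.
Proof.
move=> Hu u0; apply: big1 => i _; apply: big1 => j _.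
have L : L2D (wD D j (wD D i u)) := H1_wD_L2 j (H2_wD i Hu).
have n0 z (Lz : L2D z) : inn u z = 0 := ae0_inner (H1_L2 (H2_H1 Hu)) Lz u0.
have n1 z (Lz : L2D z) : inn (wD D i u) z = 0 := null_wD i (H2_H1 Hu) n0 Lz.
exact: (null_wD j (H2_wD i Hu) n1 L).
Qed.

Lemma null_innerm p q (F G : 'rV[R]_n -> 'M[R]_(p, q)) : L2m lam D F -> L2m lam D G ->
  {ae lam, forall x, D x -> F x = 0} -> innerm lam D F G = 0.
Proof.
move=> LF LG F0; apply: big1 => i _; apply: big1 => j _.
apply: (ae0_inner (LF i j) (LG i j)); apply: filterS F0 => x h Dx; by rewrite h ?mxE.
Qed.

Lemma null_div_ip (tau : 'rV[R]_n -> 'M[R]_n) : Hdiv D tau ->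
  {ae lam, forall x, D x -> tau x = 0} -> div_ip D tau tau = 0.
Proof.
move=> Ht t0; have Lt := Hdiv_L2 Ht; rewrite /div_ip (null_innerm Lt Lt t0) add0r.
have z0 : weak_div D tau 0.
  split; first exact: (L2m_subspace lam mD 1 n).1.
  move=> i phi tphi; have Lphi := test_L2 oD bD tphi; rewrite big1 => [|j _].
    have -> : (fun x : 'rV[R]_n => (0 : 'rV[R]_n -> 'rV[R]_n) x ord0 i) = fun=> 0.
      by apply/funext => x; rewrite mxE.
    by rewrite [X in _ = - X](inner0l Lphi) oppr0.
  have Ldphi := test_L2 oD bD (test_partial j tphi).
  apply: (ae0_inner (Lt i j) Ldphi); apply: filterS t0 => x h Dx; by rewrite h ?mxE.
have Lw := wdiv_L2 Ht; have e := weak_div_unique oD bD (wdivP Ht) z0 Lw.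
have lin a x y (Lx : L2m lam D x) (Ly : L2m lam D y) := sip_lin (L2m_sip lam mD 1 n) a Lx Ly Lw.
exact: (etrans e (linear_on0 (sip_subspace (L2m_sip lam mD 1 n)) lin)).
Qed.

(** The entries are indexed by a countable type, so the null sets of the entries can be
    united. *)
Lemma innerm_eq0_ae p q (F : 'rV[R]_n -> 'M[R]_(p, q)) : L2m lam D F ->
  innerm lam D F F = 0 -> {ae lam, forall x, D x -> F x = 0}.
Proof.
move=> LF F0.
have e i j : {ae lam, forall x, D x -> F x i j = 0}.
  apply: (inner_eq0_ae mD (LF i j)); apply/eqP; rewrite eq_le inner_ge0 andbT -[X in _ <= X]F0.
  apply: le_trans (ler_sum_term (F := fun i => \sum_j inn (fun x => F x i j) (fun x => F x i j)) i _).
    by apply: (ler_sum_term (F := fun j => inn (fun x => F x i j) (fun x => F x i j))) => k; exact: inner_ge0.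
  by move=> k; apply: sumr_ge0 => l _; exact: inner_ge0.
have : {ae lam, forall x (k : nat), if unpickle k is Some ij then D x -> F x ij.1 ij.2 = 0 else True}.
  apply: ae_foralln => k; case: (unpickle k : option ('I_p * 'I_q)) => [[i j]|]; last exact: aeW.
  exact: e.
apply: filterS => x h Dx; apply/matrixP => i j; rewrite mxE.
by have := h (pickle (i, j)); rewrite pickleK; exact.
Qed.

End null_functions.

Section plate_poincare.
Context (R : realType) (beta : set 'rV[R]_2).
Hypotheses (ob : open beta) (bb : bounded_set beta).
Local Notation P := ('rV[R]_2 -> 'rV[R]_3).
Implicit Types v : P.

Definition plate_norm v : R := snorm (plate_ip beta) v.

Lemma sqr_plate_norm v : plate_norm v ^+ 2 =
  \sum_I H1_semi beta (plate_comp v I) ^+ 2 + H2_semi beta (deflection v) ^+ 2.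
Proof.
rewrite sqr_sqrtr; last first.
  apply: addr_ge0; first by apply: sumr_ge0 => I _; apply: sumr_ge0 => i _; exact: inner_ge0.
  by apply: sumr_ge0 => I _; apply: sumr_ge0 => i _; exact: inner_ge0.
by rewrite /plate_ip sqr_H2_semi; congr (_ + _); apply: eq_bigr => I _; rewrite sqr_H1_semi.
Qed.

Lemma plate_norm_ge0 v : 0 <= plate_norm v. Proof. exact: sqrtr_ge0. Qed.

Lemma plate_comp_lift v I : (fun x => v x ord0 (lift ord_max I)) = plate_comp v I.
Proof. by apply/funext => x; rewrite /plate_comp mxE. Qed.

Local Opaque H1_semi H2_semi H1_norm norm0 plate_norm.

Lemma comp_le_plate_norm v I : H1_semi beta (plate_comp v I) <= plate_norm v.
Proof.
rewrite -(@ler_pXn2r _ 2)// ?nnegrE ?H1_semi_ge0 ?plate_norm_ge0// sqr_plate_norm.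
apply: ler_wpDr; first exact: sqr_ge0.
by apply: (ler_sum_term (F := fun I => H1_semi beta (plate_comp v I) ^+ 2)) => k; exact: sqr_ge0.
Qed.

Lemma defl_le_plate_norm v : H2_semi beta (deflection v) <= plate_norm v.
Proof.
rewrite -(@ler_pXn2r _ 2)// ?nnegrE ?H2_semi_ge0 ?plate_norm_ge0// sqr_plate_norm.
by apply: ler_wpDl => //; apply: sumr_ge0 => k _; exact: sqr_ge0.
Qed.

Lemma clamped_H1v v : clamped_space beta v -> H1v beta v.
Proof.
move=> [h [h2 h10]] i; case: (unliftP ord_max i) => [I|] ->.
  by rewrite plate_comp_lift; exact: H10_H1 (h I).
exact: H10_H1 h10.
Qed.

(** The in-plane components are controlled by the Poincare inequality. For the
    deflection, the first derivatives are controlled by the second ones first. *)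
Lemma clamped_H1_norm M v i : 0 <= M -> beta `<=` box M -> clamped_space beta v ->
  H1_norm beta (fun x => v x ord0 i) <= (2 * M + 1) * (4 * M + 1) * plate_norm v.
Proof.
move=> M0 bM [h [h2 h10]]; have N0 := plate_norm_ge0 v.
have c1 : 0 <= 2 * M + 1 by rewrite addr_ge0// mulr_ge0.
rewrite -mulrA; case: (unliftP ord_max i) => [I|] ->.
  rewrite plate_comp_lift; apply: le_trans (H1_norm_le_semi ob bb isT M0 bM (h I)) _.
  apply: ler_wpM2l => //; apply: le_trans (comp_le_plate_norm v I) _.
  by rewrite ler_peMl// lerDr mulr_ge0.
apply: le_trans (H1_norm_le_semi ob bb isT M0 bM h10) _; apply: ler_wpM2l => //.
apply: le_trans (H1_semi_le_H2_semi ob bb isT M0 bM h2 h10) _.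
have d := defl_le_plate_norm v.
have h4 : 2 * M * 2%:R * H2_semi beta (deflection v) <= 4 * M * plate_norm v.
  have -> : 2 * M * 2%:R = 4 * M :> R by ring.
  by apply: ler_wpM2l => //; rewrite mulr_ge0.
by apply: le_trans h4 _; rewrite ler_wpM2r// lerDl.
Qed.

Lemma H1v_norm_sqr v : H1v_norm beta v ^+ 2 = \sum_i H1_norm beta (fun x => v x ord0 i) ^+ 2.
Proof. by rewrite sqr_sqrtr// sumr_ge0// => i _; exact: sqr_ge0. Qed.

Lemma clamped_H1v_norm M v : 0 <= M -> beta `<=` box M -> clamped_space beta v ->
  H1v_norm beta v <= 3 * ((2 * M + 1) * (4 * M + 1)) * plate_norm v.
Proof.
move=> M0 bM hv; have N0 := plate_norm_ge0 v.
have C0 : 0 <= (2 * M + 1) * (4 * M + 1) by rewrite mulr_ge0// addr_ge0// mulr_ge0.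
have CN : 0 <= 3 * ((2 * M + 1) * (4 * M + 1)) * plate_norm v by do 2!rewrite mulr_ge0//.
rewrite -(@ler_pXn2r _ 2)// ?nnegrE ?sqrtr_ge0//.
rewrite H1v_norm_sqr.
apply: (@le_trans _ _ (\sum_(i < 3) ((2 * M + 1) * (4 * M + 1) * plate_norm v) ^+ 2)).
  have CN0 : 0 <= (2 * M + 1) * (4 * M + 1) * plate_norm v by exact: mulr_ge0.
  apply: ler_sum => i _; have h := clamped_H1_norm i M0 bM hv.
  by apply: lerXn2r => //; rewrite nnegrE ?H1_norm_ge0.
rewrite sumr_const card_ord -[3 * _ * _]mulrA.
move: ((2 * M + 1) * (4 * M + 1) * plate_norm v) => c.
by have := sqr_ge0 c; rewrite exprMn -mulr_natr; lra.
Qed.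

End plate_poincare.

(** * Finite element spaces *)

Section finite_element_spaces.
Context (R : realType) (n : nat) (D : set 'rV[R]_n) (V : lmodType R).
Context (Th : seq (n.+1.-tuple 'rV[R]_n)) (S : set ('rV[R]_n -> V)).
Hypothesis fe : fe_space D Th S.

Lemma fe_subspace : linear_subspace S.
Proof. by have [S0 Sl _ _] := fe; split. Qed.

(** The basis of the space represents its functions only almost everywhere, so it spans
    up to functions that vanish almost everywhere. *)
Lemma fe_spans (null : set ('rV[R]_n -> V)) :
  (forall f, S f -> {ae leb R n, forall x, D x -> f x = 0} -> null f) -> spans S null.
Proof.
move=> hn; have [_ _ [N [e [Se sp]]] _] := fe; exists N, e; split=> // f Sf.
have [c fc] := sp f Sf; exists c; apply: hn.
  apply: (subspace_sub fe_subspace Sf); apply: (subspace_sum fe_subspace) => k.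
  exact: (subspace_scale fe_subspace).
apply: filterS fc => x h Dx.
have e2 := congr1 (@^~ x) (fct_sumE (index_enum 'I_N) xpredT (fun k => c k *: e k)).
by rewrite [LHS](congr1 (fun z => f x - z) e2) (h Dx); exact: subrr.
Qed.

End finite_element_spaces.

Section plate_elements.
Context (R : realType) (beta : set 'rV[R]_2) (bd_beta : seq (2.-tuple 'rV[R]_2)).
Hypotheses (ob : open beta) (bb : bounded_set beta).
Context (Tb : seq (3.-tuple 'rV[R]_2)).
Context (W1 : set ('rV[R]_2 -> 'rV[R]_2)) (W2 : set ('rV[R]_2 -> R^o)).
Hypotheses (fe1 : fe_space beta Tb W1) (fe2 : fe_space beta Tb W2).
Hypothesis W1_conf : forall w, W1 w -> forall I, H10 beta (fun x => w x ord0 I).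
Hypothesis W2_conf : W2 `<=` H20 beta bd_beta.

Lemma product_clamped : product_space W1 W2 `<=` clamped_space beta.
Proof.
move=> v [w1 w2]; split=> [I|]; first exact: (W1_conf w1 I).
by have [h2 h10 _] := W2_conf w2.
Qed.

Lemma product_subspace : linear_subspace (product_space W1 W2).
Proof.
have s1 := fe_subspace fe1; have s2 := fe_subspace fe2; split.
  split.
    rewrite (_ : inplane 0 = 0); first exact: s1.1.
    by apply/funext => x; apply/rowP => I; rewrite !mxE.
  rewrite (_ : deflection 0 = 0); first exact: s2.1.
  by apply/funext => x; rewrite /deflection mxE.
move=> a u v [u1 u2] [v1 v2]; split.
  rewrite (_ : inplane _ = a *: inplane u + inplane v); first exact: s1.2.
  by apply/funext => x; apply/rowP => I; rewrite !mxE.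
rewrite (_ : deflection _ = a *: (deflection u : _ -> R^o) + deflection v); first exact: s2.2.
by apply/funext => x; rewrite /deflection !mxE.
Qed.

(** The bases of the two factors are put side by side, as displacements in the plane and
    as deflections. *)
Lemma product_spans :
  spans (product_space W1 W2) [set v | plate_ip beta v v = 0].
Proof.
pose null1 := [set w : 'rV[R]_2 -> 'rV[R]_2 |
  forall I, grad_ip beta (fun x => w x ord0 I) (fun x => w x ord0 I) = 0].
pose null2 := [set w : 'rV[R]_2 -> R^o | hess_ip beta w w = 0].
have sp1 : spans W1 null1.
  apply: (fe_spans fe1) => w Ww w0 I; apply: (null_grad_ip ob bb (W1_conf Ww I).1).
  by apply: filterS w0 => x h bx; rewrite h// mxE.
have sp2 : spans W2 null2.
  apply: (fe_spans fe2) => w Ww w0; have [h2 _ _] := W2_conf Ww.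
  exact: (null_hess_ip ob bb h2 w0).
have sp := spans_prod (fe_subspace fe1).1 (fe_subspace fe2).1 sp1 sp2.
pose phi (w : ('rV[R]_2 -> 'rV[R]_2) * ('rV[R]_2 -> R^o)) : 'rV[R]_2 -> 'rV[R]_3 :=
  fun x => snoc (w.1 x, w.2 x).
have phi1 w : inplane (phi w) = w.1.
  by apply/funext => x; apply/rowP => I; rewrite mxE snocK.
have phi2 w : deflection (phi w) = w.2.
  by apply/funext => x; rewrite /deflection snoc_max.
apply: (spans_image (phi := phi) _ _ _ _ sp).
- move=> a u v; apply/funext => x; apply/rowP => i; case: (unliftP ord_max i) => [I|] ->.
    by rewrite !mxE !liftK /= !mxE.
  by rewrite !mxE !unlift_none.
- by move=> w [w1 w2]; split; [rewrite phi1|rewrite phi2].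
- move=> v [v1 v2]; exists (inplane v, deflection v) => //.
  apply/funext => x; apply/rowP => i; case: (unliftP ord_max i) => [I|] ->.
    by rewrite snocK mxE.
  by rewrite snoc_max.
- move=> w [w1 w2]; rewrite /= /plate_ip phi2 big1 ?add0r//.
  by move=> I _; rewrite /plate_comp phi1; exact: w1.
Qed.

End plate_elements.

Lemma snorm0 (R : realType) (X : lmodType R) (ip : X -> X -> R) x :
  ip x x = 0 -> snorm ip x = 0.
Proof. by move=> h; rewrite /snorm h sqrtr0. Qed.

Lemma ae_sub_eq0 (R : realType) n (D : set 'rV[R]_n) (V : lmodType R) (f g : 'rV[R]_n -> V) :
  {ae leb R n, forall x, D x -> (f - g) x = 0} -> {ae leb R n, forall x, D x -> f x = g x}.
Proof. by apply: filterS => x h Dx; apply/eqP; rewrite -subr_eq0; apply/eqP; exact: h. Qed.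

(** This brings the constant to the form required: positive, and the same for both
    loads. *)
Lemma absorb_constant (R : realType) (k c f g : R) : 0 <= c -> 0 <= f -> 0 <= g ->
  k * (c * g + f) <= (`|k| * (c + 1) + 1) * (f + g).
Proof.
move=> c0 f0 g0; have h0 : 0 <= c * g + f by rewrite addr_ge0// mulr_ge0.
apply: le_trans (ler_wpM2r h0 (ler_norm k)) _.
have h : c * g + f <= (c + 1) * (f + g) by have := mulr_ge0 c0 f0; lra.
rewrite [leRHS]mulrDl mul1r -mulrA.
apply: le_trans (ler_wpM2l (normr_ge0 k) h) _.
by rewrite lerDl addr_ge0.
Qed.

Lemma ler_mul2 (R : realType) (c p q s t : R) :
  0 <= c -> 0 <= p -> 0 <= q -> p <= s -> q <= t -> c * p * q <= c * s * t.
Proof. by move=> c0 p0 q0 ps qt; rewrite -!mulrA ler_wpM2l// ler_pM. Qed.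

Lemma ler_comb (R : realType) (c n p q : R) : 0 <= p -> n <= c * q -> p * n <= c * p * q.
Proof. by move=> p0 nq; rewrite [c * p]mulrC -mulrA; exact: ler_wpM2l. Qed.

Lemma ler_norm4 (R : realType) (p q r s cp cq cr cs x y : R) :
  `|p| <= cp * x * y -> `|q| <= cq * x * y -> `|r| <= cr * x * y -> `|s| <= cs * x * y ->
  `|p + q + r - s| <= (cp + cq + cr + cs) * x * y.
Proof.
move=> hp hq hr hs; rewrite !mulrDl; apply: le_trans (ler_normB _ _) (lerD _ hs).
apply: le_trans (ler_normD _ _) (lerD _ hr).
exact: le_trans (ler_normD _ _) (lerD hp hq).
Qed.

(** * The coupled problem *)

Section coupled.
Context (R : realType) (alpha : set 'rV[R]_3) (bd_alpha : seq (3.-tuple 'rV[R]_3)).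
Context (beta : set 'rV[R]_2) (Gamma : set 'rV[R]_2).
Hypotheses (oa : open alpha) (ba : bounded_set alpha) (ob : open beta) (bb : bounded_set beta).
Hypothesis oG : open Gamma.
Context (Ea nua Eb nub tb : R).
Hypotheses (Ea0 : 0 < Ea) (Eb0 : 0 < Eb) (tb0 : 0 < tb).
Hypotheses (nua0 : 0 < nua < 1 / 2) (nub0 : 0 < nub < 1 / 2).
Local Notation Y := ('rV[R]_3 -> 'M[R]_3).
Local Notation Q := ('rV[R]_3 -> 'rV[R]_3).
Local Notation P := ('rV[R]_2 -> 'rV[R]_3).
Context (hat : P -> Q) (Ch M : R).
Hypotheses (hatP : forall v, H1v beta v ->
    [/\ Hhalf alpha bd_alpha (hat v),
        {ae surf bd_alpha, forall x, forall y, Gamma y -> x = plane y -> hat v x = v y} &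
        Hhalf_norm alpha bd_alpha (hat v) <= Ch * H1v_norm beta v]).
Hypotheses (M0 : 0 <= M) (bM : beta `<=` box M).
Context (S : set Y) (W : set P) (V : set Q).
Hypotheses (sS : linear_subspace S) (sW : linear_subspace W) (sV : linear_subspace V).
Hypotheses (S_conf : S `<=` Sigma_alpha alpha bd_alpha Gamma) (W_conf : W `<=` clamped_space beta)
  (V_conf : V `<=` V_alpha alpha).
Let ma : measurable alpha := open_measurable_rV oa.
Let mb : measurable beta := open_measurable_rV ob.
Let mG : measurable (@plane R @` Gamma) := measurable_plane oG.
Let X : lmodType R := (Y * P)%type.

Definition pair_space : set X := [set x | S x.1 /\ W x.2].

(** Its norm on stresses and displacements is the triple norm of the theorem. *)
Definition pair_ip (x y : X) : R := div_ip alpha x.1 y.1 + plate_ip beta x.2 y.2.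

Let Hd : S `<=` Hdiv alpha. Proof. by move=> s /S_conf[]. Qed.

Let off : S `<=` normal_trace_off alpha bd_alpha (@plane R @` Gamma). Proof. exact: S_conf. Qed.

Let Wp : W `<=` plate_space beta. Proof. by move=> v /W_conf; exact: clamped_plate. Qed.

Lemma pair_subspace : linear_subspace pair_space.
Proof.
split; first by split; [exact: sS.1|exact: sW.1].
by move=> a x y [Sx Wx] [Sy Wy]; split; [exact: sS.2|exact: sW.2].
Qed.

Lemma pair_sip : semi_inner_product pair_space pair_ip.
Proof.
have s1 := sip_sub (div_sip oa ba) sS Hd; have s2 := sip_sub (plate_sip ob bb) sW Wp.
split; first exact: pair_subspace.
- move=> a x y z [Sx Wx] [Sy Wy] [Sz Wz].
  exact: (linear_comb_add (sip_lin s1 a Sx Sy Sz) (sip_lin s2 a Wx Wy Wz)).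
- move=> x y [Sx Wx] [Sy Wy].
  exact: (congr2 (fun p q => p + q) (sip_sym s1 Sx Sy) (sip_sym s2 Wx Wy)).
- by move=> x [Sx Wx]; apply: addr_ge0; [exact: (sip_ge0 s1)|exact: (sip_ge0 s2)].
Qed.

Let nX : X -> R := snorm pair_ip.

Lemma V_sip : semi_inner_product V (@innerm R 3 (leb R 3) alpha 1 3 : Q -> Q -> R).
Proof. exact: (sip_sub (L2m_sip (leb R 3) ma 1 3) sV V_conf). Qed.

Lemma sqr_pair_norm (x : X) : pair_space x ->
  nX x ^+ 2 = Hdiv_norm alpha x.1 ^+ 2 + plate_norm beta x.2 ^+ 2.
Proof.
move=> Tx; rewrite (sqr_snorm pair_sip Tx) sqr_Hdiv_norm; congr (_ + _).
by rewrite (sqr_snorm (plate_sip ob bb))//; exact: (Wp Tx.2).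
Qed.

Lemma triple_normE (x : X) : pair_space x -> triple_norm alpha beta x.1 x.2 = nX x.
Proof.
move=> Tx; have := sqr_pair_norm Tx; rewrite sqr_plate_norm addrA => h.
by rewrite /triple_norm -h sqrtr_sqr ger0_norm// snorm_ge0.
Qed.

Let nX0 x : 0 <= nX x. Proof. exact: snorm_ge0. Qed.

Lemma Hdiv_le_pair x : pair_space x -> Hdiv_norm alpha x.1 <= nX x.
Proof.
move=> Tx; rewrite -(@ler_pXn2r _ 2)// ?nnegrE ?Hdiv_norm_ge0// (sqr_pair_norm Tx).
by rewrite lerDl; exact: sqr_ge0.
Qed.

Lemma plate_le_pair x : pair_space x -> plate_norm beta x.2 <= nX x.
Proof.
move=> Tx; rewrite -(@ler_pXn2r _ 2)// ?nnegrE ?plate_norm_ge0// (sqr_pair_norm Tx).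
by rewrite lerDr; exact: sqr_ge0.
Qed.

Let A (x y : X) : R := form_a Ea nua Eb nub tb alpha bd_alpha beta hat x.1 x.2 y.1 y.2.
Let b (q : Q) (x : X) : R := form_b alpha q x.1 x.2.
Let pairing (s : Y) (v : P) : R := normal_pairing alpha bd_alpha s (hat v).

Lemma form_aE x y : A x y = compliance Ea nua alpha x.1 y.1 + plate_form Eb nub tb beta x.2 y.2
  + pairing x.1 y.2 - pairing y.1 x.2.
Proof. by rewrite /A /form_a addrA. Qed.

Let hat_half v : W v -> Hhalf alpha bd_alpha (hat v).
Proof. by move=> Wv; have [] := hatP (clamped_H1v (W_conf Wv)). Qed.

Lemma pairing_linl a s t v : S s -> S t -> W v ->
  pairing (a *: s + t) v = a * pairing s v + pairing t v.
Proof.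
move=> Ss St Wv.
exact: (normal_pairing_linl oa ba (off Ss) (off St) (off (sS.2 a s t Ss St)) (hat_half Wv)).
Qed.

(** The extension operator need not be linear, but the normal trace only sees the
    interface, where the extension of a combination is the combination of the
    extensions. *)
Lemma pairing_linr a s u v : S s -> W u -> W v ->
  pairing s (a *: u + v) = a * pairing s u + pairing s v.
Proof.
move=> Ss Wu Wv; have Wuv := sW.2 a u v Wu Wv.
apply: (normal_pairing_linr oa ba mG (off Ss) (hat_half Wu) (hat_half Wv) (hat_half Wuv)).
have [_ eu _] := hatP (clamped_H1v (W_conf Wu)).
have [_ ev _] := hatP (clamped_H1v (W_conf Wv)).
have [_ euv _] := hatP (clamped_H1v (W_conf Wuv)).
apply: filterS3 eu ev euv => x hu hv huv [y Gy xy].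
by rewrite (hu y Gy (esym xy)) (hv y Gy (esym xy)) (huv y Gy (esym xy)).
Qed.

(** It bounds the norm of a clamped field in H1 by its plate norm; it depends on the
    plate only through the size M of a box around it. *)
Definition poincare_cst : R := 3 * ((2 * M + 1) * (4 * M + 1)).

Let Cp0 : 0 <= poincare_cst.
Proof. by rewrite !mulr_ge0// addr_ge0// mulr_ge0. Qed.

Lemma pairing_bound s v : S s -> W v ->
  `|pairing s v| <= 2 * `|Ch| * poincare_cst * Hdiv_norm alpha s * plate_norm beta v.
Proof.
move=> Ss Wv; have [Hh _ hb] := hatP (clamped_H1v (W_conf Wv)).
have h1 := normal_pairing_bound oa ba (off Ss) Hh.
have h2 := clamped_H1v_norm ob bb M0 bM (W_conf Wv).
have h3 : Hhalf_norm alpha bd_alpha (hat v) <= `|Ch| * (poincare_cst * plate_norm beta v).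
  apply: (le_trans hb); apply: (@le_trans _ _ (`|Ch| * H1v_norm beta v)).
    by apply: ler_wpM2r; [exact: sqrtr_ge0|exact: ler_norm].
  by apply: ler_wpM2l.
apply: (le_trans h1).
have h0 : 0 <= 2 * Hdiv_norm alpha s by apply: mulr_ge0; [|exact: Hdiv_norm_ge0].
apply: le_trans (ler_wpM2l h0 h3) _.
by rewrite le_eqVlt; apply/orP; left; apply/eqP; ring.
Qed.

Definition compliance_cst : R := `|(1 + nua) / Ea| + `|- nua / Ea| * 3%:R ^+ 2.

Definition form_cst : R := compliance_cst + plate_bound Eb nub tb
  + 2 * `|Ch| * poincare_cst + 2 * `|Ch| * poincare_cst.

Let pb0 : 0 <= plate_bound Eb nub tb.
Proof. by rewrite /plate_bound !addr_ge0// mulr_ge0// exprn_ge0. Qed.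

Lemma form_cst_ge0 : 0 <= form_cst.
Proof.
have c0 : 0 <= compliance_cst by rewrite addr_ge0// mulr_ge0// exprn_ge0.
have c1 : 0 <= 2 * `|Ch| * poincare_cst by apply: mulr_ge0 => //; exact: mulr_ge0.
exact: addr_ge0 (addr_ge0 (addr_ge0 c0 pb0) c1) c1.
Qed.

Lemma compliance_bound s t : S s -> S t ->
  `|compliance Ea nua alpha s t| <= compliance_cst * Hdiv_norm alpha s * Hdiv_norm alpha t.
Proof.
move=> Ss St; rewrite (complianceE Ea0 nua0 oa (Hd Ss) (Hd St)).
apply: le_trans (isotropic_ip_bound ma _ _ (Hdiv_L2 (Hd Ss)) (Hdiv_L2 (Hd St))) _.
have c0 : 0 <= compliance_cst by rewrite addr_ge0// mulr_ge0// exprn_ge0.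
rewrite -/compliance_cst -!mulrA; apply: ler_wpM2l => //.
by apply: ler_pM; rewrite ?norm0m_ge0 ?norm0m_le_Hdiv.
Qed.

Let pfs : semi_inner_product W (plate_form Eb nub tb beta).
Proof. exact: (sip_sub (plate_form_sip Eb0 nub0 tb0 ob bb) sW Wp). Qed.

Lemma plate_form_bound u v : W u -> W v ->
  `|plate_form Eb nub tb beta u v| <= plate_bound Eb nub tb * plate_norm beta u * plate_norm beta v.
Proof.
move=> Wu Wv; apply: le_trans (cauchy_schwarz pfs Wu Wv) _.
have h w : W w -> snorm (plate_form Eb nub tb beta) w <= Num.sqrt (plate_bound Eb nub tb) * plate_norm beta w.
  move=> Ww; rewrite /plate_norm /snorm -sqrtrM//; apply: ler_wsqrtr.
  exact: (plate_form_le Eb nub tb ob bb (Wp Ww)).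
apply: le_trans (ler_pM (snorm_ge0 _ _) (snorm_ge0 _ _) (h u Wu) (h v Wv)) _.
by rewrite mulrACA -expr2 sqr_sqrtr// mulrA.
Qed.

Lemma form_a_bounded : bounded_form pair_space pair_ip A form_cst.
Proof.
split.
- move=> a x y z [Sx Wx] [Sy Wy] [Sz Wz]; rewrite !form_aE.
  have Sxy := sS.2 a _ _ Sx Sy.
  have e1 := isotropic_ip_linl ma ((1 + nua) / Ea) (- nua / Ea) a
    (Hdiv_L2 (Hd Sx)) (Hdiv_L2 (Hd Sy)) (Hdiv_L2 (Hd Sz)).
  have {}e1 := comb_eq (complianceE Ea0 nua0 oa (Hd Sxy) (Hd Sz)) (complianceE Ea0 nua0 oa (Hd Sx) (Hd Sz))
    (complianceE Ea0 nua0 oa (Hd Sy) (Hd Sz)) e1.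
  exact: (linear_comb_sub (linear_comb_add (linear_comb_add e1 (sip_lin pfs a Wx Wy Wz))
    (pairing_linl a Sx Sy Wz)) (pairing_linr a Sz Wx Wy)).
- move=> a x y z [Sx Wx] [Sy Wy] [Sz Wz]; rewrite !form_aE.
  have Sxy := sS.2 a _ _ Sx Sy.
  have L w (Sw : S w) := Hdiv_L2 (Hd Sw).
  have C w : S w -> compliance Ea nua alpha z.1 w = isotropic_ip alpha ((1 + nua) / Ea) (- nua / Ea) w z.1.
    move=> Sw; rewrite (complianceE Ea0 nua0 oa (Hd Sz) (Hd Sw)).
    exact: (isotropic_ipC ma _ _ (L _ Sz) (L _ Sw)).
  have e1 := comb_eq (C _ Sxy) (C _ Sx) (C _ Sy)
    (isotropic_ip_linl ma ((1 + nua) / Ea) (- nua / Ea) a (L _ Sx) (L _ Sy) (L _ Sz)).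
  exact: (linear_comb_sub (linear_comb_add (linear_comb_add e1 (sip_linr pfs a Wx Wy Wz))
    (pairing_linr a Sz Wx Wy)) (pairing_linl a Sx Sy Wz)).
- move=> x y Tx Ty; have [Sx Wx] := Tx; have [Sy Wy] := Ty; rewrite form_aE.
  have hx := Hdiv_le_pair Tx; have hy := Hdiv_le_pair Ty.
  have px := plate_le_pair Tx; have py := plate_le_pair Ty.
  have d0 s : 0 <= Hdiv_norm alpha s := Hdiv_norm_ge0 _ _.
  have p0 v : 0 <= plate_norm beta v := plate_norm_ge0 _ _.
  have c0 : 0 <= compliance_cst by rewrite addr_ge0// mulr_ge0// exprn_ge0.
  have c1 : 0 <= 2 * `|Ch| * poincare_cst by apply: mulr_ge0 => //; exact: mulr_ge0.
  have e1 := le_trans (compliance_bound Sx Sy) (ler_mul2 c0 (d0 _) (d0 _) hx hy).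
  have e2 := le_trans (plate_form_bound Wx Wy) (ler_mul2 pb0 (p0 _) (p0 _) px py).
  have e3 := le_trans (pairing_bound Sx Wy) (ler_mul2 c1 (d0 _) (p0 _) hx py).
  have e4 : `|pairing y.1 x.2| <= 2 * `|Ch| * poincare_cst * nX x * nX y.
    apply: (le_trans (pairing_bound Sy Wx)); rewrite mulrAC.
    exact: (ler_mul2 c1 (p0 _) (d0 _) px hy).
  exact: ler_norm4 e1 e2 e3 e4.
Qed.

(** On the diagonal the two coupling terms cancel, which leaves the energies of the body
    and of the plate. *)
Lemma form_a_coercive c1 x : 0 < c1 -> pair_space x ->
  c1 * Hdiv_norm alpha x.1 ^+ 2 <= compliance Ea nua alpha x.1 x.1 ->
  Num.min c1 (plate_coer Eb nub tb) * nX x ^+ 2 <= A x x.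
Proof.
move=> c10 Tx h; have [Sx Wx] := Tx; rewrite form_aE addrK (sqr_pair_norm Tx) mulrDr; apply: lerD.
  by apply: le_trans h; apply: ler_wpM2r; [exact: sqr_ge0|rewrite ge_min lexx].
have := plate_form_coercive Eb0 nub0 tb0 ob bb (W_conf Wx); apply: le_trans.
rewrite /plate_norm (sqr_snorm (plate_sip ob bb) (Wp Wx)).
apply: ler_wpM2r; first exact: (sip_ge0 (plate_sip ob bb) (Wp Wx)).
by rewrite ge_min lexx orbT.
Qed.

Lemma form_b_linl a p q x : V p -> V q -> pair_space x -> b (a *: p + q) x = a * b p x + b q x.
Proof.
move=> Vp Vq [Sx _].
exact: (sip_linr (L2m_sip (leb R 3) ma 1 3) a (V_conf Vp) (V_conf Vq) (wdiv_L2 (Hd Sx))).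
Qed.

Lemma form_b_linr a x y q : pair_space x -> pair_space y -> V q ->
  b q (a *: x + y) = a * b q x + b q y.
Proof.
by move=> [Sx _] [Sy _] Vq; exact: (wdiv_lin oa ba a (Hd Sx) (Hd Sy) (V_conf Vq)).
Qed.

Let nQ : Q -> R := snorm (@innerm R 3 (leb R 3) alpha 1 3 : Q -> Q -> R).

Lemma form_b_bound q x : V q -> pair_space x -> `|b q x| <= 1 * nQ q * nX x.
Proof.
move=> Vq Tx; have [Sx _] := Tx.
apply: le_trans (innerm_bound oa (wdiv_L2 (Hd Sx)) (V_conf Vq)) _.
rewrite mul1r mulrC; apply: ler_wpM2l; first exact: norm0m_ge0.
exact: le_trans (norm0m_wdiv_le _ _) (Hdiv_le_pair Tx).
Qed.

(** A stress with zero displacement is enough, since the form b involves the stress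
    only. The supremum need not be attained, whence the factor 1 / 2. *)
Lemma infsup_pair c2 q : 0 < c2 -> (c2%:E <= inf_sup alpha S V)%E -> V q -> nQ q != 0 ->
  exists2 x, pair_space x & 0 < nX x /\ c2 / 2 * nQ q * nX x <= b q x.
Proof.
move=> c20 hc Vq q0.
have : ((c2 / 2)%:E < ereal_sup [set
      (innerm (leb R 3) alpha (wdiv alpha tau) q /
         (norm0m (leb R 3) alpha q * Hdiv_norm alpha tau))%:E
      | tau in [set tau | S tau /\ Hdiv_norm alpha tau != 0%R]])%E.
  apply: (@lt_le_trans _ _ c2%:E); first by rewrite lte_fin ltr_pdivrMr// ltr_pMr// ltr1n.
  by apply: (le_trans hc); apply: ereal_inf_lbound; exists q.
move=> /ereal_sup_gt[_ [tau [St t0] <-]]; rewrite lte_fin => h.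
pose x : X := (tau, 0); have Tx : pair_space x by split; [|exact: sW.1].
have e : nX x = Hdiv_norm alpha tau.
  rewrite Hdiv_normE /nX /snorm /pair_ip.
  rewrite [X in _ + X](_ : _ = 0) ?addr0//.
  exact: (linear_on0 sW (f := (plate_ip beta)^~ 0)
    (fun a u v Wu Wv => sip_lin (plate_sip ob bb) a (Wp Wu) (Wp Wv) (Wp sW.1))).
have tp : 0 < Hdiv_norm alpha tau by rewrite lt0r t0 Hdiv_norm_ge0.
have qp : 0 < nQ q by rewrite lt0r q0 snorm_ge0.
exists x => //; rewrite e; split=> //.
rewrite ltr_pdivlMr in h; last exact: mulr_gt0.
by rewrite -mulrA; exact: ltW.
Qed.

Lemma load_bounded (fb : P) : L2m (leb R 2) beta fb ->
  bounded_functional pair_space nX (fun x => innerm (leb R 2) beta fb x.2)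
    (poincare_cst * norm0m (leb R 2) beta fb).
Proof.
move=> Lf; have L2W v : W v -> L2m (leb R 2) beta v.
  by move=> Wv i j; rewrite ord1; exact: (H1_L2 (clamped_H1v (W_conf Wv) j)).
have Ls := L2m_sip (leb R 2) mb 1 3.
split=> [a x y [_ Wx] [_ Wy]|x Tx].
  exact: (sip_linr Ls a (L2W _ Wx) (L2W _ Wy) Lf).
have [_ Wx] := Tx; apply: le_trans (cauchy_schwarz Ls Lf (L2W _ Wx)) _.
have h : norm0m (leb R 2) beta x.2 <= poincare_cst * nX x.
  apply: le_trans (norm0m_le_H1v beta x.2) _.
  apply: le_trans (clamped_H1v_norm ob bb M0 bM (W_conf Wx)) _.
  exact: (ler_wpM2l Cp0 (plate_le_pair Tx)).
exact: (ler_comb (sqrtr_ge0 _) h).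
Qed.

Lemma body_load_bounded (fa : Q) : L2m (leb R 3) alpha fa ->
  bounded_functional V nQ (fun q => - innerm (leb R 3) alpha fa q) (norm0m (leb R 3) alpha fa).
Proof.
move=> Lf; have Ls := L2m_sip (leb R 3) ma 1 3.
split=> [a p q Vp Vq|q Vq].
  by rewrite (sip_linr Ls a (V_conf Vp) (V_conf Vq) Lf) opprD mulrN.
by rewrite normrN; exact: (cauchy_schwarz Ls Lf (V_conf Vq)).
Qed.

Hypotheses (finS : spans S [set s | div_ip alpha s s = 0])
  (finW : spans W [set v | plate_ip beta v v = 0])
  (finV : spans V [set q | innerm (leb R 3) alpha q q = 0]).

Lemma pair_spans : spans pair_space [set x | nX x = 0].
Proof.
apply: (spans_mono pair_subspace _ (spans_prod sS.1 sW.1 finS finW)) => x _ [x1 x2].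
by apply: snorm0; exact: etrans (congr2 (fun p q => p + q) x1 x2) (addr0 _).
Qed.

Lemma V_spans : spans V [set q | nQ q = 0].
Proof. by apply: (spans_mono sV _ finV) => q _ q0; exact: snorm0. Qed.

(** The plate norm bounds the norm in L2 by the Poincare inequality. *)
Lemma pair_null_ae x : pair_space x -> nX x = 0 ->
  {ae leb R 3, forall y, alpha y -> x.1 y = 0} /\ {ae leb R 2, forall y, beta y -> x.2 y = 0}.
Proof.
move=> Tx x0; have [Sx Wx] := Tx; split.
  have L := Hdiv_L2 (Hd Sx).
  have h : norm0m (leb R 3) alpha x.1 = 0.
    apply/eqP; rewrite eq_le norm0m_ge0 andbT -[X in _ <= X]x0.
    exact: le_trans (norm0m_le_Hdiv _ _) (Hdiv_le_pair Tx).
  apply: (innerm_eq0_ae oa L); rewrite -sqr_norm0m h; exact: expr0n.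
have L : L2m (leb R 2) beta x.2.
  by move=> i j; rewrite ord1; exact: (H1_L2 (clamped_H1v (W_conf Wx) j)).
have h : norm0m (leb R 2) beta x.2 = 0.
  apply/eqP; rewrite eq_le sqrtr_ge0 andbT; apply: le_trans (norm0m_le_H1v beta x.2) _.
  apply: le_trans (clamped_H1v_norm ob bb M0 bM (W_conf Wx)) _.
  apply: le_trans (ler_wpM2l Cp0 (plate_le_pair Tx)) _.
  by rewrite x0 mulr0.
apply: (innerm_eq0_ae ob L); rewrite -sqr_norm0m h; exact: expr0n.
Qed.

Theorem coupled_well_posed c1 c2 fa fb : 0 < c1 -> 0 < c2 ->
  (forall tau, discrete_kernel alpha S V tau ->
     c1 * Hdiv_norm alpha tau ^+ 2 <= compliance Ea nua alpha tau tau) ->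
  (c2%:E <= inf_sup alpha S V)%E ->
  L2m (leb R 3) alpha fa -> L2m (leb R 2) beta fb ->
  let solution := discrete_solution Ea nua Eb nub tb alpha bd_alpha beta hat S V W fa fb in
  exists s w u,
    [/\ solution s w u,
        forall s' w' u', solution s' w' u' ->
          [/\ {ae leb R 3, forall x, alpha x -> s' x = s x},
              {ae leb R 3, forall x, alpha x -> w' x = w x} &
              {ae leb R 2, forall x, beta x -> u' x = u x}] &
        triple_norm alpha beta s u + norm0m (leb R 3) alpha w <=
          brezzi_cst (c2 / 2) form_cst (Num.min c1 (plate_coer Eb nub tb)) *
          (poincare_cst * norm0m (leb R 2) beta fb + norm0m (leb R 3) alpha fa)].
Proof.
move=> c10 c20 coer infs La Lb solution.
have al0 : 0 < Num.min c1 (plate_coer Eb nub tb).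
  by rewrite lt_min c10; exact: plate_coer_gt0.
have kerA x : pair_space x -> (forall q, V q -> b q x = 0) ->
    Num.min c1 (plate_coer Eb nub tb) * nX x ^+ 2 <= A x x.
  by move=> Tx kx; apply: (form_a_coercive c10 Tx); apply: coer; split; [exact: Tx.1|exact: kx].
have f0 : 0 <= poincare_cst * norm0m (leb R 2) beta fb := mulr_ge0 Cp0 (sqrtr_ge0 _).
have g0 : 0 <= norm0m (leb R 3) alpha fa := sqrtr_ge0 _.
have [x [q [[Tx Vq xF xG] uniq bnd]]] := brezzi pair_sip V_sip pair_spans V_spans
  (divr_gt0 c20 (ltr0Sn R 1)) form_b_linl form_b_linr form_b_bound
  (fun q Vq q0 => infsup_pair c20 infs Vq q0) form_cst_ge0 al0 form_a_bounded kerA f0 g0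
  (load_bounded Lb) (body_load_bounded La).
exists x.1, q, x.2; split.
- by split; [exact: Tx.1|exact: Vq|exact: Tx.2|move=> t v St Wv; exact: (xF (t, v))|exact: xG].
- move=> s' w' u' [Ss' Vw' Wu' eF eG].
  have Tx' : pair_space (s', u') by split.
  have [|n1 n2] := uniq (s', u') w'.
    by split; [exact: Tx'|exact: Vw'|move=> y [Sy Wy]; exact: (eF y.1 y.2 Sy Wy)|exact: eG].
  have [a1 a2] := pair_null_ae (subspace_sub pair_subspace Tx' Tx) n1.
  have Vd := subspace_sub sV Vw' Vq; have Ld := V_conf Vd.
  split; [exact: ae_sub_eq0 a1| |exact: ae_sub_eq0 a2].
  apply: ae_sub_eq0; apply: (innerm_eq0_ae oa Ld); rewrite -sqr_norm0m.
  by rewrite [norm0m _ _ _]n2 expr0n.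
- by rewrite (triple_normE Tx).
Qed.

End coupled.

Theorem theorem4p1 (R : realType)
  (alpha : set 'rV[R]_3) (bd_alpha : seq (3.-tuple 'rV[R]_3))
  (beta : set 'rV[R]_2) (bd_beta : seq (2.-tuple 'rV[R]_2))
  (Gamma : set 'rV[R]_2)
  (alpha_polyhedron : polyhedral_domain alpha bd_alpha)
  (beta_polygon : polyhedral_domain beta bd_beta)
  (Gamma_interface : interface alpha beta Gamma)
  (Ea nua Eb nub tb : R)
  (Ea_gt0 : 0 < Ea) (Eb_gt0 : 0 < Eb) (tb_gt0 : 0 < tb)
  (nua_itv : 0 < nua < 1 / 2) (nub_itv : 0 < nub < 1 / 2)
  (* the extension operator v |-> \hat v *)
  (hat : ('rV[R]_2 -> 'rV[R]_3) -> ('rV[R]_3 -> 'rV[R]_3))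
  (hat_bounded : bounded_extension alpha bd_alpha beta Gamma hat)
  (H : Type) (kappa : R)
  (Ta : H -> seq (4.-tuple 'rV[R]_3)) (Tb : H -> seq (3.-tuple 'rV[R]_2))
  (Ta_mesh : forall h, triangulates (Ta h) (closure alpha))
  (Tb_mesh : forall h, triangulates (Tb h) (closure beta))
  (Ta_regular : forall h, shape_regular kappa (Ta h))
  (Tb_regular : forall h, shape_regular kappa (Tb h))
  (Sh : H -> set ('rV[R]_3 -> 'M[R]_3))
  (Vh : H -> set ('rV[R]_3 -> 'rV[R]_3))
  (W1h : H -> set ('rV[R]_2 -> 'rV[R]_2))
  (W2h : H -> set ('rV[R]_2 -> R^o))
  (Sh_fe : forall h, fe_space alpha (Ta h) (Sh h))
  (Vh_fe : forall h, fe_space alpha (Ta h) (Vh h))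
  (W1h_fe : forall h, fe_space beta (Tb h) (W1h h))
  (W2h_fe : forall h, fe_space beta (Tb h) (W2h h))
  (Sh_conf : forall h, Sh h `<=` Sigma_alpha alpha bd_alpha Gamma)
  (Vh_conf : forall h, Vh h `<=` V_alpha alpha)
  (W1h_conf : forall h w, W1h h w -> forall I, H10 beta (fun x => w x ord0 I))
  (W2h_conf : forall h, W2h h `<=` H20 beta bd_beta)
  (c1 c2 : R) (c1_gt0 : 0 < c1) (c2_gt0 : 0 < c2)
  (coercive : forall h tau, discrete_kernel alpha (Sh h) (Vh h) tau ->
     c1 * Hdiv_norm alpha tau ^+ 2 <= compliance Ea nua alpha tau tau)
  (infsup : forall h, (c2%:E <= inf_sup alpha (Sh h) (Vh h))%E) :
  exists2 C : R, 0 < C &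
    forall h (fa : 'rV[R]_3 -> 'rV[R]_3) (fb : 'rV[R]_2 -> 'rV[R]_3),
    L2m (leb R 3) alpha fa -> L2m (leb R 2) beta fb ->
    let solution := discrete_solution Ea nua Eb nub tb alpha bd_alpha beta hat
                      (Sh h) (Vh h) (product_space (W1h h) (W2h h)) fa fb in
    exists s w u,
      [/\ solution s w u,
          forall s' w' u', solution s' w' u' ->
            [/\ {ae leb R 3, forall x, alpha x -> s' x = s x},
                {ae leb R 3, forall x, alpha x -> w' x = w x} &
                {ae leb R 2, forall x, beta x -> u' x = u x}] &
          triple_norm alpha beta s u + norm0m (leb R 3) alpha w <=
            C * (norm0m (leb R 3) alpha fa + norm0m (leb R 2) beta fb)].
Proof.
have [[oa _ _ ba] _ _ _] := alpha_polyhedron.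
have [[ob _ _ bb] _ _ _] := beta_polygon.
have [[_ [[oG _ _ _] _ _ _]] _ _] := Gamma_interface.
have [M M0 bM] := bounded_setP bb; have [Ch hatP] := hat_bounded.
pose k := brezzi_cst (c2 / 2) (form_cst Ea nua Eb nub tb Ch M) (Num.min c1 (plate_coer Eb nub tb)).
have P0 : 0 <= poincare_cst M by rewrite !mulr_ge0// addr_ge0// mulr_ge0.
exists (`|k| * (poincare_cst M + 1) + 1) => [|h fa fb La Lb].
  by apply: ltr_wpDl => //; rewrite mulr_ge0// addr_ge0.
have sS := fe_subspace (Sh_fe h); have sV := fe_subspace (Vh_fe h).
have sW := product_subspace (W1h_fe h) (W2h_fe h).
have S_null : spans (Sh h) [set s | div_ip alpha s s = 0].
  apply: (fe_spans (Sh_fe h)) => s Ss s0; have [Hs _] := Sh_conf h s Ss.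
  exact: (null_div_ip oa ba Hs s0).
have V_null : spans (Vh h) [set q | innerm (leb R 3) alpha q q = 0].
  apply: (fe_spans (Vh_fe h)) => q Vq q0; have Lq := Vh_conf h q Vq.
  exact: (null_innerm oa Lq Lq q0).
have W_null := product_spans ob bb (W1h_fe h) (W2h_fe h) (@W1h_conf h) (W2h_conf h).
have W_conf := product_clamped (@W1h_conf h) (W2h_conf h).
have [s [w [u [sol uniq bnd]]]] := coupled_well_posed oa ba ob bb oG Ea_gt0 Eb_gt0 tb_gt0
  nua_itv nub_itv hatP M0 bM sS sW sV (Sh_conf h) W_conf (Vh_conf h) S_null W_null V_null
  c1_gt0 c2_gt0 (coercive h) (infsup h) La Lb.
exists s, w, u; split; [exact: sol|exact: uniq|].
exact: le_trans bnd (absorb_constant k P0 (sqrtr_ge0 _) (sqrtr_ge0 _)).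
Qed.
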